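(* Consider $s+1$ scalar Gaussian channels from one transmitter, $Y_r[t]=\sqrt{h_r}\,X[t]+Z_r[t]$ for $r\in\{0,\dots,s\}$. Let $P_1,\dots,P_s\ge 0$ with $\sum_{i=1}^sP_i\le P_{\max}$, put $I_i:=\sum_{j=i+1}^sP_j$, and define for $i=1,\dots,s$ $$R_i=\frac12\Big[\log\Big(1+\frac{h_iP_i}{1+h_iI_i}\Big)-\log\Big(1+\frac{h_{i-1}P_i}{1+h_{i-1}I_i}\Big)\Big].$$ Then $(R_1,\dots,R_s)$ is achievable for the nested-message-set degraded wiretap problem described in the context.
   Context: Channel model: - $Z_r[t]\sim N(0,1)$ are i.i.d. over $t$. - $0<h_0<h_1<\cdots<h_s$ are constants. - The input must satisfy $\frac1L\sum_{t=1}^L\mathbb E[X[t]^2]\le P_{\max}$. Messages: $W_1,\dots,W_s$ are independent, with $W_i$ uniform on $\{1,\dots,2^{LR_i}\}$. A rate tuple $(R_1,\dots,R_s)$ is achievable if for every $\epsilon>0$ and all sufficiently large block length $L$ there exist: - a (possibly randomized) encoder mapping $(W_1,\dots,W_s)$ to $X^{L}=(X[1],\dots,X[L])$ that satisfies the power constraint, and - for each $j\in\{1,\dots,s\}$, a decoder at receiver $j$ that outputs estimates of $W_1,\dots,W_j$ from $Y_j^L$, such that: - (i) each message $W_i$ is decoded correctly by every receiver $Y_i,\dots,Y_s$ with error probability at most $\epsilon$; - (ii) $\frac1L I(W_{i+1},\dots,W_s;Y_i^{L})\le\epsilon$ for every $i\in\{0,\dots,s\}$. Logarithms are base 2. *)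

(* Defs.v *)
From mathcomp Require Import all_boot all_order all_algebra.
From mathcomp Require Import all_classical all_reals all_analysis.
Set Implicit Arguments. Unset Strict Implicit. Unset Printing Implicit Defensive.
Import Order.TTheory GRing.Theory Num.Theory.
Local Open Scope classical_set_scope.
Local Open Scope ring_scope.

Definition log2 {R : realType} (x : R) : R := ln x / ln 2.

Definition msg_num {R : realType} (L : nat) (r : R) : nat :=
  `|Num.ceil (2 `^ (L%:R * r))|%N.

(* Integral w.r.t. Lebesgue measure on R^L (points are L-tuples), for
   nonnegative integrands, as the iterated integral (= product-Lebesgue
   integral for measurable integrands, by Tonelli). *)
Fixpoint intL {R : realType} (n : nat) : (n.-tuple R -> \bar R) -> \bar R :=
  match n return (n.-tuple R -> \bar R) -> \bar R with
  | 0 => fun F => F [tuple]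
  | n'.+1 => fun F =>
      (\int[@lebesgue_measure R]_(y in setT)
          intL (fun t : n'.-tuple R => F [tuple of y :: t]))%E
  end.

Definition intRL {R : realType} (n : nat) (F : n.-tuple R -> \bar R) : \bar R :=
  (intL (fun y => maxe (F y) 0) - intL (fun y => maxe (- F y) 0))%E.

Definition KL {R : realType} (n : nat) (p q : n.-tuple R -> \bar R) : \bar R :=
  intRL (fun y => (fine (p y) * ln (fine (p y) / fine (q y)))%:E).

(* Sum of the powers of the messages with (paper) index > i;
   here k : 'I_s stands for the paper's index k+1. *)
Definition interf {R : realType} (s : nat) (P : 'I_s -> R) (k : 'I_s) : R :=
  \sum_(j < s | (k < j)%N) P j.

(* The rates of the theorem: rate k = R_{k+1} of the paper; h i is h_i for
   i = 0..s. *)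
Definition rate {R : realType} (s : nat) (h : 'I_s.+1 -> R) (P : 'I_s -> R)
    (k : 'I_s) : R :=
  let hi := h (lift ord0 k) in
  let hi1 := h (widen_ord (leqnSn s) k) in
  2^-1 * (log2 (1 + hi * P k / (1 + hi * interf P k))
          - log2 (1 + hi1 * P k / (1 + hi1 * interf P k))).

(* message space: W = (W_1, ..., W_s), W_{k+1} in 'I_(M k) *)
Definition msgspace (s : nat) (M : 'I_s -> nat) : finType :=
  {dffun forall k : 'I_s, 'I_(M k)}.

Section Channel.
Variables (R : realType) (s L : nat) (M : 'I_s -> nat) (h : 'I_s.+1 -> R).
Variable enc : msgspace M -> probability (L.-tuple R) R.

(* conditional density of Y_r^L given W = w:
   y |-> E_{X ~ enc w} prod_t phi(y_t - sqrt(h_r) X_t), phi = N(0,1) pdf *)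
Definition out_dens (r : 'I_s.+1) (w : msgspace M) (y : L.-tuple R) : \bar R :=
  (\int[enc w]_(x in setT)
     (\prod_(t < L) normal_pdf 0 1 (tnth y t - Num.sqrt (h r) * tnth x t))%:E)%E.

Definition nmsg : R := (#|{: msgspace M}|)%:R.

Definition marg_dens (r : 'I_s.+1) (y : L.-tuple R) : \bar R :=
  ((nmsg^-1)%:E * \sum_(w : msgspace M) out_dens r w y)%E.

(* density of Y_r^L given (W_{i+1},...,W_s) = (w_{i+1},...,w_s), for i = val r *)
Definition cond_dens (r : 'I_s.+1) (w : msgspace M) (y : L.-tuple R) : \bar R :=
  let C := [pred w' : msgspace M | [forall k : 'I_s, (r <= k)%N ==> (w' k == w k)]] in
  (((#|C|)%:R^-1)%:E * \sum_(w' in C) out_dens r w' y)%E.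

(* I(W_{i+1},...,W_s ; Y_i^L) in bits, i = val r *)
Definition secrecy_MI (r : 'I_s.+1) : \bar R :=
  (((nmsg * ln 2)^-1)%:E *
     \sum_(w : msgspace M) KL (cond_dens r w) (marg_dens r))%E.

Definition err_prob (g : L.-tuple R -> msgspace M) (r : 'I_s.+1) (k : 'I_s)
  : \bar R :=
  ((nmsg^-1)%:E *
    \sum_(w : msgspace M)
       intL (fun y => if g y k != w k then out_dens r w y else 0))%E.

Definition avg_power : \bar R :=
  (((L%:R * nmsg)^-1)%:E *
     \sum_(w : msgspace M) \sum_(t < L) \int[enc w]_(x in setT) ((tnth x t) ^+ 2)%:E)%E.
End Channel.

(* Achievability of the rate tuple Rt for the nested-message-set degraded
   Gaussian wiretap problem. Receivers r = 0..s (type 'I_s.+1); message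
   k : 'I_s is the paper's W_{k+1}; receiver r decodes W_1..W_r, i.e. the
   k with k < r. *)
Definition achievable {R : realType} (s : nat) (h : 'I_s.+1 -> R) (Pmax : R)
    (Rt : 'I_s -> R) : Prop :=
  forall eps : R, 0 < eps ->
  exists N : nat, forall L : nat, (N <= L)%N ->
    let M := fun k => msg_num L (Rt k) in
    exists (enc : msgspace M -> probability (L.-tuple R) R)
           (dec : 'I_s.+1 -> L.-tuple R -> msgspace M),
      (avg_power enc <= Pmax%:E)%E /\
      (forall r w, measurable (dec r @^-1` [set w])) /\
      (forall (r : 'I_s.+1) (k : 'I_s), (k < r)%N ->
          (err_prob h enc (dec r) r k <= eps%:E)%E) /\
      (forall r : 'I_s.+1, ((L%:R^-1)%:E * secrecy_MI h enc r <= eps%:E)%E).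

(* Main.v *)
(* Random Gaussian superposition coding. Layer k carries the message w_k and a
   local randomization v_k with e^{L(I_k(h_k) - 4 delta)} values, where
   I_k(eta) = 1/2 ln((1 + eta S_k)/(1 + eta S_{k+1})) with S_k the sum of the
   powers P_j, j >= k, is the information of layer k at gain eta. Writing D_k
   for the output density given the words of the layers below k (the others
   acting as Gaussian noise), all error events are controlled by the likelihood
   ratios D_{k+1}/D_k, whose exponential moments are explicit.

   Decoding: receiver r > k tests D_{k+1}/D_k for each layer against
   e^{L(I_k(h_r) - delta)}; the words of layer k number about
   e^{L(I_k(h_{k+1}) - 4 delta)}, and I_k is increasing in the gain.

   Secrecy: by the log-sum inequality the leakage to receiver r is at most the
   sum over k >= r of E ln(1 + (V_k^{-1} sum_v D_{k+1}(v)) / D_k), the sum being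
   over the V_k words of layer k that share the message w_k. Wrong words
   contribute at most 1 each layer in expectation, and the true one O(delta L),
   since V_k exceeds e^{L(I_k(h_r) - 4 delta)} when h_r <= h_k.

   Power: the powers are shrunk by e^{-delta}, and an exponential moment of the
   output energy at receiver 0 bounds the input energy of the chosen code. A
   code meeting all these bounds at once exists by Markov's inequality. *)
Require Import Defs.
From HB Require Import structures.
From mathcomp Require Import all_boot all_order all_algebra.
From mathcomp Require Import all_classical all_reals all_analysis.
From mathcomp Require Import measurable_realfun ring lra.
Set Implicit Arguments. Unset Strict Implicit. Unset Printing Implicit Defensive.
Import Order.TTheory GRing.Theory Num.Theory.
Local Open Scope classical_set_scope.
Local Open Scope ring_scope.

(** * Product laws *)

(** Every estimate concerns the integral of a nonnegative measurable function, so Tonelli is the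
    only exchange of integrals required and integrability never has to be shown. The obstacle is the
    logarithm in the leakage, which changes sign and is unbounded. It is removed in two moves:
    adding the marginal density makes each relative-entropy integrand nonnegative, and [ln (1 + z)]
    is bounded by a constant plus an exponential of the log-likelihood ratio. Decoding and secrecy
    then rest on one estimate: the exponential moment of order [c] of a log-likelihood ratio is at
    most [expR (L * (c * info + 4 * c ^+ 2))], used with [c = - rho] for decoding and [c = rho] for
    secrecy. With [rho = delta / 8] the quadratic term is [rho * delta / 2], half of what the margin
    [delta] left by the code sizes provides in either case. All words are independent, so each
    expectation reduces to redrawing single words while the others stay frozen; no typical sets
    appear. *)

Definition tset {T : Type} {n : nat} (t : n.-tuple T) (i : 'I_n) (x : T) :
    n.-tuple T := [tuple if j == i then x else tnth t j | j < n].

Lemma tnth_tset (T : Type) n (t : n.-tuple T) i x j :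
  tnth (tset t i x) j = if j == i then x else tnth t j.
Proof. by rewrite tnth_mktuple. Qed.

Lemma measurable_fun_tnth d1 d2 (T1 : measurableType d1) (T2 : measurableType d2)
    n (f : T1 -> n.-tuple T2) (i : 'I_n) :
  measurable_fun setT f -> measurable_fun setT (fun x => tnth (f x) i).
Proof. by move/measurable_fun_tnthP/(_ i). Qed.

Lemma integral_prob_cst d (T : measurableType d) (R : realType)
  (P : probability T R) (c : \bar R) : (\int[P]_x c = c)%E.
Proof.
transitivity (c * P setT)%E; last by rewrite probability_setT mule1.
exact: integral_cst.
Qed.

Section fubini.
Context d1 d2 (T1 : measurableType d1) (T2 : measurableType d2) (R : realType).
Variables (m1 : {sigma_finite_measure set T1 -> \bar R})
  (m2 : {sigma_finite_measure set T2 -> \bar R}).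
Variable F : T1 -> T2 -> \bar R.
Hypothesis mF : measurable_fun setT (fun p => F p.1 p.2).
Hypothesis F0 : forall x y, (0 <= F x y)%E.

Lemma integral_swap :
  (\int[m1]_x \int[m2]_y F x y = \int[m2]_y \int[m1]_x F x y)%E.
Proof. exact: (@fubini_tonelli _ _ _ _ _ m1 m2 _ mF (fun p => F0 p.1 p.2)). Qed.

Lemma measurable_integral2 :
  measurable_fun setT (fun x => \int[m2]_y F x y)%E.
Proof. exact: (@measurable_fun_fubini_tonelli_F _ _ _ _ _ m2 _ mF (fun p => F0 p.1 p.2)). Qed.

Lemma measurable_integral1 :
  measurable_fun setT (fun y => \int[m1]_x F x y)%E.
Proof. exact: (@measurable_fun_fubini_tonelli_G _ _ _ _ _ m1 _ mF (fun p => F0 p.1 p.2)). Qed.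

End fubini.

Section iid.
Context d (T : measurableType d) (R : realType) (P : probability T R).
Local Open Scope ereal_scope.

Definition tcons n (xt : T * n.-tuple T) : n.+1.-tuple T :=
  [tuple of xt.1 :: xt.2].

Lemma measurable_tcons n : measurable_fun setT (@tcons n).
Proof. exact: measurable_cons. Qed.

HB.instance Definition _ n :=
  isMeasurableFun.Build _ _ _ _ (@tcons n) (@measurable_tcons n).

(** Built by pushing binary products forward along [tcons], so that Tonelli for two factors, applied
    coordinate by coordinate, computes integrals over tuples. *)
Fixpoint iid n : probability (n.-tuple T) R :=
  match n with
  | 0 => [the probability _ _ of dirac ([tuple] : 0.-tuple T)]
  | n'.+1 => [the probability _ _ of distribution (P \x iid n')
               [the {mfun (T * n'.-tuple T)%type >-> n'.+1.-tuple T} of @tcons n']]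
  end.

Lemma integral_iidS n (F : n.+1.-tuple T -> \bar R) :
  measurable_fun setT F -> (forall t, 0 <= F t) ->
  \int[iid n.+1]_t F t = \int[P]_x \int[iid n]_t F [tuple of x :: t].
Proof.
move=> mF F0.
rewrite [LHS](ge0_integral_distribution (P := (P \x iid n))
  [the {mfun (T * n.-tuple T)%type >-> n.+1.-tuple T} of @tcons n])//.
rewrite fubini_tonelli1//.
  by apply: (measurableT_comp mF); exact: measurable_tcons.
by move=> p; exact: F0.
Qed.

Lemma measurable_tset n (i : 'I_n) :
  measurable_fun setT (fun p : n.-tuple T * T => tset p.1 i p.2).
Proof.
apply/measurable_fun_tnthP => j.
rewrite (_ : _ \o _ = fun p : n.-tuple T * T => if j == i then p.2 else tnth p.1 j).
  have [_|_] := eqVneq j i; first exact: measurable_snd.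
  exact: (measurable_fun_tnth j measurable_fst).
by apply/funext => p /=; rewrite tnth_tset.
Qed.

(** A coordinate may be redrawn from [P] without changing the law. This takes the place of
    conditional expectation: averaging over one codeword with all others fixed is the inner integral
    on the right. *)
Lemma integral_iid_tset n (i : 'I_n) (F : n.-tuple T -> \bar R) :
  measurable_fun setT F -> (forall t, 0 <= F t) ->
  \int[iid n]_t F t = \int[iid n]_t \int[P]_x F (tset t i x).
Proof.
elim: n i F => [[]//|n IH] i F mF F0.
have mcons x : measurable_fun setT (fun t : n.-tuple T => [tuple of x :: t]).
  exact: measurable_cons.
have mFs : measurable_fun setT (fun p : n.+1.-tuple T * T => F (tset p.1 i p.2)).
  exact: (measurableT_comp mF (@measurable_tset _ i)).
rewrite [RHS]integral_iidS//; last 2 first.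
- exact: (measurable_integral2 P mFs).
- by move=> t; exact: integral_ge0.
rewrite [LHS](integral_iidS mF F0).
case: (unliftP ord0 i) => [j|] ->.
  apply: eq_integral => x _; rewrite (IH j _ (measurableT_comp mF (mcons x)) (fun t => F0 _)).
  apply: eq_integral => t _; apply: eq_integral => z _; congr F.
  apply: eq_from_tnth => k; rewrite tnth_tset.
  case: (unliftP ord0 k) => [l|] ->; last by rewrite !tnth0.
  by rewrite !tnthS tnth_tset (inj_eq lift_inj).
(* Redrawing the head: its old value no longer occurs, so the outer integral is that of a
   constant. *)
set G := fun x => \int[iid n]_t F [tuple of x :: t].
transitivity (\int[P]_(z in setT) \int[P]_x G x).
  by rewrite integral_prob_cst.
apply: eq_integral => x _.
rewrite (@integral_swap _ _ _ _ _ P (iid n) (fun z t => F [tuple of z :: t])); last 2 first.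
  - by apply: (measurableT_comp mF); exact: measurable_tcons.
  - by move=> *; exact: F0.
  apply: eq_integral => t _; apply: eq_integral => z _; congr F.
    apply: eq_from_tnth => k; rewrite tnth_tset.
    by case: (unliftP ord0 k) => [l|] ->; rewrite ?tnth0 // !tnthS.
Qed.

Lemma emeasurable_prod d' (T' : measurableType d') (I : Type) (s : seq I)
    (f : I -> T' -> \bar R) :
  (forall i, measurable_fun setT (f i)) ->
  measurable_fun setT (fun x => \prod_(i <- s) f i x).
Proof.
move=> mf; elim: s => [|i s IH].
  rewrite (_ : (fun x => _) = cst 1); first exact: measurable_cst.
  by apply/funext => x; rewrite big_nil.
rewrite (_ : (fun x => _) = fun x => f i x * \prod_(j <- s) f j x).
  exact: emeasurable_funM.
by apply/funext => x; rewrite big_cons.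
Qed.

Lemma integral_iid_prod n (f : 'I_n -> T -> \bar R) :
  (forall i, measurable_fun setT (f i)) -> (forall i x, 0 <= f i x) ->
  \int[iid n]_t \prod_(i < n) f i (tnth t i) = \prod_(i < n) \int[P]_x f i x.
Proof.
elim: n f => [|n IH] f mf f0.
  rewrite big_ord0; under eq_integral do rewrite big_ord0.
  by rewrite integral_prob_cst.
have p0 m (g : 'I_m -> T -> \bar R) (t : m.-tuple T) :
    (forall i x, 0 <= g i x) -> 0 <= \prod_(i < m) g i (tnth t i).
  by move=> g0; apply: prode_ge0 => i _.
rewrite integral_iidS//; last 2 first.
- by apply: emeasurable_prod => i; apply: (measurableT_comp (mf i)); exact: (@measurable_fun_tnth _ _ _ _ _ id _ (@measurable_id _ _ setT)).
- by move=> t; exact: p0.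
rewrite big_ord_recl -IH//.
rewrite -ge0_integralZr//.
- apply: eq_integral => x _.
  rewrite -ge0_integralZl//.
  + apply: eq_integral => t _; rewrite big_ord_recl tnth0.
    by congr (_ * _); apply: eq_bigr => i _; rewrite tnthS.
  + by apply: emeasurable_prod => i; apply: (measurableT_comp (mf _)); exact: (@measurable_fun_tnth _ _ _ _ _ id _ (@measurable_id _ _ setT)).
  + by move=> t _; exact: (p0 _ (fun i => f (lift ord0 i))).
- by apply: integral_ge0 => t _; exact: (p0 _ (fun i => f (lift ord0 i))).
Qed.

End iid.

(** * Gaussian integrals *)

Section gaussian.
Context {R : realType}.
Implicit Types v z m a : R.
Local Notation mu := (@lebesgue_measure R).

(** Centred Gaussian density parametrised by the variance rather than the deviation, so that
    convolution adds parameters. *)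
Definition gauss v z : R := (Num.sqrt (v * pi *+ 2))^-1 * expR (- z ^+ 2 / (v *+ 2)).

Lemma normal_pdf_gauss v m z : 0 < v -> normal_pdf m (Num.sqrt v) z = gauss v (z - m).
Proof.
move=> v0; rewrite normal_pdfE ?gt_eqF ?sqrtr_gt0// /normal_peak /normal_fun.
by rewrite sqr_sqrtr ?ltW.
Qed.

Lemma gauss_gt0 v z : 0 < v -> 0 < gauss v z.
Proof.
move=> v0; rewrite mulr_gt0 ?expR_gt0// invr_gt0 sqrtr_gt0 pmulrn_lgt0//.
by rewrite mulr_gt0 ?pi_gt0.
Qed.

Lemma measurable_gauss v : measurable_fun setT (gauss v).
Proof.
apply: measurable_funM => //; apply: measurableT_comp => //.
apply: measurable_funM => //; apply: measurableT_comp => //.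
Qed.

Lemma measurable_fun_gauss d (T : measurableType d) v (f : T -> R) :
  measurable_fun setT f -> measurable_fun setT (fun x => gauss v (f x)).
Proof. by move=> mf; exact: (measurableT_comp (measurable_gauss v) mf). Qed.

Lemma integral_gauss v m : 0 < v -> (\int[mu]_y (gauss v (y - m))%:E = 1)%E.
Proof.
move=> v0; rewrite -(integral_normal_pdf m (Num.sqrt v)).
by apply: eq_integral => y _; rewrite normal_pdf_gauss.
Qed.

Lemma integral_normal_prob (f : R -> \bar R) :
  measurable_fun setT f -> (forall x, 0 <= f x)%E ->
  (\int[normal_prob 0 1]_x f x = \int[mu]_x (f x * (gauss 1 x)%:E))%E.
Proof.
move=> mf f0.
have dom : normal_prob (0:R) 1 `<< mu by exact: normal_prob_dominates.
rewrite -(Radon_Nikodym_SigmaFinite.change_of_variables dom f0 measurableT mf).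
apply: ae_eq_integral => //.
- apply: emeasurable_funM => //; apply: (measurable_int mu).
  exact: Radon_Nikodym_SigmaFinite.f_integrable.
- by apply: emeasurable_funM => //; apply/measurable_EFinP; exact: measurable_gauss.
(* The Radon-Nikodym derivative is determined only up to null sets; it is identified with [gauss 1]
   because both integrate to the normal law on every measurable set. *)
- apply: ae_eqe_mul2l => /=.
  apply: integral_ae_eq => //.
  + exact: Radon_Nikodym_SigmaFinite.f_integrable.
  + by apply/measurable_EFinP; exact: measurable_gauss.
  + move=> E _ mE; rewrite -Radon_Nikodym_SigmaFinite.f_integral//.
    apply: eq_integral => x _; rewrite -[X in gauss _ X]subr0 -normal_pdf_gauss//.
    by rewrite sqrtr1.
Qed.

Lemma gauss_const v w v' w' : 0 < v -> 0 < v' -> v * w = v' * w' ->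
  (Num.sqrt (v * pi *+ 2))^-1 * (Num.sqrt (w * pi *+ 2))^-1 =
  (Num.sqrt (v' * pi *+ 2))^-1 * (Num.sqrt (w' * pi *+ 2))^-1 :> R.
Proof.
move=> v0 v'0 e; rewrite -!invfM -!sqrtrM; first last.
- by rewrite mulrn_wge0// mulr_ge0 ?pi_ge0 ?ltW.
- by rewrite mulrn_wge0// mulr_ge0 ?pi_ge0 ?ltW.
congr (Num.sqrt _)^-1.
transitivity (v * w * (pi *+ 2) ^+ 2); first by ring.
by rewrite e; ring.
Qed.

(** Bayes' rule for a standard Gaussian prior on [x], by completing the square: the first factor on
    the right is the evidence, the second the posterior. *)
Lemma gaussM v a x z : 0 < v ->
  gauss v (z - a * x) * gauss 1 x =
  gauss (v + a ^+ 2) z * gauss (v / (v + a ^+ 2)) (x - a * z / (v + a ^+ 2)).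
Proof.
move=> v0; have va0 : 0 < v + a ^+ 2 by rewrite ltr_pwDl ?sqr_ge0.
have va0' : v + a ^+ 2 != 0 by rewrite gt_eqF.
rewrite /gauss mulrACA [RHS]mulrACA; congr (_ * _); first last.
  rewrite -!expRD; congr expR; field.
  by rewrite va0' gt_eqF.
by apply: gauss_const => //; rewrite mulr1 mulrC mulfVK.
Qed.

Lemma integral_gauss_shift v a z : 0 < v ->
  (\int[normal_prob 0 1]_x (gauss v (z - a * x))%:E = (gauss (v + a ^+ 2) z)%:E)%E.
Proof.
move=> v0; have va0 : 0 < v + a ^+ 2 by rewrite ltr_pwDl ?sqr_ge0.
rewrite integral_normal_prob; last 2 first.
- apply/measurable_EFinP/measurable_fun_gauss; apply: measurable_funB => //.
- by move=> x; rewrite lee_fin ltW// gauss_gt0.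
under eq_integral do rewrite -EFinM gaussM// EFinM.
rewrite ge0_integralZl//.
- by rewrite integral_gauss ?mule1// divr_gt0.
- by apply/measurable_EFinP/measurable_fun_gauss; exact: measurable_funB.
- by move=> x _; rewrite lee_fin ltW// gauss_gt0// divr_gt0.
- by rewrite lee_fin ltW// gauss_gt0.
Qed.

(** Tilting by a multiple of the square only rescales the variance; the remaining mass is the moment
    generating function of a chi-square variable with one degree of freedom. *)
Lemma gauss_expR v s z : 0 < v -> s < 2^-1 ->
  gauss v z * expR (s * (z ^+ 2 / v)) =
  (Num.sqrt (1 - s * 2))^-1 * gauss (v / (1 - s * 2)) z.
Proof.
move=> v0 s2; have s0 : 0 < 1 - s * 2 by rewrite subr_gt0 -ltr_pdivlMr// mul1r.
have s0' : 1 - s * 2 != 0 by rewrite gt_eqF.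
rewrite /gauss -[LHS]mulrA -expRD [RHS]mulrA; congr (_ * expR _); last first.
  by field; rewrite ?s0' gt_eqF.
rewrite -invfM -sqrtrM ?ltW//; congr (Num.sqrt _)^-1.
by field.
Qed.

Lemma integral_gauss_expR v s m : 0 < v -> s < 2^-1 ->
  (\int[mu]_y (gauss v (y - m) * expR (s * ((y - m) ^+ 2 / v)))%:E =
   ((Num.sqrt (1 - s * 2))^-1)%:E)%E.
Proof.
move=> v0 s2; have s0 : 0 < 1 - s * 2 by rewrite subr_gt0 -ltr_pdivlMr// mul1r.
under eq_integral do rewrite gauss_expR// EFinM.
rewrite ge0_integralZl//.
- by rewrite integral_gauss ?mule1// divr_gt0.
- by apply/measurable_EFinP/measurable_fun_gauss; exact: measurable_funB.
- by move=> x _; rewrite lee_fin ltW// gauss_gt0// divr_gt0.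
Qed.

Lemma gauss_expR_shift s m y : s < 2^-1 ->
  gauss 1 (y - m) * expR (s * y ^+ 2) =
  (Num.sqrt (1 - s * 2))^-1 * expR (s * m ^+ 2 / (1 - s * 2)) *
  gauss (1 - s * 2)^-1 (y - m / (1 - s * 2)).
Proof.
move=> s2; have s0 : 0 < 1 - s * 2 by rewrite subr_gt0 -ltr_pdivlMr// mul1r.
have s0' : 1 - s * 2 != 0 by rewrite gt_eqF.
rewrite /gauss -[LHS]mulrA -expRD [RHS]mulrACA -expRD; congr (_ * expR _); last first.
  by field; rewrite ?s0'.
rewrite -invfM -sqrtrM ?ltW//; congr (Num.sqrt _)^-1.
by field.
Qed.

Lemma integral_gauss_expR_shift s m : s < 2^-1 ->
  (\int[mu]_y (gauss 1 (y - m) * expR (s * y ^+ 2))%:E =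
   ((Num.sqrt (1 - s * 2))^-1 * expR (s * m ^+ 2 / (1 - s * 2)))%:E)%E.
Proof.
move=> s2; have s0 : 0 < 1 - s * 2 by rewrite subr_gt0 -ltr_pdivlMr// mul1r.
under eq_integral do rewrite gauss_expR_shift// EFinM.
rewrite ge0_integralZl//.
- by rewrite integral_gauss ?mule1// invr_gt0.
- by apply/measurable_EFinP/measurable_fun_gauss; exact: measurable_funB.
- by move=> x _; rewrite lee_fin ltW// gauss_gt0// invr_gt0.
Qed.

(** The linear coefficient is the exact derivative at [0], which lets first-order terms cancel when
    two tilts of opposite sign are added; the quadratic coefficient is rounded up. *)
Lemma invsqrt1B_le (x : R) : `|x| <= 2^-1 -> (Num.sqrt (1 - x))^-1 <= 1 + x / 2 + x ^+ 2.
Proof.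
rewrite ler_norml => /andP[x1 x2].
have b0 : 0 < 1 + x / 2 + x ^+ 2 by nra.
have x0 : 0 < 1 - x by lra.
rewrite -[leLHS]mul1r ler_pdivrMr ?sqrtr_gt0//.
rewrite -(@ler_pXn2r _ 2) ?nnegrE ?mulr_ge0 ?sqrtr_ge0 ?(ltW b0)//.
rewrite exprMn sqr_sqrtr ?(ltW x0)// expr1n -subr_ge0.
have -> : (1 + x / 2 + x ^+ 2) ^+ 2 * (1 - x) - 1 = x ^+ 2 * (5 / 4 - 5 / 4 * x - x ^+ 3).
  by field.
rewrite mulr_ge0 ?sqr_ge0// subr_ge0.
nra.
Qed.

End gaussian.

(* The library's normal law lives on [measurableTypeR R]; this transports it to
   the canonical measurable structure of [R] used by tuples. *)
Section stdnormal.
Context {R : realType}.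

Definition of_measurableTypeR (x : measurableTypeR R) : R := x.

Lemma measurable_of_measurableTypeR : measurable_fun setT of_measurableTypeR.
Proof. by move=> _ Y mY; rewrite setTI. Qed.

HB.instance Definition _ :=
  isMeasurableFun.Build _ _ _ _ of_measurableTypeR measurable_of_measurableTypeR.

Definition stdnormal : probability R R :=
  distribution (normal_prob (0 : R) 1)
    [the {mfun measurableTypeR R >-> R} of of_measurableTypeR].

End stdnormal.

Section gaussian_iid.
Context {R : realType}.
Local Notation mu := (@lebesgue_measure R).
Local Notation gam := (@stdnormal R).

Lemma gauss1_gt0 (z : R) : 0 < gauss 1 z.
Proof. exact: gauss_gt0. Qed.

Lemma integral_stdnormal (f : R -> \bar R) :
  measurable_fun setT f -> (forall x, 0 <= f x)%E ->
  (\int[gam]_x f x = \int[mu]_x (f x * (gauss 1 x)%:E))%E.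
Proof.
move=> mf f0.
have <- := integral_normal_prob mf f0.
exact: (@ge0_integral_distribution _ _ _ _ _ (normal_prob (0 : R) 1)
  [the {mfun measurableTypeR R >-> R} of of_measurableTypeR] f mf f0).
Qed.

Lemma measurable_invgauss : measurable_fun setT (fun x : R => (gauss 1 x)^-1).
Proof.
have -> : (fun x : R => (gauss 1 x)^-1) =
    (fun x => Num.sqrt (1 * pi *+ 2) * expR (x ^+ 2 / (1 *+ 2))).
  by apply/funext => x; rewrite /gauss invfM invrK -expRN mulNr opprK.
by apply: measurable_funM => //; apply: measurableT_comp => //; exact: measurable_funM.
Qed.

Lemma integral_stdnormalV (f : R -> \bar R) :
  measurable_fun setT f -> (forall x, 0 <= f x)%E ->
  (\int[gam]_x (f x * ((gauss 1 x)^-1)%:E) = \int[mu]_x f x)%E.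
Proof.
move=> mf f0; rewrite integral_stdnormal.
- apply: eq_integral => x _; rewrite -muleA -EFinM mulVf ?mule1//.
  by rewrite gt_eqF// gauss1_gt0.
- by apply: emeasurable_funM => //; apply/measurable_EFinP; exact: measurable_invgauss.
- by move=> x; rewrite mule_ge0// lee_fin invr_ge0 ltW// gauss1_gt0.
Qed.

(** Density of Lebesgue measure with respect to the standard Gaussian law on tuples. *)
Definition gweight L (y : L.-tuple R) : R := \prod_(t < L) (gauss 1 (tnth y t))^-1.

Lemma gweight_gt0 L (y : L.-tuple R) : 0 < gweight y.
Proof. by apply: prodr_gt0 => t _; rewrite invr_gt0 gauss1_gt0. Qed.

Lemma measurable_gweight L : measurable_fun setT (@gweight L).
Proof.
apply: measurable_prod => t _.
exact: (measurableT_comp measurable_invgauss (@measurable_tnth _ _ _ t)).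
Qed.

(** Turns the iterated Lebesgue integrals of the model into expectations, to which the lemmas on
    product laws apply. *)
Lemma intL_iid L (F : L.-tuple R -> \bar R) :
  measurable_fun setT F -> (forall y, 0 <= F y)%E ->
  intL F = (\int[iid gam L]_y (F y * (gweight y)%:E))%E.
Proof.
elim: L F => [|L IH] F mF F0.
  rewrite /= integral_dirac//; last first.
    apply: emeasurable_funM => //; apply/measurable_EFinP; exact: measurable_gweight.
  by rewrite diracT mul1e /gweight big_ord0 mule1.
have mcons x : measurable_fun setT (fun t : L.-tuple R => [tuple of x :: t]).
  exact: measurable_cons.
have mG : measurable_fun setT (fun y : L.+1.-tuple R => F y * (gweight y)%:E)%E.
  by apply: emeasurable_funM => //; apply/measurable_EFinP; exact: measurable_gweight.
have G0 (y : L.+1.-tuple R) : (0 <= F y * (gweight y)%:E)%E.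
  by rewrite mule_ge0// lee_fin ltW// gweight_gt0.
rewrite (integral_iidS _ mG G0) /=.
have mJ : measurable_fun setT (fun p : R * L.-tuple R =>
    F [tuple of p.1 :: p.2] * (gweight p.2)%:E)%E.
  apply: emeasurable_funM; first exact: (measurableT_comp mF (@measurable_tcons _ _ L)).
  by apply/measurable_EFinP; exact: (measurableT_comp (@measurable_gweight L) measurable_snd).
have J0 (x : R) (y : L.-tuple R) : (0 <= F [tuple of x :: y] * (gweight y)%:E)%E.
  by rewrite mule_ge0// lee_fin ltW// gweight_gt0.
have mx x : measurable_fun setT (fun y : L.-tuple R => F [tuple of x :: y] * (gweight y)%:E)%E.
  apply: emeasurable_funM; first exact: (measurableT_comp mF (mcons x)).
  by apply/measurable_EFinP; exact: measurable_gweight.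
have E : (fun x => intL (fun t : L.-tuple R => F [tuple of x :: t])) =
    (fun x => \int[iid gam L]_t (F [tuple of x :: t] * (gweight t)%:E))%E.
  by apply/funext => x; exact: (IH _ (measurableT_comp mF (mcons x)) (fun y => F0 _)).
rewrite E -integral_stdnormalV; last 2 first.
- exact: (measurable_integral2 _ mJ J0).
- by move=> x; apply: integral_ge0 => t _; exact: J0.
apply: eq_integral => x _.
rewrite -ge0_integralZr//.
- apply: eq_integral => t _; rewrite -muleA -EFinM; congr (_ * _%:E)%E.
  rewrite /gweight big_ord_recl tnth0 mulrC; congr (_ * _).
  by apply: eq_bigr => i _; rewrite tnthS.
- by rewrite lee_fin invr_ge0 ltW// gauss1_gt0.
Qed.

Lemma integral_stdnormal_gauss (v a z : R) : 0 < v ->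
  (\int[gam]_x (gauss v (z - a * x))%:E = (gauss (v + a ^+ 2) z)%:E)%E.
Proof.
move=> v0; rewrite -integral_gauss_shift//.
have mf : measurable_fun setT (fun x : R => (gauss v (z - a * x))%:E).
  by apply/measurable_EFinP/measurable_fun_gauss; apply: measurable_funB.
have f0 (x : R) : (0 <= (gauss v (z - a * x))%:E)%E by rewrite lee_fin ltW// gauss_gt0.
by rewrite integral_stdnormal// integral_normal_prob.
Qed.

Lemma ln_gauss (v z : R) : 0 < v ->
  ln (gauss v z) = - (2^-1 * ln (v * pi *+ 2)) - z ^+ 2 / (v *+ 2).
Proof.
move=> v0; have c0 : 0 < v * pi *+ 2 by rewrite pmulrn_lgt0// mulr_gt0 ?pi_gt0.
rewrite /gauss lnM ?posrE ?invr_gt0 ?sqrtr_gt0 ?expR_gt0// expRK mulNr.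
by rewrite lnV ?posrE ?sqrtr_gt0// -powR12_sqrt ?ltW// ln_powR.
Qed.

Lemma expR_midpoint (p q : R) : expR ((p + q) / 2) <= 2^-1 * (expR p + expR q).
Proof.
have -> : expR ((p + q) / 2) = expR (p / 2) * expR (q / 2) by rewrite -expRD -mulrDl.
have E (x : R) : expR x = expR (x / 2) ^+ 2.
  by rewrite expr2 -expRD; congr expR; field.
rewrite (E p) (E q); have := sqr_ge0 (expR (p / 2) - expR (q / 2)).
by rewrite sqrrB; nra.
Qed.

(** The log-likelihood ratio is the mutual information plus half the difference of two squares, the
    output's and the noise's, each divided by its variance. Both normalised squares have mean one,
    so around the mutual information only a term of order [s ^+ 2] survives. *)
Lemma gauss_pair_bound (v a m s : R) : 0 < v -> `|s| <= 4^-1 ->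
  (\int[mu]_y \int[gam]_x
    (gauss v (y - m - a * x) *
     expR (s * (ln (gauss v (y - m - a * x)) - ln (gauss (v + a ^+ 2) (y - m)))))%:E
   <= (expR (s * (2^-1 * ln ((v + a ^+ 2) / v)) + 4 * s ^+ 2))%:E)%E.
Proof.
move=> v0; rewrite ler_norml => /andP[s1 s2].
set v1 := v + a ^+ 2; have v10 : 0 < v1 by rewrite ltr_pwDl ?sqr_ge0.
set C := expR (s * (2^-1 * ln (v1 / v))).
pose f (y x : R) := gauss v (y - m - a * x).
pose A (y : R) := expR (s * ((y - m) ^+ 2 / v1)).
pose B (y x : R) := expR (- s * ((y - m - a * x) ^+ 2 / v)).
have f0 y x : 0 <= f y x by rewrite ltW// gauss_gt0.
have mfy : measurable_fun setT (fun p : R * R => p.1 - m - a * p.2).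
  apply: measurable_funB; first exact: measurable_funB.
  exact: measurable_funM.
have mf : measurable_fun setT (fun p : R * R => f p.1 p.2).
  exact: measurable_fun_gauss.
have mA : measurable_fun setT (fun p : R * R => A p.1).
  rewrite /A; apply: measurableT_comp => //; apply: measurable_funM => //.
  apply: measurable_funM => //; apply: measurable_funX; exact: measurable_funB.
have mB : measurable_fun setT (fun p : R * R => B p.1 p.2).
  rewrite /B; apply: measurableT_comp => //; apply: measurable_funM => //.
  by apply: measurable_funM => //; exact: measurable_funX.
pose G1 (y x : R) := C / 2 * (f y x * A y).
pose G2 (y x : R) := C / 2 * (f y x * B y x).
have C0 : 0 <= C / 2 by rewrite divr_ge0// expR_ge0.
have G10 y x : (0 <= (G1 y x)%:E)%E by rewrite lee_fin mulr_ge0// mulr_ge0// expR_ge0.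
have G20 y x : (0 <= (G2 y x)%:E)%E by rewrite lee_fin mulr_ge0// mulr_ge0// expR_ge0.
have mG1 : measurable_fun setT (fun p : R * R => (G1 p.1 p.2)%:E).
  by apply/measurable_EFinP; apply: measurable_funM => //; exact: measurable_funM.
have mG2 : measurable_fun setT (fun p : R * R => (G2 p.1 p.2)%:E).
  by apply/measurable_EFinP; apply: measurable_funM => //; exact: measurable_funM.
pose H (y x : R) := f y x * expR (s * (ln (f y x) - ln (gauss v1 (y - m)))).
have mH : measurable_fun setT (fun p : R * R => (H p.1 p.2)%:E).
  apply/measurable_EFinP; apply: measurable_funM => //.
  apply: measurableT_comp => //; apply: measurable_funM => //.
  apply: measurable_funB; first exact: measurableT_comp.
  apply: measurableT_comp => //; apply: measurable_fun_gauss; exact: measurable_funB.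
have H0 y x : (0 <= (H y x)%:E)%E by rewrite lee_fin mulr_ge0// expR_ge0.
(* AM-GM splits the tilt into a moment of the output and one of the noise,
   each a Gaussian integral. *)
have HG y x : ((H y x)%:E <= (G1 y x)%:E + (G2 y x)%:E)%E.
  rewrite -EFinD lee_fin /H /G1 /G2 /f !ln_gauss// -/(f y x).
  rewrite [leRHS](_ : _ = f y x * (C * (2^-1 * (A y + B y x)))); last by ring.
  apply: ler_wpM2l => //.
  rewrite [X in expR X](_ : _ = s * (2^-1 * ln (v1 / v)) +
    (s * ((y - m) ^+ 2 / v1) + - s * ((y - m - a * x) ^+ 2 / v)) / 2).
    by rewrite expRD ler_wpM2l ?expR_ge0// expR_midpoint.
  have p0 : 0 < pi *+ 2 :> R by rewrite pmulrn_lgt0// pi_gt0.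
  rewrite -[v * pi *+ 2]mulrnAr -[v1 * pi *+ 2]mulrnAr.
  rewrite !lnM ?posrE ?invr_gt0// lnV ?posrE//.
  by field; rewrite !gt_eqF.
have intG1 : (\int[mu]_y \int[gam]_x (G1 y x)%:E <= (C / 2 * (1 + s + 4 * s ^+ 2))%:E)%E.
  rewrite [leLHS](_ : _ = \int[mu]_y ((C / 2)%:E * (gauss v1 (y - m) * A y)%:E))%E; last first.
    apply: eq_integral => y _; rewrite (eq_integral (fun x : R => (C / 2 * A y)%:E * (f y x)%:E)%E).
      rewrite ge0_integralZl_EFin//.
      - by rewrite integral_stdnormal_gauss// -!EFinM; congr _%:E; ring.
      - by move=> x _; rewrite lee_fin.
      - by apply/measurable_EFinP; exact: (measurable_fun_pair2 y mf).
      - by rewrite mulr_ge0// expR_ge0.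
    by move=> x _; rewrite -EFinM; congr _%:E; rewrite /G1; ring.
  rewrite ge0_integralZl_EFin//; last 2 first.
  - by move=> y _; rewrite lee_fin mulr_ge0 ?expR_ge0// ltW// gauss_gt0.
  - apply/measurable_EFinP; apply: measurable_funM; last exact: (measurable_fun_pair1 _ mA).
    by apply: measurable_fun_gauss; exact: measurable_funB.
  rewrite integral_gauss_expR//; last by lra.
  rewrite -EFinM lee_fin ler_wpM2l//.
  apply: (le_trans (invsqrt1B_le _)); last by rewrite le_eqVlt; apply/orP; left; apply/eqP; field.
  by rewrite ler_norml; lra.
have intG2 : (\int[mu]_y \int[gam]_x (G2 y x)%:E <= (C / 2 * (1 - s + 4 * s ^+ 2))%:E)%E.
  (* The noise [y - m - a * x] is Gaussian in [y] for each fixed [x], so here [y] is integrated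
     first, whereas the moment of the output needed [x] integrated out. *)
  rewrite [leLHS](_ : _ = \int[gam]_x \int[mu]_y (G2 y x)%:E)%E; last first.
    exact: (@integral_swap _ _ _ _ _ mu gam _ mG2 G20).
  rewrite (eq_integral (fun x : R => (C / 2 * (Num.sqrt (1 - (- s) * 2))^-1)%:E)); last first.
    move=> x _; transitivity (\int[mu]_y ((C / 2)%:E * (gauss v (y - (m + a * x)) *
        expR (- s * ((y - (m + a * x)) ^+ 2 / v)))%:E))%E.
      apply: eq_integral => y _; rewrite -EFinM; congr _%:E.
      by rewrite /G2 /f /B opprD addrA.
    rewrite ge0_integralZl_EFin//.
    - by rewrite integral_gauss_expR//; lra.
    - by move=> y _; rewrite lee_fin mulr_ge0 ?expR_ge0// ltW// gauss_gt0.
    - apply/measurable_EFinP; apply: measurable_funM.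
        by apply: measurable_fun_gauss; exact: measurable_funB.
      apply: measurableT_comp => //; apply: measurable_funM => //.
      by apply: measurable_funM => //; apply: measurable_funX; exact: measurable_funB.
  rewrite integral_prob_cst lee_fin ler_wpM2l//.
  apply: (le_trans (invsqrt1B_le _)); last by rewrite le_eqVlt; apply/orP; left; apply/eqP; field.
  by rewrite ler_norml; lra.
apply: (@le_trans _ _ (\int[mu]_y (\int[gam]_x (G1 y x)%:E + \int[gam]_x (G2 y x)%:E)))%E.
  apply: ge0_le_integral => //.
  - by move=> y _; apply: integral_ge0 => x _; exact: H0.
  - exact: (measurable_integral2 _ mH H0).
  - by apply: emeasurable_funD; [exact: (measurable_integral2 _ mG1 G10)|exact: (measurable_integral2 _ mG2 G20)].
  move=> y _; rewrite -ge0_integralD//; last 2 first.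
  - exact: (measurable_fun_pair2 y mG1).
  - exact: (measurable_fun_pair2 y mG2).
  apply: ge0_le_integral => //.
  - by move=> x _; exact: H0.
  - exact: (measurable_fun_pair2 y mH).
  - apply: emeasurable_funD; [exact: (measurable_fun_pair2 y mG1)|exact: (measurable_fun_pair2 y mG2)].
  - by move=> x _; exact: HG.
rewrite ge0_integralD//; last 4 first.
- by move=> y _; apply: integral_ge0 => x _; exact: G10.
- exact: (measurable_integral2 _ mG1 G10).
- by move=> y _; apply: integral_ge0 => x _; exact: G20.
- exact: (measurable_integral2 _ mG2 G20).
(* The terms [s] and [- s] cancel, leaving [C * (1 + 4 * s ^+ 2)]. *)
apply: (le_trans (leeD intG1 intG2)); rewrite -EFinD lee_fin expRD.
have := expR_ge1Dx (4 * s ^+ 2); have : 0 <= C by exact: expR_ge0.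
rewrite -/C.
set E := expR _; nra.
Qed.

End gaussian_iid.

(** * Layered Gaussian densities *)

Lemma lee_prod (R : realType) (I : Type) (r : seq I) (f g : I -> \bar R) :
  (forall i, 0 <= f i)%E -> (forall i, f i <= g i)%E ->
  (\prod_(i <- r) f i <= \prod_(i <- r) g i)%E.
Proof.
move=> f0 fg; suff [] : (0 <= \prod_(i <- r) f i)%E /\
    (\prod_(i <- r) f i <= \prod_(i <- r) g i)%E by [].
elim/big_ind2 : _ => [//|x x' y y' [x0 xx'] [y0 yy']|//]; split.
  exact: mule_ge0.
exact: lee_pmul.
Qed.

Section layered.
Context {R : realType} (s L : nat) (a : 'I_s -> R).
Local Notation mu := (@lebesgue_measure R).
Local Notation gam := (@stdnormal R).
Local Notation X := (L.-tuple R).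

Definition lvar (k : nat) : R := 1 + \sum_(j < s | (k <= j)%N) a j ^+ 2.

Definition lmean (k : nat) (u : s.-tuple X) (t : 'I_L) : R :=
  \sum_(j < s | (j < k)%N) a j * tnth (tnth u j) t.

(* Output density given the words [u] of the layers [j < k]; the layers
   [j >= k] are averaged out into the noise variance [lvar k]. *)
Definition gdens (k : nat) (u : s.-tuple X) (y : X) : R :=
  \prod_(t < L) gauss (lvar k) (tnth y t - lmean k u t).

(* The same density relative to the standard Gaussian law instead of Lebesgue
   measure, so that every expectation is over probability measures. *)
Definition wdens (k : nat) (u : s.-tuple X) (y : X) : R := gdens k u y * gweight y.

Lemma lvar_gt0 k : 0 < lvar k.
Proof. by rewrite ltr_pwDl// sumr_ge0// => j _; rewrite sqr_ge0. Qed.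

Lemma lvarS (k : 'I_s) : lvar k = lvar k.+1 + a k ^+ 2.
Proof.
rewrite /lvar (bigD1 k)//= -addrA [_ + a k ^+ 2]addrC; congr (_ + (_ + _)).
by apply: eq_bigl => j; rewrite ltn_neqAle andbC eq_sym -val_eqE.
Qed.

Lemma lmean_tset (k : 'I_s) u x t :
  lmean k.+1 (tset u k x) t = lmean k u t + a k * tnth x t.
Proof.
rewrite /lmean (bigD1 k)//= tnth_tset eqxx addrC; congr (_ + _).
apply: eq_big => [j|j /andP[_ /negbTE jk]]; last by rewrite tnth_tset jk.
by rewrite ltnS -val_eqE andbC -ltn_neqAle.
Qed.

Lemma lmean_eq k u u' t :
  (forall j : 'I_s, (j < k)%N -> tnth u j = tnth u' j) -> lmean k u t = lmean k u' t.
Proof. by move=> uu'; apply: eq_bigr => j jk; rewrite uu'. Qed.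

Lemma wdens_eq k u u' y :
  (forall j : 'I_s, (j < k)%N -> tnth u j = tnth u' j) -> wdens k u y = wdens k u' y.
Proof.
move=> uu'; congr (_ * _); apply: eq_bigr => t _.
by rewrite (lmean_eq _ uu').
Qed.

Lemma gdens_gt0 k u y : 0 < gdens k u y.
Proof. by apply: prodr_gt0 => t _; exact/gauss_gt0/lvar_gt0. Qed.

Lemma wdens_gt0 k u y : 0 < wdens k u y.
Proof. by rewrite mulr_gt0 ?gdens_gt0 ?gweight_gt0. Qed.

Lemma measurable_gdens k :
  measurable_fun setT (fun p : s.-tuple X * X => gdens k p.1 p.2).
Proof.
apply: measurable_prod => t _; apply: measurable_fun_gauss.
apply: measurable_funB; first exact: (measurable_fun_tnth t measurable_snd).
rewrite (_ : (fun p => _) = fun p : s.-tuple X * X =>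
    \sum_(j < s) if (j < k)%N then a j * tnth (tnth p.1 j) t else 0); last first.
  by apply/funext => p; rewrite /lmean big_mkcond.
apply: measurable_sum => j; case: (j < k)%N => //; apply: measurable_funM => //.
exact: (measurable_fun_tnth t (measurable_fun_tnth j measurable_fst)).
Qed.

Lemma measurable_wdens k :
  measurable_fun setT (fun p : s.-tuple X * X => wdens k p.1 p.2).
Proof.
apply: measurable_funM; first exact: measurable_gdens.
exact: (measurableT_comp (@measurable_gweight _ L) measurable_snd).
Qed.

(** Consistency between levels: by Gaussian convolution in each coordinate, averaging over the word
    of layer [k] turns [lvar k.+1] into [lvar k]. This is the identity that drives the averaging
    over codebooks. *)
Lemma integral_wdens_tset (k : 'I_s) u y :
  (\int[iid gam L]_x (wdens k.+1 (tset u k x) y)%:E = (wdens k u y)%:E)%E.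
Proof.
pose f (t : 'I_L) (x : R) : \bar R :=
  (gauss (lvar k.+1) (tnth y t - lmean k u t - a k * x))%:E.
transitivity (\int[iid gam L]_x ((gweight y)%:E * \prod_(t < L) f t (tnth x t)))%E.
  apply: eq_integral => x _; rewrite /wdens mulrC EFinM; congr (_ * _)%E.
  rewrite prodEFin; congr _%:E; apply: eq_bigr => t _.
  by rewrite lmean_tset opprD addrA.
have mf t : measurable_fun setT (f t).
  by apply/measurable_EFinP/measurable_fun_gauss; apply: measurable_funB.
have f0 t x : (0 <= f t x)%E by rewrite lee_fin ltW// gauss_gt0// lvar_gt0.
rewrite ge0_integralZl_EFin//.
- rewrite (integral_iid_prod gam mf f0).
  rewrite /wdens mulrC EFinM; congr (_ * _)%E; rewrite /gdens -prodEFin.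
  by apply: eq_bigr => t _; rewrite integral_stdnormal_gauss ?lvar_gt0// -lvarS.
- by move=> x _; apply: prode_ge0.
- by apply: emeasurable_prod => t; apply: (measurableT_comp (mf t)); exact: measurable_tnth.
- by rewrite ltW// gweight_gt0.
Qed.

Lemma integral_wdens k u : (\int[iid gam L]_y (wdens k u y)%:E = 1)%E.
Proof.
pose f (t : 'I_L) (y : R) : \bar R :=
  ((gauss (lvar k) (y - lmean k u t))%:E * ((gauss 1 y)^-1)%:E)%E.
transitivity (\int[iid gam L]_y (\prod_(t < L) f t (tnth y t)))%E.
  apply: eq_integral => y _; rewrite /wdens /gdens /gweight -big_split/= -prodEFin.
  by apply: eq_bigr => t _; rewrite /f EFinM.
have mg t : measurable_fun setT (fun y : R => (gauss (lvar k) (y - lmean k u t))%:E).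
  by apply/measurable_EFinP/measurable_fun_gauss; exact: measurable_funB.
have g0 t (y : R) : (0 <= (gauss (lvar k) (y - lmean k u t))%:E)%E.
  by rewrite lee_fin ltW// gauss_gt0// lvar_gt0.
have mf t : measurable_fun setT (f t).
  by apply: emeasurable_funM => //; apply/measurable_EFinP; exact: measurable_invgauss.
have f0 t x : (0 <= f t x)%E by rewrite mule_ge0// lee_fin invr_ge0 ltW// gauss1_gt0.
rewrite (integral_iid_prod gam mf f0) big1// => t _.
by rewrite integral_stdnormalV// integral_gauss// lvar_gt0.
Qed.

Lemma integral_wdens_expR k u (c : R) :
  (\int[iid gam L]_y (wdens k u y * expR (c * \sum_(t < L) (tnth y t) ^+ 2))%:E =
   \prod_(t < L) \int[mu]_y (gauss (lvar k) (y - lmean k u t) * expR (c * y ^+ 2))%:E)%E.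
Proof.
pose f (t : 'I_L) (y : R) : \bar R :=
  ((gauss (lvar k) (y - lmean k u t) * expR (c * y ^+ 2))%:E * ((gauss 1 y)^-1)%:E)%E.
transitivity (\int[iid gam L]_y (\prod_(t < L) f t (tnth y t)))%E.
  apply: eq_integral => y _; rewrite mulr_sumr expR_sum.
  rewrite /wdens /gdens /gweight mulrAC -!big_split/= -prodEFin.
  by apply: eq_bigr => t _; rewrite /f EFinM.
have mg t : measurable_fun setT (fun y : R =>
    (gauss (lvar k) (y - lmean k u t) * expR (c * y ^+ 2))%:E).
  apply/measurable_EFinP; apply: measurable_funM.
    by apply: measurable_fun_gauss; exact: measurable_funB.
  by apply: measurableT_comp => //; apply: measurable_funM.
have g0 t (y : R) : (0 <= (gauss (lvar k) (y - lmean k u t) * expR (c * y ^+ 2))%:E)%E.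
  by rewrite lee_fin mulr_ge0 ?expR_ge0// ltW// gauss_gt0// lvar_gt0.
have mf t : measurable_fun setT (f t).
  by apply: emeasurable_funM => //; apply/measurable_EFinP; exact: measurable_invgauss.
have f0 t x : (0 <= f t x)%E by rewrite mule_ge0// lee_fin invr_ge0 ltW// gauss1_gt0.
rewrite (integral_iid_prod gam mf f0); apply: eq_bigr => t _.
by rewrite integral_stdnormalV.
Qed.

Lemma prod_tilt (f g : 'I_L -> R) (c : R) : (forall t, 0 < f t) -> (forall t, 0 < g t) ->
  (\prod_t f t) * expR (c * (ln (\prod_t f t) - ln (\prod_t g t))) =
  \prod_t (f t * expR (c * (ln (f t) - ln (g t)))).
Proof.
move=> f0 g0; rewrite big_split /= -expR_sum; congr (_ * expR _).
have ln_prod (e : 'I_L -> R) : (forall t, 0 < e t) -> ln (\prod_t e t) = \sum_t ln (e t).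
  move=> e0; suff [] : 0 < \prod_t e t /\ ln (\prod_t e t) = \sum_t ln (e t) by [].
  elim/big_ind2 : _ => [|x x' y y' [x0 <-] [y0 <-]|t _]; first by rewrite ln1.
    by rewrite mulr_gt0// lnM.
  by rewrite e0.
by rewrite !ln_prod// -sumrB mulr_sumr.
Qed.

(** Channel and codewords are memoryless, so the moment is a product over [t] of single-letter
    moments; the factor [gweight] cancels between the two logarithms. *)
Lemma integral_wdens_tilt (k : 'I_s) u (c : R) : `|c| <= 4^-1 ->
  (\int[iid gam L]_y \int[iid gam L]_x
     (wdens k.+1 (tset u k x) y *
      expR (c * (ln (wdens k.+1 (tset u k x) y) - ln (wdens k u y))))%:E
   <= (expR (L%:R * (c * (2^-1 * ln (lvar k / lvar k.+1)) + 4 * c ^+ 2)))%:E)%E.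
Proof.
move=> c4.
pose h (t : 'I_L) (y x : R) : R := gauss (lvar k.+1) (y - lmean k u t - a k * x) *
  expR (c * (ln (gauss (lvar k.+1) (y - lmean k u t - a k * x)) -
             ln (gauss (lvar k) (y - lmean k u t)))).
have h0 t y x : (0 <= (h t y x)%:E)%E.
  by rewrite lee_fin mulr_ge0 ?expR_ge0// ltW// gauss_gt0// lvar_gt0.
have mh t : measurable_fun setT (fun p : R * R => (h t p.1 p.2)%:E).
  apply/measurable_EFinP.
  have m1 : measurable_fun setT (fun p : R * R => p.1 - lmean k u t).
    exact: measurable_funB.
  have m2 : measurable_fun setT (fun p : R * R => gauss (lvar k.+1) (p.1 - lmean k u t - a k * p.2)).
    by apply: measurable_fun_gauss; apply: measurable_funB => //; exact: measurable_funM.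
  apply: measurable_funM => //; apply: measurableT_comp => //.
  apply: measurable_funM => //; apply: measurable_funB; first exact: measurableT_comp.
  by apply: measurableT_comp => //; exact: measurable_fun_gauss.
pose g (t : 'I_L) (y : R) : \bar R := (\int[gam]_x (h t y x)%:E)%E.
have mg t : measurable_fun setT (g t) by exact: (measurable_integral2 _ (mh t) (h0 t)).
have g0 t y : (0 <= g t y)%E by apply: integral_ge0 => x _; exact: h0.
pose f t y := (g t y * ((gauss 1 y)^-1)%:E)%E.
have mf t : measurable_fun setT (f t).
  by apply: emeasurable_funM => //; apply/measurable_EFinP; exact: measurable_invgauss.
have f0 t y : (0 <= f t y)%E by rewrite mule_ge0// lee_fin invr_ge0 ltW// gauss1_gt0.
rewrite [leLHS](_ : _ = \int[iid gam L]_y \prod_(t < L) f t (tnth y t))%E; last first.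
  apply: eq_integral => y _.
  transitivity (\int[iid gam L]_x ((gweight y)%:E * \prod_(t < L) (h t (tnth y t) (tnth x t))%:E))%E.
    apply: eq_integral => x _.
    rewrite prodEFin -EFinM; congr _%:E.
    rewrite /wdens !lnM ?posrE ?gdens_gt0 ?gweight_gt0// opprD addrACA subrr addr0.
    rewrite mulrAC mulrC; congr (_ * _).
    rewrite /gdens prod_tilt; last 2 first.
    - by move=> t; exact/gauss_gt0/lvar_gt0.
    - by move=> t; exact/gauss_gt0/lvar_gt0.
    by apply: eq_bigr => t _; rewrite lmean_tset opprD addrA.
  have mht t : measurable_fun setT (fun x : R => (h t (tnth y t) x)%:E).
    exact: (measurable_fun_pair2 (tnth y t) (mh t)).
  rewrite ge0_integralZl_EFin//.
  - rewrite (integral_iid_prod gam mht (fun t => h0 t _)) /f big_split/= muleC.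
    by rewrite prodEFin.
  - by move=> x _; apply: prode_ge0.
  - by apply: emeasurable_prod => t; apply: (measurableT_comp (mht t)); exact: measurable_tnth.
  - by rewrite ltW// gweight_gt0.
rewrite (integral_iid_prod gam mf f0).
set C := c * (2^-1 * ln (lvar k / lvar k.+1)) + 4 * c ^+ 2.
rewrite expRM_natl (_ : expR C ^+ L = \prod_(t < L) expR C); last first.
  by rewrite prodr_const card_ord.
rewrite -prodEFin; apply: lee_prod => t; first exact: integral_ge0.
rewrite integral_stdnormalV//.
have := gauss_pair_bound (a k) (lmean k u t) (lvar_gt0 k.+1) c4.
by rewrite -lvarS.
Qed.

(* An exponential moment of the channel input, read off from the channel output. *)
Lemma expR_energy_le (c : R) u : 0 <= c -> c < 2^-1 ->
  ((expR (c * \sum_(t < L) (1 + (lmean s u t) ^+ 2)))%:E <=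
   \int[iid gam L]_y (wdens s u y * expR (c * \sum_(t < L) (tnth y t) ^+ 2))%:E)%E.
Proof.
move=> c0 c2.
rewrite (integral_wdens_expR s u c) mulr_sumr expR_sum -prodEFin.
apply: lee_prod => t; first by rewrite lee_fin expR_ge0.
have -> : lvar s = 1 by rewrite /lvar big1 ?addr0// => j; rewrite leqNgt ltn_ord.
rewrite integral_gauss_expR_shift// lee_fin.
have c1 : 0 < 1 - c * 2 by lra.
rewrite mulrDr mulr1 expRD ler_pM ?expR_ge0//.
  rewrite -[leLHS]invrK -expRN lef_pV2 ?posrE ?expR_gt0 ?sqrtr_gt0//.
  have -> : expR (- c) = Num.sqrt (expR (- (c * 2))).
    rewrite -[LHS]ger0_norm ?expR_ge0// -sqrtr_sqr -expRM_natl; congr (Num.sqrt (expR _)).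
    by rewrite mulrN mulrC.
  by rewrite ler_sqrt ?expR_ge0//; have := expR_ge1Dx (- (c * 2)).
have m0 : 0 <= c * lmean s u t ^+ 2 by rewrite mulr_ge0// sqr_ge0.
by rewrite ler_expR ler_pdivlMr// ler_piMr//; lra.
Qed.

(** At level [0] every word has been averaged out: the output is white Gaussian of variance [lvar 0]
    and its energy a scaled chi-square. *)
Lemma integral_wdens0_expR (c : R) u : 0 <= c -> c * lvar 0 <= 4^-1 ->
  (\int[iid gam L]_y (wdens 0 u y * expR (c * \sum_(t < L) (tnth y t) ^+ 2))%:E
   <= (expR (L%:R * (c * lvar 0 + 4 * (c * lvar 0) ^+ 2)))%:E)%E.
Proof.
move=> c0 c4; set v := lvar 0; have v0 : 0 < v := lvar_gt0 0.
rewrite (integral_wdens_expR 0 u c).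
set C := c * v + _.
rewrite expRM_natl (_ : expR C ^+ L = \prod_(t < L) expR C); last first.
  by rewrite prodr_const card_ord.
rewrite -prodEFin; apply: lee_prod => t.
  by apply: integral_ge0 => y _; rewrite lee_fin mulr_ge0 ?expR_ge0// ltW// gauss_gt0.
have -> : lmean 0 u t = 0 by rewrite /lmean big_pred0.
rewrite [leLHS](_ : _ = \int[mu]_y (gauss v (y - 0) * expR (c * v * ((y - 0) ^+ 2 / v)))%:E)%E; last first.
  apply: eq_integral => y _; rewrite subr0; congr (_ * expR _)%:E.
  by field; rewrite gt_eqF.
rewrite integral_gauss_expR//; last by rewrite -/v in c4 *; lra.
have cv : 0 <= c * v by rewrite mulr_ge0// ltW.
rewrite lee_fin; apply: le_trans (expR_ge1Dx _).
apply: (le_trans (invsqrt1B_le _)).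
  by rewrite ger0_norm; rewrite -/v in c4 *; lra.
by rewrite /C; nra.
Qed.

End layered.

(** * Random codebooks *)

Section random_codebook.
Context d d' (X : measurableType d) (Y : measurableType d') (R : realType).
Variables (mu : probability X R) (nu : probability Y R).
Variables (s : nat) (A : 'I_s -> finType).

(** One coordinate of the codebook per word of each layer. Words of different layers are drawn
    independently; they meet only when they are added in the channel input. *)
Let I : finType := {k : 'I_s & A k}.

Definition codebook := #|I|.-tuple X.
Definition slot (k : 'I_s) (i : A k) : 'I_(#|I|) := enum_rank (Tagged A i).
Definition word (c : codebook) (k : 'I_s) (i : A k) : X := tnth c (slot i).
Definition words (c : codebook) (x : forall k, A k) : s.-tuple X :=
  [tuple word c (x k) | k < s].

Lemma slot_eq (k l : 'I_s) (i : A k) (x : forall k, A k) :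
  (slot (x l) == slot i) = (l == k) && (x k == i).
Proof.
rewrite /slot (inj_eq enum_rank_inj); have [lk|lk] := eqVneq l k.
  by rewrite lk eq_Tagged.
by apply/eqP => e; case/eqP: lk; exact: (congr1 (@tag _ _) e).
Qed.

Lemma word_tset c (k : 'I_s) (i j : A k) z :
  word (tset c (slot i) z) j = if j == i then z else word c j.
Proof.
by rewrite /word tnth_tset /slot (inj_eq enum_rank_inj) eq_Tagged.
Qed.

Lemma words_tset c (k : 'I_s) (x : forall k, A k) z :
  words (tset c (slot (x k)) z) x = tset (words c x) k z.
Proof.
apply: eq_from_tnth => l; rewrite tnth_tset !tnth_mktuple /word tnth_tset slot_eq.
by rewrite eqxx andbT.
Qed.

Lemma words_tset_neq c (k : 'I_s) (i : A k) (x : forall k, A k) z :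
  i != x k -> words (tset c (slot i) z) x = words c x.
Proof.
move=> ix; apply: eq_from_tnth => l; rewrite !tnth_mktuple /word tnth_tset slot_eq.
by rewrite [x k == i]eq_sym (negbTE ix) andbF.
Qed.

Lemma measurable_words x : measurable_fun setT (fun c : codebook => words c x).
Proof.
apply/measurable_fun_tnthP => l.
rewrite (_ : _ \o _ = fun c => tnth c (slot (x l))); first exact: measurable_tnth.
by apply/funext => c /=; rewrite tnth_mktuple.
Qed.

Lemma measurable_word k (i : A k) : measurable_fun setT (fun c : codebook => word c i).
Proof. exact: measurable_tnth. Qed.

(** An abstract tower of output densities: [D k] sees the words of the layers below [k], and
    averaging [D k.+1] over the word of layer [k] gives [D k]. The averaging arguments use nothing
    specific to Gaussian laws. *)
Variable D : nat -> s.-tuple X -> Y -> R.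
Hypothesis mD : forall k, measurable_fun setT (fun p : s.-tuple X * Y => D k p.1 p.2).
Hypothesis D_gt0 : forall k u y, 0 < D k u y.
Hypothesis D_eq : forall k u u' y,
  (forall j : 'I_s, (j < k)%N -> tnth u j = tnth u' j) -> D k u y = D k u' y.
Hypothesis D_marg : forall (k : 'I_s) u y,
  (\int[mu]_z (D k.+1 (tset u k z) y)%:E = (D k u y)%:E)%E.
Hypothesis D_int : forall k u, (\int[nu]_y (D k u y)%:E = 1)%E.

(** Density under the hypothesis that the layers below [k] carry the words of [x] while layer [k]
    carries the competing word [i]. *)
Definition dalt (k : 'I_s) (c : codebook) x (i : A k) y : R :=
  D k.+1 (tset (words c x) k (word c i)) y.

Let Gam := iid mu #|I|.

Lemma D_tset_ge k (j : 'I_s) u z y : (k <= j)%N -> D k (tset u j z) y = D k u y.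
Proof.
move=> kj; apply: D_eq => l lk; rewrite tnth_tset; case: eqP => // lj.
by move: kj; rewrite -lj leqNgt lk.
Qed.

Lemma measurable_Dwords k x :
  measurable_fun setT (fun p : codebook * Y => D k (words p.1 x) p.2).
Proof.
apply: (measurableT_comp (mD k) (f := fun p => D k p.1 p.2)
  (g := fun p : codebook * Y => (words p.1 x, p.2))).
apply/measurable_fun_pairP; split => /=.
  exact: (measurableT_comp (measurable_words x) measurable_fst).
exact: measurable_snd.
Qed.

Lemma measurable_dalt (k : 'I_s) x (i : A k) :
  measurable_fun setT (fun p : codebook * Y => dalt p.1 x i p.2).
Proof.
apply: (measurableT_comp (mD k.+1) (f := fun p => D k.+1 p.1 p.2)
  (g := fun p : codebook * Y => (tset (words p.1 x) k (word p.1 i), p.2))).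
apply/measurable_fun_pairP; split => /=; last exact: measurable_snd.
apply: (measurableT_comp (@measurable_tset _ _ _ k)
  (g := fun p : codebook * Y => (words p.1 x, word p.1 i))).
apply/measurable_fun_pairP; split => /=.
  exact: (measurableT_comp (measurable_words x) measurable_fst).
exact: (measurableT_comp (measurable_word i) measurable_fst).
Qed.

Lemma measurable_Dc k x y : measurable_fun setT (fun c => D k (words c x) y).
Proof. exact: (measurable_fun_pair1 y (measurable_Dwords k x)). Qed.

(** Since [H] ignores the word of layer [k], redrawing that word acts on the density alone and
    lowers its level by one. *)
Lemma integral_peel1 (k : 'I_s) x y (H : codebook -> R) :
  measurable_fun setT H -> (forall c, 0 <= H c) ->
  (forall c z, H (tset c (slot (x k)) z) = H c) ->
  (\int[Gam]_c (D k.+1 (words c x) y * H c)%:E =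
   \int[Gam]_c (D k (words c x) y * H c)%:E)%E.
Proof.
move=> mH H0 HE.
have mF : measurable_fun setT (fun c => (D k.+1 (words c x) y * H c)%:E).
  by apply/measurable_EFinP; apply: measurable_funM => //; exact: measurable_Dc.
have F0 c : (0 <= (D k.+1 (words c x) y * H c)%:E)%E.
  by rewrite lee_fin mulr_ge0// ltW.
rewrite (integral_iid_tset mu (slot (x k)) mF F0).
apply: eq_integral => c _.
transitivity (\int[mu]_z ((H c)%:E * (D k.+1 (tset (words c x) k z) y)%:E))%E.
  by apply: eq_integral => z _; rewrite HE words_tset mulrC.
rewrite ge0_integralZl_EFin//.
- by rewrite D_marg mulrC EFinM.
- by move=> z _; rewrite lee_fin ltW.
- apply/measurable_EFinP.
  apply: (measurableT_comp (mD k.+1) (f := fun p => D k.+1 p.1 p.2)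
    (g := fun z : X => (tset (words c x) k z, y))).
  apply/measurable_fun_pairP; split; last exact: measurable_cst.
  exact: (measurable_fun_pair2 (words c x) (@measurable_tset _ _ _ k)).
Qed.

Lemma integral_peel k x y (H : codebook -> R) : (k <= s)%N ->
  measurable_fun setT H -> (forall c, 0 <= H c) ->
  (forall (j : 'I_s) c z, (k <= j)%N -> H (tset c (slot (x j)) z) = H c) ->
  (\int[Gam]_c (D s (words c x) y * H c)%:E =
   \int[Gam]_c (D k (words c x) y * H c)%:E)%E.
Proof.
move=> ks mH H0 HE.
suff P n : (k + n <= s)%N -> (\int[Gam]_c (D (k + n) (words c x) y * H c)%:E =
   \int[Gam]_c (D k (words c x) y * H c)%:E)%E.
  by rewrite -(P (s - k)%N) subnKC.
elim: n => [|n IH] kn; first by rewrite addn0.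
rewrite -IH; last by rewrite addnS in kn; exact: ltnW.
rewrite addnS in kn *; apply: (@integral_peel1 (Ordinal kn)) => // c z.
by apply: HE; rewrite /= leq_addr.
Qed.

(** The layers above [k] peel off because the ratio does not see them. Redrawing the word of layer
    [k] then leaves an integral over that word alone, with the others frozen, which is why the
    hypothesis is uniform in [u]. *)
Lemma integral_tilt (k : 'I_s) x (e : R) (g : \bar R) :
  (forall u, \int[nu]_y \int[mu]_z (D k.+1 (tset u k z) y *
     expR (e * (ln (D k.+1 (tset u k z) y) - ln (D k u y))))%:E <= g)%E ->
  (\int[nu]_y \int[Gam]_c (D s (words c x) y *
     expR (e * (ln (D k.+1 (words c x) y) - ln (D k (words c x) y))))%:E <= g)%E.
Proof.
move=> Hg.
pose H c y := expR (e * (ln (D k.+1 (words c x) y) - ln (D k (words c x) y))).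
have mH : measurable_fun setT (fun p : codebook * Y => H p.1 p.2).
  apply: measurableT_comp => //; apply: measurable_funM => //; apply: measurable_funB.
    by apply: measurableT_comp => //; exact: measurable_Dwords.
  by apply: measurableT_comp => //; exact: measurable_Dwords.
pose G u y z := (D k.+1 (tset u k z) y *
  expR (e * (ln (D k.+1 (tset u k z) y) - ln (D k u y))))%:E.
have G0 u y z : (0 <= G u y z)%E by rewrite lee_fin mulr_ge0 ?expR_ge0// ltW.
have mG : measurable_fun setT (fun p : codebook * Y * X => G (words p.1.1 x) p.1.2 p.2).
  have m1 : measurable_fun setT (fun p : codebook * Y * X => D k.+1 (tset (words p.1.1 x) k p.2) p.1.2).
    apply: (measurableT_comp (mD k.+1) (f := fun p => D k.+1 p.1 p.2)
      (g := fun p : codebook * Y * X => (tset (words p.1.1 x) k p.2, p.1.2))).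
    apply/measurable_fun_pairP; split => /=; last exact: (measurableT_comp measurable_snd measurable_fst).
    apply: (measurableT_comp (@measurable_tset _ _ _ k)
      (g := fun p : codebook * Y * X => (words p.1.1 x, p.2))).
    apply/measurable_fun_pairP; split => /=; last exact: measurable_snd.
    exact: (measurableT_comp (measurable_words x) (measurableT_comp measurable_fst measurable_fst)).
  apply/measurable_EFinP; apply: measurable_funM => //.
  apply: measurableT_comp => //; apply: measurable_funM => //; apply: measurable_funB.
    exact: measurableT_comp.
  apply: measurableT_comp => //.
  exact: (measurableT_comp (measurable_Dwords k x) measurable_fst).
rewrite [leLHS](_ : _ = \int[nu]_y \int[Gam]_c \int[mu]_z G (words c x) y z)%E; last first.
  apply: eq_integral => y _.
  have mHy : measurable_fun setT (fun c => H c y) by exact: (measurable_fun_pair1 y mH).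
  rewrite (@integral_peel k.+1 x y (fun c => H c y) (ltn_ord k) mHy (fun c => expR_ge0 _)); last first.
    by move=> j c z kj; rewrite /H words_tset !D_tset_ge// ltnW.
  rewrite (@integral_iid_tset _ _ _ mu _ (slot (x k))).
  - apply: eq_integral => c _; apply: eq_integral => z _.
    by rewrite /H /G words_tset (@D_tset_ge k).
  - by apply/measurable_EFinP; apply: measurable_funM => //; exact: measurable_Dc.
  - by move=> c; rewrite lee_fin mulr_ge0 ?expR_ge0// ltW.
have mG2 := @measurable_integral2 _ _ _ _ _ mu (fun p : codebook * Y => G (words p.1 x) p.2) mG
   (fun p z => G0 _ _ _).
rewrite -(@integral_swap _ _ _ _ _ Gam nu (fun c y => \int[mu]_z G (words c x) y z)%E mG2
   (fun c y => integral_ge0 _ (fun z _ => G0 _ _ _))).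
rewrite -(integral_prob_cst Gam g).
apply: ge0_le_integral => //.
- by move=> c _; apply: integral_ge0 => y _; apply: integral_ge0.
- exact: (measurable_integral2 nu mG2 (fun c y => integral_ge0 _ (fun z _ => G0 _ _ _))).
- by move=> c _; exact: Hg.
Qed.

(** Given the lower words, a wrong word is independent of the output, so its likelihood ratio has
    mean one: averaging out the sent word of layer [k] produces a [D k] that cancels the
    denominator, and averaging out the wrong word then leaves the density [D k]. *)
Lemma integral_alt (k : 'I_s) x (i : A k) : i != x k ->
  (\int[nu]_y \int[Gam]_c (D s (words c x) y *
     (dalt c x i y / D k (words c x) y))%:E = 1)%E.
Proof.
move=> ix.
transitivity (\int[nu]_y \int[Gam]_c (D k (words c x) y)%:E)%E; last first.
  rewrite -(@integral_swap _ _ _ _ _ Gam nu (fun c y => (D k (words c x) y)%:E)).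
  - under eq_integral do rewrite D_int.
    by rewrite integral_prob_cst.
  - by apply/measurable_EFinP; exact: measurable_Dwords.
  - by move=> c y; rewrite lee_fin ltW.
apply: eq_integral => y _.
have mV : measurable_fun setT (fun c => (D k (words c x) y)^-1).
  (* Measurability of the reciprocal is read off from its form as an exponential of a logarithm. *)
  rewrite (_ : (fun c => _) = fun c => expR (- ln (D k (words c x) y))).
    apply: measurableT_comp => //; apply: measurableT_comp => //.
    by apply: measurableT_comp => //; exact: measurable_Dc.
  by apply/funext => c; rewrite expRN lnK// posrE.
have mA : measurable_fun setT (fun c => dalt c x i y).
  exact: (measurable_fun_pair1 y (measurable_dalt x i)).
have q0 c : 0 <= dalt c x i y / D k (words c x) y by rewrite divr_ge0// ltW// D_gt0.
rewrite (@integral_peel k.+1 x y (fun c => dalt c x i y / D k (words c x) y) (ltn_ord k)) //; last 2 first.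
- exact: measurable_funM.
- move=> j c z kj; rewrite /dalt words_tset (@D_tset_ge k _ _ _ _ (ltnW kj)); congr (_ / _).
  apply: D_eq => l lk; rewrite !tnth_tset.
  have [_|lk'] := eqVneq l k.
    rewrite /word tnth_tset [slot i == _]eq_sym slot_eq.
    by rewrite -val_eqE gtn_eqF.
  by case: eqP => // lj; move: lk; rewrite lj ltnNge kj.
(* This is where [ix] matters: the competing word occupies a slot other than the one redrawn, and
   [dalt] overwrites the sent word. *)
rewrite (@integral_peel1 k x y (fun c => dalt c x i y / D k (words c x) y)) //; last 2 first.
- exact: measurable_funM.
- move=> c z; rewrite /dalt words_tset (@D_tset_ge k)// word_tset (negbTE ix).
  congr (D _ _ _ / _); apply: eq_from_tnth => l; rewrite !tnth_tset.
  by case: eqP.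
transitivity (\int[Gam]_c (dalt c x i y)%:E)%E.
  by apply: eq_integral => c _; rewrite mulrC divfK// gt_eqF.
rewrite (@integral_iid_tset _ _ _ mu _ (slot i)).
- apply: eq_integral => c _; rewrite -D_marg.
  apply: eq_integral => z _.
  by rewrite /dalt word_tset eqxx words_tset_neq.
- exact/measurable_EFinP.
- by move=> c; rewrite lee_fin ltW// D_gt0.
Qed.

Lemma integral_level0 x (f : Y -> R) :
  measurable_fun setT f -> (forall y, 0 <= f y) ->
  (\int[nu]_y \int[Gam]_c (D s (words c x) y * f y)%:E =
   \int[Gam]_c \int[nu]_y (D 0 (words c x) y * f y)%:E)%E.
Proof.
move=> mf f0.
rewrite (@integral_swap _ _ _ _ _ Gam nu (fun c y => (D 0 (words c x) y * f y)%:E)).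
- apply: eq_integral => y _.
  by rewrite (@integral_peel 0 x y (fun=> f y)).
- apply/measurable_EFinP; apply: measurable_funM; first exact: measurable_Dwords.
  exact: (measurableT_comp mf measurable_snd).
- by move=> c y; rewrite lee_fin mulr_ge0// ltW.
Qed.

End random_codebook.

(** * Log-sum bound on the leakage *)

Section log_sum.
Context {R : realType}.

Lemma ln_ge1BV (t : R) : 0 < t -> 1 - t^-1 <= ln t.
Proof.
move=> t0; have := @le_ln1Dx R (t^-1 - 1).
rewrite subrKC lnV ?posrE// => h.
have : - ln t <= t^-1 - 1 by apply: h; rewrite ltrBrDl subrr invr_gt0.
lra.
Qed.

Lemma xlnx_ge (x q : R) : 0 < x -> 0 < q -> x - q <= x * ln (x / q).
Proof.
move=> x0 q0; have h := ln_ge1BV (divr_gt0 x0 q0).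
have : x * (1 - (x / q)^-1) <= x * ln (x / q) by apply: ler_wpM2l => //; exact: ltW.
rewrite invf_div mulrBr mulr1 mulrCA divff ?mulr1// gt_eqF//.
Qed.

Lemma log_sum (I : finType) (P : pred I) (p g : I -> R) (i0 : I) : P i0 ->
  (forall i, 0 < p i) -> (forall i, 0 < g i) ->
  (\sum_(i | P i) p i) * ln ((\sum_(i | P i) p i) / \sum_(i | P i) g i) <=
  \sum_(i | P i) p i * ln (p i / g i).
Proof.
move=> Pi0 p0 g0; set p' := \sum_(i | P i) p i; set g' := \sum_(i | P i) g i.
have p'0 : 0 < p'.
  by rewrite /p' (bigD1 i0)//= ltr_pwDl// sumr_ge0// => i _; rewrite ltW.
have g'0 : 0 < g'.
  by rewrite /g' (bigD1 i0)//= ltr_pwDl// sumr_ge0// => i _; rewrite ltW.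
rewrite -subr_ge0 mulr_suml -sumrB.
(* Each summand is bounded below by [xlnx_ge] with [q] equal to [g i] rescaled to total mass [p'];
   these linear lower bounds add up to zero. *)
have e : \sum_(i | P i) (p i - g i * (p' / g')) = 0.
  by rewrite sumrB -mulr_suml -/g' mulrCA divff ?mulr1 ?subrr// gt_eqF.
rewrite -[leLHS]e; apply: ler_sum => i _.
have := xlnx_ge (p0 i) (mulr_gt0 (g0 i) (divr_gt0 p'0 g'0)).
move=> /le_trans; apply; rewrite -mulrBr ler_wpM2l ?(ltW (p0 i))//.
have q0 : 0 < p' / g' by rewrite divr_gt0.
have gq0 : 0 < g i * (p' / g') by rewrite mulr_gt0.
rewrite (ln_div (p0 i) gq0) (ln_div (p0 i) (g0 i)).
by rewrite (lnM (g0 i) q0); lra.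
Qed.

End log_sum.

(** * Class averages over message vectors *)

Section product_index.
Context {R : realType} (s : nat) (M : 'I_s -> nat).

Definition dset (w : msgspace M) (k : 'I_s) (i : 'I_(M k)) : msgspace M :=
  [ffun j => eqtype.dfwith w i j].

Lemma dset_in w (k : 'I_s) (i : 'I_(M k)) : dset w i k = i.
Proof. by rewrite ffunE eqtype.dfwith_in. Qed.

Lemma dset_out w (k : 'I_s) (i : 'I_(M k)) j : j != k -> dset w i j = w j.
Proof. by move=> jk; rewrite ffunE eqtype.dfwith_out// eq_sym. Qed.

(** Exchanging coordinate [k] with the spare index is an involution on pairs, which turns the
    summand into [H] of the first component. *)
Lemma sum_dset (k : 'I_s) (H : msgspace M -> R) :
  \sum_w \sum_(i < M k) H (dset w i) = (M k)%:R * \sum_w H w.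
Proof.
rewrite pair_bigA /=.
pose sg (p : msgspace M * 'I_(M k)) := (dset p.1 p.2, p.1 k).
have sgK : involutive sg.
  move=> [w i]; rewrite /sg /= dset_in; congr (_, _).
  apply/ffunP => j; have [->|jk] := eqVneq j k; first by rewrite dset_in.
  by rewrite !dset_out.
rewrite (reindex_inj (inv_inj sgK)) /=.
rewrite (eq_bigr (fun p : msgspace M * 'I_(M k) => H p.1)); last first.
  move=> [w i] _ /=; congr H; apply/ffunP => j.
  by have [->|jk] := eqVneq j k; rewrite ?dset_in// !dset_out.
rewrite -(pair_bigA _ (fun w (i : 'I_(M k)) => H w)) /= mulr_sumr.
by apply: eq_bigr => w _; rewrite sumr_const card_ord mulr_natl.
Qed.

Definition agree_ge (r : nat) (w w' : msgspace M) : bool :=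
  [forall k : 'I_s, (r <= k)%N ==> (w' k == w k)].

Lemma agree_geP r (w w' : msgspace M) :
  reflect (forall k : 'I_s, (r <= k)%N -> w' k = w k) (agree_ge r w w').
Proof.
apply: (iffP forallP) => h k; first by move=> rk; have /implyP/(_ rk)/eqP := h k.
by apply/implyP => rk; apply/eqP/h.
Qed.

Lemma agree_ge_refl r w : agree_ge r w w. Proof. exact/agree_geP. Qed.

Lemma agree_ge_sym r w w' : agree_ge r w w' = agree_ge r w' w.
Proof. by apply/agree_geP/agree_geP => h k rk; rewrite h. Qed.

Lemma agree_ge_class r w w' : agree_ge r w w' -> agree_ge r w =1 agree_ge r w'.
Proof.
move=> /agree_geP h u; apply/agree_geP/agree_geP => h' k rk.
  by rewrite h'// h.
by rewrite h'// -h.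
Qed.

Definition class_card r w : R := \sum_(w' | agree_ge r w w') 1.

Lemma class_card_gt0 r w : 0 < class_card r w.
Proof.
by rewrite /class_card (bigD1 w) ?agree_ge_refl//= ltr_pwDl// sumr_ge0.
Qed.

(** Averaging within the classes of an equivalence relation preserves the total: each [w'] is
    counted once per member of its class, with weight one over the size. *)
Lemma sum_class_avg r (G : msgspace M -> R) :
  \sum_w (class_card r w)^-1 * \sum_(w' | agree_ge r w w') G w' = \sum_w G w.
Proof.
under eq_bigr do rewrite mulr_sumr.
rewrite (exchange_big_dep predT)//=; apply: eq_bigr => w' _.
rewrite (eq_bigr (fun=> (class_card r w')^-1 * G w')); last first.
  move=> w h; congr (_^-1 * _); apply: eq_bigl => u; exact: agree_ge_class.
rewrite (eq_bigl (agree_ge r w')); last by move=> w; rewrite agree_ge_sym.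
have -> : \sum_(w | agree_ge r w' w) (class_card r w')^-1 * G w' =
   (class_card r w') * ((class_card r w')^-1 * G w').
  by rewrite {1}/class_card mulr_suml; apply: eq_bigr => w _; rewrite mul1r.
by rewrite mulrA divff ?mul1r// gt_eqF// class_card_gt0.
Qed.

(** Every class contains each choice of the coordinates below [r] exactly once; splicing in the
    other top coordinates is a bijection between classes that [G] does not notice. *)
Lemma sum_class_const r (G : msgspace M -> R) w1 w2 :
  (forall w w' : msgspace M, (forall k : 'I_s, (k < r)%N -> w k = w' k) -> G w = G w') ->
  \sum_(w' | agree_ge r w1 w') G w' = \sum_(w' | agree_ge r w2 w') G w'.
Proof.
move=> GE.
pose mg (w u : msgspace M) : msgspace M := [ffun k : 'I_s => if (r <= k)%N then w k else u k].
have mgK w1' w2' u : agree_ge r w1' u -> mg w1' (mg w2' u) = u.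
  move=> /agree_geP h; apply/ffunP => k; rewrite !ffunE.
  by have [rk|//] := leqP r k; rewrite h.
have mgA w u : agree_ge r w (mg w u) by apply/agree_geP => k rk; rewrite ffunE rk.
rewrite (reindex_onto (mg w1) (mg w2)) /=; last by move=> u; exact: mgK.
apply: eq_big => [u|u _]; last first.
  by apply: GE => k; rewrite ltnNge => /negbTE rk; rewrite ffunE rk.
rewrite mgA /=; apply/eqP/idP => [<-|]; first exact: mgA.
exact: mgK.
Qed.

End product_index.

(** * Leakage at a fixed codebook and output *)

Section leakage_pointwise.
Context {R : realType} (s : nat) (M V : 'I_s -> nat).
Hypothesis V_gt0 : forall k, (0 < V k)%N.
Variables (r : nat) (rs : (r <= s)%N).
Variable D : nat -> msgspace M -> msgspace V -> R.
Hypothesis D_gt0 : forall k w v, 0 < D k w v.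
Hypothesis D_eq : forall k (w w' : msgspace M) (v v' : msgspace V),
  (forall j : 'I_s, (j < k)%N -> w j = w' j /\ v j = v' j) -> D k w v = D k w' v'.
Variables (w0 : msgspace M) (v0 : msgspace V).

(** Density seen by an observer who knows all words below layer [k] and the message of layer [k],
    but not its randomization. *)
Definition mixV (k : 'I_s) w v : R := (V k)%:R^-1 * \sum_(i < V k) D k.+1 w (dset v i).

Let nV : R := #|{: msgspace V}|%:R.
Let N : R := #|{: msgspace M}|%:R.
Let fbar w : R := nV^-1 * \sum_v D s w v.
Let cw w : R := (class_card r w)^-1 * \sum_(w' | agree_ge r w w') fbar w'.
Let marg : R := N^-1 * \sum_w fbar w.
(* Reference measure for the log-sum inequality: summing out [v_k] for the top
   layer turns [D k.+1] into [V k * mixV k], so its total mass telescopes. *)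
Let chain (m : nat) w v : R := D m w v *
  \prod_(k < s | (r <= k < m)%N) (D k w v / mixV k w v).

Let nV0 : 0 < nV.
Proof. by rewrite ltr0n; apply/card_gt0P; exists v0. Qed.

Let N0 : 0 < N.
Proof. by rewrite ltr0n; apply/card_gt0P; exists w0. Qed.

Lemma mixV_gt0 k w v : 0 < mixV k w v.
Proof.
rewrite mulr_gt0 ?invr_gt0 ?ltr0n// (bigD1 (Ordinal (V_gt0 k)))//=.
by rewrite ltr_pwDl// sumr_ge0// => i _; exact: ltW.
Qed.

Let chain_gt0 m w v : 0 < chain m w v.
Proof.
by rewrite mulr_gt0//; apply: prodr_gt0 => k _; rewrite divr_gt0// mixV_gt0.
Qed.

Lemma mixV_eq (k : 'I_s) w (v v' : msgspace V) : (forall j : 'I_s, (j < k)%N -> v j = v' j) ->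
  mixV k w v = mixV k w v'.
Proof.
move=> h; congr (_ * _); apply: eq_bigr => i _; apply: D_eq => j; rewrite ltnS => jk.
split => //; have [->|jk'] := eqVneq j k; first by rewrite !dset_in.
by rewrite !dset_out// h// ltn_neqAle jk' jk.
Qed.

Lemma sum_chainS (k : 'I_s) w : (r <= k)%N ->
  \sum_v chain k.+1 w v = \sum_v chain k w v.
Proof.
move=> rk; have Vk0 : (V k)%:R != 0 :> R by rewrite pnatr_eq0 -lt0n.
apply: (mulfI Vk0); rewrite -sum_dset mulr_sumr; apply: eq_bigr => v _.
pose C := \prod_(j < s | (r <= j < k)%N) (D j w v / mixV j w v).
have Ej (j : 'I_s) (i : 'I_(V k)) : (j <= k)%N ->
    D j w (dset v i) / mixV j w (dset v i) = D j w v / mixV j w v :> R.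
  move=> jk; have h (l : 'I_s) : (l < j)%N -> dset v i l = v l.
    move=> lj; rewrite dset_out// -val_eqE ltn_eqF//; exact: leq_trans lj jk.
  by congr (_ / _); [apply: D_eq => l /h ->|apply: mixV_eq].
transitivity (\sum_(i < V k) D k.+1 w (dset v i) * (D k w v / mixV k w v * C)).
  apply: eq_bigr => i _; congr (_ * _).
  rewrite (bigD1 k) /=; last by rewrite rk ltnS leqnn.
  rewrite Ej//; congr (_ * _); apply: eq_big => [j|j /andP[/andP[_ jk] _]].
    by rewrite ltnS -andbA -val_eqE /= [(_ <= k)%N && _]andbC -ltn_neqAle.
  by rewrite Ej.
rewrite -mulr_suml.
have -> : \sum_(i < V k) D k.+1 w (dset v i) = (V k)%:R * mixV k w v.
  by rewrite /mixV mulrA divff ?mul1r.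
rewrite -/C /chain -/C; field; exact: lt0r_neq0 (mixV_gt0 _ _ _).
Qed.

Lemma sum_chain w : \sum_v chain s w v = \sum_v D r w v.
Proof.
suff P n : (r + n <= s)%N -> \sum_v chain (r + n) w v = \sum_v D r w v.
  by rewrite -(P (s - r)%N) subnKC.
elim: n => [|n IH] rn.
  rewrite addn0; apply: eq_bigr => v _; rewrite /chain big_pred0 ?mulr1// => k.
  by rewrite leqNgt; case: ltngtP.
rewrite addnS in rn *.
by rewrite -IH ?(ltnW rn)// (@sum_chainS (Ordinal rn)) //= leq_addr.
Qed.

(** The marginal is exchanged for a reference [Q], the class average of [D r]. As [D r] sees only
    messages below [r], [Q] is the same for every class; as [chain s] has the same total mass, the
    log-sum inequality within a class can compare [D s] with [chain s] term by term. *)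
Lemma leakage_pointwise :
  \sum_w (cw w * ln (cw w / marg) + marg) <=
  \sum_w nV^-1 * \sum_v D s w v * \sum_(k < s | (r <= k)%N) ln (1 + mixV k w v / D k w v)
  + \sum_w nV^-1 * \sum_v D r w v.
Proof.
have fbar0 w : 0 < fbar w.
  rewrite mulr_gt0 ?invr_gt0// (bigD1 v0)//= ltr_pwDl// sumr_ge0// => v _; exact: ltW.
have cw0 w : 0 < cw w.
  rewrite mulr_gt0 ?invr_gt0 ?class_card_gt0// (bigD1 w) ?agree_ge_refl//=.
  by rewrite ltr_pwDl// sumr_ge0// => w' _; exact: ltW.
have m0 : 0 < marg.
  rewrite mulr_gt0 ?invr_gt0// (bigD1 w0)//= ltr_pwDl// sumr_ge0// => w _; exact: ltW.
pose gbar w := nV^-1 * \sum_v D r w v.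
pose Qw w := (class_card r w)^-1 * \sum_(w' | agree_ge r w w') gbar w'.
have gE (w w' : msgspace M) : (forall k : 'I_s, (k < r)%N -> w k = w' k) -> gbar w = gbar w'.
  by move=> h; congr (_ * _); apply: eq_bigr => v _; apply: D_eq => j jr; rewrite h.
pose Q := Qw w0.
have QwE w : Qw w = Q.
  rewrite /Q /Qw /class_card (@sum_class_const _ _ _ r gbar w w0 gE).
  by rewrite (@sum_class_const _ _ _ r (fun=> 1) w w0).
have gbar0 w : 0 < gbar w.
  rewrite mulr_gt0 ?invr_gt0// (bigD1 v0)//= ltr_pwDl// sumr_ge0// => v _; exact: ltW.
have Q0 : 0 < Q.
  rewrite mulr_gt0 ?invr_gt0 ?class_card_gt0// (bigD1 w0) ?agree_ge_refl//=.
  by rewrite ltr_pwDl// sumr_ge0// => w' _; exact: ltW.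
have NQ : N * Q = \sum_w gbar w.
  rewrite -(sum_class_avg r gbar) (eq_bigr (fun=> Q)); last by move=> w _; exact: QwE.
  by rewrite sumr_const mulr_natl.
have Scw : \sum_w cw w = N * marg.
  by rewrite /cw sum_class_avg /marg mulrA divff ?mul1r// gt_eqF.
pose ell w v := \sum_(k < s | (r <= k)%N) ln (1 + mixV k w v / D k w v).
have H1 w : cw w * ln (cw w / Q) <=
    (class_card r w)^-1 * \sum_(w' | agree_ge r w w') nV^-1 * \sum_v D s w' v * ell w' v.
  pose P (p : msgspace M * msgspace V) := agree_ge r w p.1.
  pose K := (class_card r w)^-1 * nV^-1.
  have K0 : 0 < K by rewrite mulr_gt0 ?invr_gt0 ?class_card_gt0.
  have S (F : msgspace M -> msgspace V -> R) :
      (class_card r w)^-1 * \sum_(w' | agree_ge r w w') nV^-1 * \sum_v F w' v =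
      \sum_(p | P p) K * F p.1 p.2.
    transitivity (\sum_(w' | agree_ge r w w') \sum_v K * F w' v).
      by rewrite -mulr_sumr mulrA mulr_sumr; apply: eq_bigr => w' _; rewrite mulr_sumr.
    by rewrite pair_big /=; apply: eq_bigl => p; rewrite andbT.
  have -> : cw w = \sum_(p | P p) K * D s p.1 p.2 by rewrite -S.
  have -> : Q = \sum_(p | P p) K * chain s p.1 p.2.
    rewrite -S -(QwE w) /Qw; congr (_ * _); apply: eq_bigr => w' _.
    by rewrite sum_chain.
  apply: le_trans (@log_sum _ _ P _ _ (w, v0) _ _ _) _ => //.
  - exact: agree_ge_refl.
  - by move=> p; rewrite mulr_gt0.
  - by move=> p; rewrite mulr_gt0.
  rewrite S; apply: ler_sum => -[w' v] _ /=.
  rewrite [leRHS]mulrA; apply: ler_wpM2l; first by rewrite ltW// mulr_gt0.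
  have -> : K * D s w' v / (K * chain s w' v) =
     \prod_(k < s | (r <= k)%N) (mixV k w' v / D k w' v).
    rewrite /chain (eq_bigl (fun k : 'I_s => (r <= k)%N)); last first.
      by move=> k; rewrite ltn_ord andbT.
    have -> : \prod_(k < s | (r <= k)%N) (mixV k w' v / D k w' v) =
        (\prod_(k < s | (r <= k)%N) (D k w' v / mixV k w' v))^-1.
      by rewrite -prodfV; apply: eq_bigr => k _; rewrite invf_div.
    have p0 : \prod_(k < s | (r <= k)%N) (D k w' v / mixV k w' v) != 0.
      by apply/lt0r_neq0/prodr_gt0 => k _; rewrite divr_gt0// mixV_gt0.
    by field; rewrite p0 (lt0r_neq0 K0) (lt0r_neq0 (D_gt0 _ _ _)).
  (* Each ratio [z] is enlarged to [1 + z], so that every logarithm becomes nonnegative and the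
     layers can be integrated separately. *)
  rewrite /ell; set p := \prod_(k | _) _.
  suff [] : 0 < p /\ ln p <= \sum_(k < s | (r <= k)%N) ln (1 + mixV k w' v / D k w' v) by [].
  rewrite /p; elim/big_ind2 : _ => [|x x' y y' [x0 xx'] [y0 yy']|k _].
  - by rewrite ln1.
  - by rewrite mulr_gt0// lnM// lerD.
  - have q0 : 0 < mixV k w' v / D k w' v by rewrite divr_gt0// mixV_gt0.
    by split=> //; rewrite ler_ln ?posrE ?addr_gt0// lerDr.
have H2 : \sum_w (cw w * ln (cw w / marg) + marg) <=
    \sum_w cw w * ln (cw w / Q) + N * Q.
  have E w : cw w * ln (cw w / marg) = cw w * ln (cw w / Q) - cw w * ln (marg / Q).
    by rewrite !ln_div ?posrE//; ring.
  rewrite big_split /= (eq_bigr _ (fun w _ => E w)) sumrB -mulr_suml Scw.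
  rewrite sumr_const -/N -mulr_natl -/N -addrA lerD2l.
  (* The exchange subtracts [N * marg * ln (marg / Q)], which is at least [N * (marg - Q)]; with the
     added terms [marg] at most [N * Q] remains. *)
  have := xlnx_ge m0 Q0; have := N0; move: (ln _) => l; nra.
apply: (le_trans H2); rewrite NQ lerD2r.
apply: (le_trans (ler_sum _ (fun w _ => H1 w))).
by rewrite sum_class_avg.
Qed.

End leakage_pointwise.

(** * Expectations over codebook and output *)

Section expectation.
Context d1 d2 (T1 : measurableType d1) (T2 : measurableType d2) (R : realType).
Variables (P : probability T1 R) (nu : probability T2 R).
Implicit Types F G : T1 -> T2 -> R.

Definition nnm F := measurable_fun setT (fun p : T1 * T2 => F p.1 p.2) /\
  forall c y, 0 <= F c y.

(** Both variables follow reference laws; the true law of the output enters later through the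
    density factor [cdens s] inside [F]. *)
Definition EE F : \bar R := (\int[nu]_y \int[P]_c (F c y)%:E)%E.

Lemma nnm_measurable F : nnm F -> measurable_fun setT (fun p : T1 * T2 => (F p.1 p.2)%:E).
Proof. by move=> [mF _]; exact/measurable_EFinP. Qed.

Lemma nnm_ge0 F c y : nnm F -> (0 <= (F c y)%:E)%E.
Proof. by move=> [_ F0]; rewrite lee_fin. Qed.

Lemma EE_swap F : nnm F -> EE F = (\int[P]_c \int[nu]_y (F c y)%:E)%E.
Proof.
move=> nF; rewrite /EE.
by rewrite (@integral_swap _ _ _ _ _ P nu (fun c y => (F c y)%:E)) //;
  [exact: nnm_measurable | move=> c y; exact: nnm_ge0].
Qed.

Lemma nnmD F G : nnm F -> nnm G -> nnm (fun c y => F c y + G c y).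
Proof.
move=> [mF F0] [mG G0]; split; first exact: measurable_funD.
by move=> c y; rewrite addr_ge0.
Qed.

Lemma nnmZ k F : 0 <= k -> nnm F -> nnm (fun c y => k * F c y).
Proof.
move=> k0 [mF F0]; split; first by apply: measurable_funM.
by move=> c y; rewrite mulr_ge0.
Qed.

Lemma nnm_sum (I : Type) (r : seq I) (Q : pred I) (F : I -> T1 -> T2 -> R) :
  (forall i, nnm (F i)) -> nnm (fun c y => \sum_(i <- r | Q i) F i c y).
Proof.
move=> nF; split; last by move=> c y; rewrite sumr_ge0// => i _; have [] := nF i.
rewrite (_ : (fun p => _) = fun p : T1 * T2 =>
    \sum_(i <- r) if Q i then F i p.1 p.2 else 0); last first.
  by apply/funext => p; rewrite big_mkcond.
apply: measurable_sum => i; case: (Q i) => //.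
by have [] := nF i.
Qed.

Lemma EED F G : nnm F -> nnm G -> EE (fun c y => F c y + G c y) = (EE F + EE G)%E.
Proof.
move=> nF nG; rewrite /EE -ge0_integralD//.
- apply: eq_integral => y _; under eq_integral do rewrite EFinD.
  rewrite ge0_integralD//.
  + by move=> c _; exact: nnm_ge0.
  + exact: (measurable_fun_pair1 y (nnm_measurable nF)).
  + by move=> c _; exact: nnm_ge0.
  + exact: (measurable_fun_pair1 y (nnm_measurable nG)).
- by move=> y _; apply: integral_ge0 => c _; exact: nnm_ge0.
- exact: (@measurable_integral1 _ _ _ _ _ P (fun c y => (F c y)%:E) (nnm_measurable nF) (fun c y => nnm_ge0 c y nF)).
- by move=> y _; apply: integral_ge0 => c _; exact: nnm_ge0.
- exact: (@measurable_integral1 _ _ _ _ _ P (fun c y => (G c y)%:E) (nnm_measurable nG) (fun c y => nnm_ge0 c y nG)).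
Qed.

Lemma EEZ k F : 0 <= k -> nnm F -> EE (fun c y => k * F c y) = (k%:E * EE F)%E.
Proof.
move=> k0 nF; rewrite /EE -ge0_integralZl_EFin//.
- apply: eq_integral => y _; under eq_integral do rewrite EFinM.
  rewrite ge0_integralZl_EFin//.
  + by move=> c _; exact: nnm_ge0.
  + exact: (measurable_fun_pair1 y (nnm_measurable nF)).
- by move=> y _; apply: integral_ge0 => c _; exact: nnm_ge0.
- exact: (@measurable_integral1 _ _ _ _ _ P (fun c y => (F c y)%:E) (nnm_measurable nF) (fun c y => nnm_ge0 c y nF)).
Qed.

Lemma EE0 : EE (fun _ _ => 0) = 0%E.
Proof. by rewrite /EE; under eq_integral do rewrite integral0; rewrite integral0. Qed.

Lemma EE_sum_le (I : Type) (r : seq I) (Q : pred I) (F : I -> T1 -> T2 -> R) (b : I -> R) :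
  (forall i, nnm (F i)) -> (forall i, Q i -> EE (F i) <= (b i)%:E)%E ->
  (EE (fun c y => (\sum_(i <- r | Q i) F i c y)%R) <= (\sum_(i <- r | Q i) b i)%:E)%E.
Proof.
move=> nF Fb; elim: r => [|i r IH].
  rewrite big_nil (_ : (fun c y => _) = fun _ _ => 0) ?EE0//.
  by apply/funext => c; apply/funext => y; rewrite big_nil.
rewrite big_cons; case: ifPn => Qi; last first.
  rewrite (_ : (fun c y => _) = fun c y => \sum_(i <- r | Q i) F i c y)//.
  by apply/funext => c; apply/funext => y; rewrite big_cons (negbTE Qi).
rewrite (_ : (fun c y => _) = fun c y => F i c y + \sum_(i <- r | Q i) F i c y); last first.
  by apply/funext => c; apply/funext => y; rewrite big_cons Qi.
rewrite EED//; last exact: nnm_sum.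
by rewrite EFinD leeD// Fb.
Qed.

(** The criteria, each divided by its tolerance, have a sum of expectation at most [#|I| / #|I|.+1].
    The extra one in the denominator makes this strictly less than one, so some code keeps the sum,
    and with it every term, below one. *)
Lemma exists_good_code (I : finType) (F : I -> T1 -> T2 -> R) (e : I -> R) :
  (forall i, nnm (F i)) -> (forall i, 0 < e i) ->
  (forall i, EE (F i) <= (e i / #|I|.+1%:R)%:E)%E ->
  exists c, forall i, (\int[nu]_y (F i c y)%:E <= (e i)%:E)%E.
Proof.
move=> nF e0 Fe.
pose G c y := \sum_(i : I) (e i)^-1 * F i c y.
have nFi i : nnm (fun c y => (e i)^-1 * F i c y).
  by apply: nnmZ => //; rewrite invr_ge0 ltW.
have nG : nnm G by exact: nnm_sum.
have : (EE G < 1)%E.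
  apply: (@le_lt_trans _ _ (\sum_(i : I) (#|I|.+1%:R^-1 : R))%:E).
    apply: EE_sum_le => // i _; rewrite EEZ ?invr_ge0 ?(ltW (e0 i))//.
    apply: (@le_trans _ _ ((e i)^-1%:E * (e i / #|I|.+1%:R)%:E)%E).
      by apply: lee_wpmul2l => //; rewrite lee_fin invr_ge0 ltW.
    by rewrite -EFinM mulrA mulVf ?mul1r// gt_eqF.
  by rewrite sumr_const lte_fin -[ltLHS]mulr_natl ltr_pdivrMr ?mul1r ?ltr_nat ?ltr0n.
rewrite EE_swap// => lt1.
have [c Hc] : exists c, (\int[nu]_y (G c y)%:E < 1)%E.
  apply: contrapT => /forallNP h; move: lt1; apply/negP; rewrite -leNgt.
  rewrite -(integral_prob_cst P 1%E); apply: ge0_le_integral => //.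
  - exact: (@measurable_integral2 _ _ _ _ _ nu (fun c y => (G c y)%:E) (nnm_measurable nG) (fun c y => nnm_ge0 c y nG)).
  - by move=> c _; rewrite leNgt; apply/negP/h.
exists c => i.
apply: (@le_trans _ _ ((e i)%:E * \int[nu]_y (G c y)%:E)%E); last first.
  rewrite -[leRHS]mule1; apply: lee_wpmul2l; first by rewrite lee_fin ltW.
  exact: ltW.
rewrite -ge0_integralZl_EFin//; last 3 first.
- by move=> y _; exact: nnm_ge0.
- exact: (measurable_fun_pair2 c (nnm_measurable nG)).
- exact: ltW.
apply: ge0_le_integral => //.
- by move=> y _; exact: nnm_ge0.
- exact: (measurable_fun_pair2 c (nnm_measurable (nF i))).
- by apply: emeasurable_funM => //; exact: (measurable_fun_pair2 c (nnm_measurable nG)).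
move=> y _; rewrite -EFinM lee_fin /G (bigD1 i)//= mulrDr mulrA divff ?gt_eqF// mul1r.
rewrite lerDl mulr_ge0 ?(ltW (e0 i))// sumr_ge0// => j _.
by have [_] := nFi j.
Qed.

End expectation.

(** * Finite mixtures and finitely many tests *)

Section uniform_mixture.
Context d (T : measurableType d) (R : realType) (I : finType) (i0 : I) (f : I -> T).

Let cst_inv : {nonneg R} := NngNum (ltac:(by rewrite invr_ge0) : 0 <= (#|I|%:R : R)^-1).

(** Law of [f i] for a uniform index [i], where values may coincide; as a scaled sum of Dirac
    measures it integrates to a finite average. *)
Definition umix : set T -> \bar R :=
  mscale cst_inv (msum (fun n => \d_(f (nth i0 (enum I) n))) #|I|).

HB.instance Definition _ := Measure.on umix.

Let I0 : #|I|%:R != 0 :> R.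
Proof. by rewrite pnatr_eq0 -lt0n; apply/card_gt0P; exists i0. Qed.

Let umix_setT : umix setT = 1%E.
Proof.
transitivity ((#|I|%:R^-1)%:E * \sum_(n < #|I|) (1%R)%:E : \bar R)%E.
  by congr (_ * _)%E; apply: eq_bigr => n _; exact: diracT.
rewrite sumEFin sumr_const card_ord -EFinM mulVf//.
Qed.

HB.instance Definition _ := Measure_isProbability.Build _ _ _ umix umix_setT.

Lemma integral_umix (g : T -> R) : measurable_fun setT g -> (forall t, 0 <= g t) ->
  (\int[umix]_x (g x)%:E = (#|I|%:R^-1 * \sum_i g (f i))%:E)%E.
Proof.
move=> mg g0; have mg' : measurable_fun setT (EFin \o g) by exact/measurable_EFinP.
have g0' t : setT t -> (0 <= (EFin \o g) t)%E by move=> _; rewrite lee_fin.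
transitivity (\int[mscale cst_inv (msum (fun n => \d_(f (nth i0 (enum I) n))) #|I|)]_x
    (EFin \o g) x)%E; first by [].
rewrite (ge0_integral_mscale _ measurableT _ mg' g0').
rewrite (ge0_integral_measure_sum _ measurableT g0' mg') EFinM; congr (_ * _)%E.
rewrite (eq_bigr (fun n : 'I_#|I| => (g (f (nth i0 (enum I) n)))%:E)); last first.
  by move=> n _; rewrite integral_dirac// diracT mul1e.
rewrite sumEFin; congr _%:E.
rewrite (reindex (fun n : 'I_#|I| => enum_val n)) /=; last first.
  by apply: onW_bij; exact: enum_val_bij.
by apply: eq_bigr => n _; rewrite (enum_val_nth i0).
Qed.

End uniform_mixture.

(** The map factors through finitely many measurable tests, so a preimage is a finite union of
    finite intersections. *)
Lemma measurable_finite_preimage d (T : measurableType d) (I : finType) (U : Type)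
    (p : I -> T -> bool) (g : {ffun I -> bool} -> U) (A : set U) :
  (forall i, measurable_fun setT (p i)) ->
  measurable ((fun y => g [ffun i => p i y]) @^-1` A).
Proof.
move=> mp.
rewrite (_ : _ @^-1` _ = \bigcup_(b in [set b | A (g b)])
    \bigcap_(i in setT) [set y | p i y = b i]); last first.
  apply/seteqP; split => y /=.
    by move=> Ay; exists [ffun i => p i y] => // i _ /=; rewrite ffunE.
  by move=> [b /= Ab h]; rewrite (_ : [ffun i => _] = b)//; apply/ffunP => i; rewrite ffunE h.
apply: fin_bigcup_measurable; first exact: finite_finset.
move=> b _; apply: fin_bigcap_measurable; first exact: finite_finset.
by move=> i _; have := mp i measurableT [set b i]; rewrite setTI; apply.
Qed.

(** * The superposition code *)

Lemma avg_affine (R : realType) (I : finType) (c e : R) (W : I -> R) : (0 < #|I|)%N ->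
  #|I|%:R^-1 * \sum_i (c + e * W i) = c + e * (#|I|%:R^-1 * \sum_i W i).
Proof.
move=> I0; rewrite big_split /= sumr_const -mulr_sumr mulrDr -[c *+ _]mulr_natl.
by rewrite mulrA mulVf ?pnatr_eq0 -?lt0n// mul1r mulrCA.
Qed.

Section superposition_code.
Context {R : realType} (s L : nat) (M V : 'I_s -> nat).
Hypothesis V_gt0 : forall k, (0 < V k)%N.
Variables (w0 : msgspace M) (v0 : msgspace V).
Local Notation X := (L.-tuple R).
Local Notation gam := (@stdnormal R).
Local Notation nu := (iid gam L).

Definition lindex (k : 'I_s) : finType := ('I_(M k) * 'I_(V k))%type.
Definition full (w : msgspace M) (v : msgspace V) (k : 'I_s) : lindex k := (w k, v k).
Local Notation book := (codebook X lindex).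
Local Notation Gam := (iid nu #|{: {k : 'I_s & lindex k}}|).
Local Notation nM := (#|{: msgspace M}|%:R : R).
Local Notation nV := (#|{: msgspace V}|%:R : R).

Let nM_gt0 : 0 < nM.
Proof. by rewrite ltr0n; apply/card_gt0P; exists w0. Qed.
Let nV_gt0 : 0 < nV.
Proof. by rewrite ltr0n; apply/card_gt0P; exists v0. Qed.

Section one_receiver.
Variable a : 'I_s -> R.

Definition cdens (k : nat) (c : book) (w : msgspace M) (v : msgspace V) (y : X) : R :=
  wdens a k (words c (full w v)) y.

Definition altdens (k : 'I_s) (c : book) (w : msgspace M) (v : msgspace V)
    (i : lindex k) (y : X) : R :=
  dalt (wdens a) c (full w v) i y.

Definition loglik (k : 'I_s) (c : book) w v y : R :=
  ln (cdens k.+1 c w v y) - ln (cdens k c w v y).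

Lemma cdens_gt0 k c w v y : 0 < cdens k c w v y.
Proof. exact: wdens_gt0. Qed.

Lemma altdens_gt0 (k : 'I_s) c w v (i : lindex k) y : 0 < altdens c w v i y.
Proof. exact: wdens_gt0. Qed.

Lemma cdens_eq k c (w w' : msgspace M) (v v' : msgspace V) y :
  (forall j : 'I_s, (j < k)%N -> w j = w' j /\ v j = v' j) ->
  cdens k c w v y = cdens k c w' v' y.
Proof.
move=> h; apply: wdens_eq => j jk; rewrite !tnth_mktuple /full.
by have [-> ->] := h j jk.
Qed.

Lemma words_dset (c : book) w v (k : 'I_s) (i : 'I_(V k)) :
  words c (full w (dset v i)) = tset (words c (full w v)) k (word c ((w k, i) : lindex k)).
Proof.
apply: eq_from_tnth => j; rewrite tnth_tset !tnth_mktuple /full.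
by have [->|jk] := eqVneq j k; rewrite ?dset_in// dset_out.
Qed.

Lemma mixV_altdens (k : 'I_s) c w v y :
  mixV (fun k w v => cdens k c w v y) k w v =
  (V k)%:R^-1 * \sum_(i < V k) altdens c w v ((w k, i) : lindex k) y.
Proof. by congr (_ * _); apply: eq_bigr => i _; rewrite /cdens words_dset. Qed.

Lemma altdens_self (k : 'I_s) c w v y :
  altdens c w v ((w k, v k) : lindex k) y = cdens k.+1 c w v y.
Proof.
apply: wdens_eq => j _; rewrite tnth_tset tnth_mktuple /full.
by have [->|//] := eqVneq j k.
Qed.

Lemma altdens_other (k : 'I_s) c (w w' : msgspace M) (v v' : msgspace V) y :
  (forall j : 'I_s, (j < k)%N -> w j = w' j /\ v j = v' j) ->
  cdens k.+1 c w' v' y = altdens c w v ((w' k, v' k) : lindex k) y.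
Proof.
move=> h; apply: wdens_eq => j; rewrite ltnS => jk.
rewrite tnth_tset !tnth_mktuple /full; have [->//|jk'] := eqVneq j k.
by have [|-> ->] := h j; first by rewrite ltn_neqAle jk' jk.
Qed.

(* Decoding error of layers below r: either the transmitted word fails a
   likelihood-ratio test, or a wrong word of some layer passes its test. *)
Definition err_bound (r : nat) (rho : R) (th : 'I_s -> R) (c : book) w v y : R :=
  \sum_(k < s | (k < r)%N)
    (expR (rho * th k) * expR (- rho * loglik k c w v y) +
     \sum_(i : lindex k | i != full w v k)
        expR (- th k) * (altdens c w v i y / cdens k c w v y)).

(** A candidate is judged layer by layer: its own words below [k] count as known signal, the layers
    above as noise. Receiver [r] tests message and randomization of its layers together. *)
Definition passes (r : nat) (th : 'I_s -> R) (c : book)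
    (p : msgspace M * msgspace V) (y : X) : bool :=
  [forall k : 'I_s, (k < r)%N ==>
    (expR (th k) * cdens k c p.1 p.2 y < cdens k.+1 c p.1 p.2 y)].

Definition decoder r th c (y : X) : msgspace M :=
  if [pick p | passes r th c p y] is Some p then p.1 else w0.

Lemma loglik_le (k : 'I_s) c w v y t :
  cdens k.+1 c w v y <= expR t * cdens k c w v y -> loglik k c w v y <= t.
Proof.
move=> h; rewrite /loglik lerBlDr -[t]expRK -lnM ?posrE ?expR_gt0 ?cdens_gt0//.
have q0 : 0 < expR t * cdens k c w v y by rewrite mulr_gt0 ?expR_gt0 ?cdens_gt0.
by rewrite (ler_ln (cdens_gt0 _ _ _ _ _) q0).
Qed.

Lemma decoder_error r (rho : R) th c (w : msgspace M) v y (k0 : 'I_s) : 0 <= rho -> (k0 < r)%N ->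
  decoder r th c y k0 != w k0 -> 1 <= err_bound r rho th c w v y.
Proof.
move=> rho0 k0r; rewrite /err_bound.
have T0 (k : 'I_s) : 0 <= \sum_(i : lindex k | i != full w v k)
    expR (- th k) * (altdens c w v i y / cdens k c w v y).
  apply: sumr_ge0 => i _; rewrite mulr_ge0 ?expR_ge0// divr_ge0// ltW//.
    exact: altdens_gt0.
  exact: cdens_gt0.
have S0 (k : 'I_s) : 0 <= expR (rho * th k) * expR (- rho * loglik k c w v y) +
    \sum_(i : lindex k | i != full w v k)
        expR (- th k) * (altdens c w v i y / cdens k c w v y).
  by rewrite addr_ge0// mulr_ge0 ?expR_ge0.
have [pass|fail] := boolP (passes r th c (w, v) y); last first.
  move=> _; move: fail; rewrite negb_forall => /existsP[k].
  rewrite negb_imply -leNgt => /andP[kr /= /loglik_le le].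
  rewrite (bigD1 k)//= -[leLHS]addr0; apply: lerD; last exact: sumr_ge0.
  rewrite -[leLHS]addr0; apply: lerD; last exact: T0.
  by rewrite -expRD -expR0 ler_expR mulNr -mulrBr mulr_ge0// subr_ge0.
rewrite /decoder; case: (pickP (fun p => passes r th c p y)) => [[w' v'] /= pass' ne|/(_ (w, v))]; last by rewrite pass.
(* The lowest layer where the chosen and the sent pair differ. Below it they agree, so there a wrong
   word has passed its test against the sent lower words. It is at most [k0], hence among the tested
   layers. *)
pose bad (n : nat) := [exists k : 'I_s, (k == n :> nat) && ((w' k, v' k) != (w k, v k))].
have exbad : exists n, bad n.
  exists k0; apply/existsP; exists k0; rewrite eqxx /=.
  by apply: contra ne => /eqP[->].
case: (ex_minnP exbad) => n /existsP[k /andP[/eqP kn kbad]] nmin.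
have agree (j : 'I_s) : (j < k)%N -> w j = w' j /\ v j = v' j.
  move=> jk; have /existsPn/(_ j) : ~~ bad j.
    by apply: contraTN jk => /nmin; rewrite -kn -leqNgt.
  by rewrite eqxx /= negbK => /eqP[-> ->].
have kr : (k < r)%N.
  apply: leq_ltn_trans k0r; rewrite kn; apply: nmin.
  apply/existsP; exists k0; rewrite eqxx /=.
  by apply: contra ne => /eqP[->].
move: pass' => /forallP/(_ k); rewrite kr /= (altdens_other _ _ agree).
rewrite -(cdens_eq _ _ agree) => lt.
rewrite (bigD1 k)//= -[leLHS]addr0; apply: lerD; last exact: sumr_ge0.
rewrite -[leLHS]add0r; apply: lerD; first by rewrite mulr_ge0 ?expR_ge0.
rewrite (bigD1 ((w' k, v' k) : lindex k))//= -[leLHS]addr0; apply: lerD; last first.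
  apply: sumr_ge0 => i _; rewrite mulr_ge0 ?expR_ge0// divr_ge0// ltW//.
    exact: altdens_gt0.
  exact: cdens_gt0.
rewrite expRN mulrA ler_pdivlMr ?cdens_gt0// mul1r mulrC ler_pdivlMr ?expR_gt0//.
by rewrite mulrC ltW.
Qed.

Lemma measurable_cdens k w v :
  measurable_fun setT (fun p : book * X => cdens k p.1 w v p.2).
Proof. exact: (measurable_Dwords (@measurable_wdens R s L a) k (full w v)). Qed.

Lemma measurable_altdens (k : 'I_s) w v (i : lindex k) :
  measurable_fun setT (fun p : book * X => altdens p.1 w v i p.2).
Proof. exact: (measurable_dalt (@measurable_wdens R s L a) (full w v) i). Qed.

Lemma measurable_loglik (k : 'I_s) w v :
  measurable_fun setT (fun p : book * X => loglik k p.1 w v p.2).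
Proof.
by apply: measurable_funB; apply: measurableT_comp => //; exact: measurable_cdens.
Qed.

Lemma measurable_alt_ratio (k : 'I_s) w v (i : lindex k) :
  measurable_fun setT (fun p : book * X => altdens p.1 w v i p.2 / cdens k p.1 w v p.2).
Proof.
rewrite (_ : (fun p => _) = fun p : book * X =>
    expR (ln (altdens p.1 w v i p.2) - ln (cdens k p.1 w v p.2))).
  apply: measurableT_comp => //; apply: measurable_funB; apply: measurableT_comp => //.
    exact: measurable_altdens.
  exact: measurable_cdens.
by apply/funext => p; rewrite expRB !lnK ?posrE ?altdens_gt0 ?cdens_gt0.
Qed.

Lemma decoder_measurable r th c (A : set (msgspace M)) :
  measurable (decoder r th c @^-1` A).
Proof.
pose g (b : {ffun msgspace M * msgspace V -> bool}) : msgspace M :=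
  if [pick p | b p] is Some p then p.1 else w0.
have -> : decoder r th c = fun y => g [ffun p => passes r th c p y].
  apply/funext => y; rewrite /decoder /g (eq_pick (fun p => esym (ffunE _ p))) //.
apply: measurable_finite_preimage => p.
rewrite (_ : passes r th c p = fun y => \big[andb/true]_(k < s)
   ((k < r)%N ==> (expR (th k) * cdens k c p.1 p.2 y < cdens k.+1 c p.1 p.2 y))); last first.
  by apply/funext => y; rewrite /passes big_andE.
have mdk k : measurable_fun setT (cdens k c p.1 p.2).
  exact: (measurable_fun_pair2 c (measurable_cdens k p.1 p.2)).
elim: (index_enum _) => [|k ks IH].
  rewrite (_ : (fun y => _) = cst true); first exact: measurable_cst.
  by apply/funext => y; rewrite big_nil.
rewrite (_ : (fun y => _) = fun y : X => ((k < r)%N ==>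
   (expR (th k) * cdens k c p.1 p.2 y < cdens k.+1 c p.1 p.2 y)) &&
   \big[andb/true]_(k <- ks)
   ((k < r)%N ==> (expR (th k) * cdens k c p.1 p.2 y < cdens k.+1 c p.1 p.2 y))); last first.
  by apply/funext => y; rewrite big_cons.
apply: measurable_and => //; case: (k < r)%N => //=.
by apply: measurable_fun_ltr => //; exact: measurable_funM.
Qed.

Local Notation EG := (EE Gam nu).

Lemma nnm_cdens w v : nnm (fun (c : book) y => cdens s c w v y).
Proof. by split; [exact: measurable_cdens | move=> c y; rewrite ltW// cdens_gt0]. Qed.

Lemma EE_cdens w v : EG (fun (c : book) y => cdens s c w v y) = 1%E.
Proof.
have := @integral_level0 _ _ _ _ _ nu nu s lindex (wdens a) (@measurable_wdens R s L a)
  (@wdens_gt0 R s L a) (@integral_wdens_tset R s L a) (full w v) (fun=> 1)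
  (measurable_cst _) (fun=> ler01).
rewrite /EE => e; under eq_integral do under eq_integral do rewrite -[cdens _ _ _ _ _]mulr1.
rewrite {}e; under eq_integral do under eq_integral do rewrite mulr1.
under eq_integral do rewrite integral_wdens.
by rewrite integral_prob_cst.
Qed.

Lemma nnm_tilt (k : 'I_s) (e : R) w v :
  nnm (fun (c : book) y => cdens s c w v y * expR (e * loglik k c w v y)).
Proof.
split; last by move=> c y; rewrite mulr_ge0 ?expR_ge0// ltW// cdens_gt0.
apply: measurable_funM; first exact: measurable_cdens.
by apply: measurableT_comp => //; apply: measurable_funM => //; exact: measurable_loglik.
Qed.

Lemma EE_tilt (k : 'I_s) (e : R) w v : `|e| <= 4^-1 ->
  (EG (fun (c : book) y => (cdens s c w v y * expR (e * loglik k c w v y))%R) <=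
   (expR (L%:R * (e * (2^-1 * ln (lvar a k / lvar a k.+1)) + 4 * e ^+ 2)))%:E)%E.
Proof.
move=> e4.
apply: (@integral_tilt _ _ _ _ _ nu nu s lindex (wdens a) (@measurable_wdens R s L a)
  (@wdens_gt0 R s L a) (@wdens_eq R s L a) (@integral_wdens_tset R s L a) k (full w v) e).
by move=> u; exact: integral_wdens_tilt.
Qed.

Lemma nnm_alt (k : 'I_s) w v (i : lindex k) :
  nnm (fun (c : book) y => cdens s c w v y * (altdens c w v i y / cdens k c w v y)).
Proof.
split; last first.
  move=> c y; rewrite mulr_ge0 ?divr_ge0// ltW//; first exact: cdens_gt0.
    exact: altdens_gt0.
  exact: cdens_gt0.
by apply: measurable_funM; [exact: measurable_cdens|exact: measurable_alt_ratio].
Qed.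

Lemma EE_alt (k : 'I_s) w v (i : lindex k) : i != full w v k ->
  EG (fun (c : book) y => cdens s c w v y * (altdens c w v i y / cdens k c w v y)) = 1%E.
Proof.
exact: (@integral_alt _ _ _ _ _ nu nu s lindex (wdens a) (@measurable_wdens R s L a)
  (@wdens_gt0 R s L a) (@wdens_eq R s L a) (@integral_wdens_tset R s L a) (@integral_wdens R s L a)).
Qed.

Definition info (k : 'I_s) : R := 2^-1 * ln (lvar a k / lvar a k.+1).

Lemma err_boundE r (rho : R) th (c : book) w v y :
  cdens s c w v y * err_bound r rho th c w v y =
  \sum_(k < s | (k < r)%N)
    (expR (rho * th k) * (cdens s c w v y * expR (- rho * loglik k c w v y)) +
     \sum_(i : lindex k | i != full w v k)
        expR (- th k) * (cdens s c w v y * (altdens c w v i y / cdens k c w v y))).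
Proof.
rewrite mulr_sumr; apply: eq_bigr => k _; rewrite mulrDr mulrCA; congr (_ + _).
by rewrite mulr_sumr; apply: eq_bigr => i _; rewrite mulrCA.
Qed.

Lemma nnm_err_bound r (rho : R) th w v :
  nnm (fun (c : book) y => cdens s c w v y * err_bound r rho th c w v y).
Proof.
rewrite (_ : (fun c y => _) = (fun (c : book) y => \sum_(k < s | (k < r)%N)
    (expR (rho * th k) * (cdens s c w v y * expR (- rho * loglik k c w v y)) +
     \sum_(i : lindex k | i != full w v k)
        expR (- th k) * (cdens s c w v y * (altdens c w v i y / cdens k c w v y))))).
  apply: nnm_sum => k; apply: nnmD; first by apply: nnmZ (expR_ge0 _) (nnm_tilt _ _ _ _).
  by apply: nnm_sum => i; apply: nnmZ (expR_ge0 _) (nnm_alt _ _ _).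
by apply/funext => c; apply/funext => y; exact: err_boundE.
Qed.

(** Each wrong word has mean one by [EE_alt] and they are counted exactly: thanks to the [- 1], a
    layer with a single word contributes no such term, as layers of zero power will require. *)
Lemma EE_err_bound r (rho : R) th w v : 0 <= rho -> rho <= 4^-1 ->
  (EG (fun (c : book) y => (cdens s c w v y * err_bound r rho th c w v y)%R) <=
   (\sum_(k < s | (k < r)%N)
     (expR (rho * th k) * expR (L%:R * (- rho * info k + 4 * rho ^+ 2)) +
      ((M k * V k)%:R - 1) * expR (- th k)))%:E)%E.
Proof.
move=> rho0 rho4.
rewrite (_ : (fun c y => _) = (fun (c : book) y => \sum_(k < s | (k < r)%N)
    (expR (rho * th k) * (cdens s c w v y * expR (- rho * loglik k c w v y)) +
     \sum_(i : lindex k | i != full w v k)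
        expR (- th k) * (cdens s c w v y * (altdens c w v i y / cdens k c w v y)))))%R; last first.
  by apply/funext => c; apply/funext => y; exact: err_boundE.
have n1 k : nnm (fun (c : book) y =>
    expR (rho * th k) * (cdens s c w v y * expR (- rho * loglik k c w v y))).
  by apply: nnmZ (expR_ge0 _) (nnm_tilt _ _ _ _).
have n2 (k : 'I_s) (i : lindex k) : nnm (fun (c : book) y =>
    expR (- th k) * (cdens s c w v y * (altdens c w v i y / cdens k c w v y))).
  by apply: nnmZ (expR_ge0 _) (nnm_alt _ _ _).
apply: EE_sum_le => [k|k _].
  by apply: nnmD (n1 k) (nnm_sum _ _ (n2 k)).
rewrite (EED _ _ (n1 k) (nnm_sum _ _ (n2 k))) EFinD; apply: leeD.
  rewrite (EEZ _ _ (expR_ge0 _) (nnm_tilt _ _ _ _)) EFinM.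
  apply: lee_wpmul2l; first by rewrite lee_fin expR_ge0.
  apply: le_trans (EE_tilt _ _ _ _) _; first by rewrite normrN ger0_norm.
  by rewrite sqrrN.
rewrite (_ : ((M k * V k)%:R - 1) * expR (- th k) =
    \sum_(i : lindex k | i != full w v k) expR (- th k)).
  apply: EE_sum_le => [i|i ine]; first exact: n2.
  by rewrite (EEZ _ _ (expR_ge0 _) (nnm_alt _ _ _)) EE_alt// mule1.
rewrite sumr_const -[RHS]mulr_natl; congr (_ * _).
have := cardC1 (full w v k); rewrite card_prod !card_ord => ->.
by rewrite -subn1 natrB// muln_gt0 V_gt0 andbT (leq_ltn_trans _ (ltn_ord (w k))).
Qed.

(** [B] is an allowance for the excess of the log-likelihood ratio over [ln (V k)]; whatever exceeds
    it is charged exponentially. *)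
Definition leak_bound (r : nat) (rho B : R) (c : book) w v y : R :=
  \sum_(k < s | (r <= k)%N)
    (1 + B + rho^-1 * expR (- (rho * (ln (V k)%:R + B))) * expR (rho * loglik k c w v y) +
     \sum_(i < V k | i != v k)
       (V k)%:R^-1 * (altdens c w v ((w k, i) : lindex k) y / cdens k c w v y)).

(** Up to one nat the left side is the positive part of [ln z], and [t <= expR t], at scale [rho],
    bounds the excess of [ln z] over [B]. *)
Lemma ln1D_le (rho B z : R) : 0 < rho -> 0 <= B -> 0 < z ->
  ln (1 + z) <= 1 + B + rho^-1 * expR (rho * (ln z - B)).
Proof.
move=> rho0 B0 z0.
have h : ln z <= B + rho^-1 * expR (rho * (ln z - B)).
  rewrite -lerBlDl mulrC ler_pdivlMr// mulrC.
  by have := expR_ge1Dx (rho * (ln z - B)); lra.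
have [z1|/ltW z1] := leP z 1.
  rewrite -addrA; apply: (@le_trans _ _ z); first exact/le_ln1Dx/(lt_trans _ z0).
  by rewrite -[leLHS]addr0 lerD// addr_ge0// mulr_ge0 ?expR_ge0// invr_ge0 ltW.
(* For [z >= 1] one has [1 + z <= 2 * z], and [ln 2 <= 1]. *)
apply: (@le_trans _ _ (ln (2 * z))).
  by rewrite ler_ln ?posrE ?mulr_gt0//; [lra | rewrite addr_gt0].
rewrite lnM ?posrE// -addrA lerD//.
by have := @le_ln1Dx R 1 _; rewrite -[1 + 1]/2; apply; lra.
Qed.

Lemma ln_mixV_le (k : 'I_s) (rho B : R) (c : book) w v y : 0 < rho -> 0 <= B ->
  ln (1 + mixV (fun k w v => cdens k c w v y) k w v / cdens k c w v y) <=
  1 + B + rho^-1 * expR (- (rho * (ln (V k)%:R + B))) * expR (rho * loglik k c w v y) +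
     \sum_(i < V k | i != v k)
       (V k)%:R^-1 * (altdens c w v ((w k, i) : lindex k) y / cdens k c w v y).
Proof.
move=> rho0 B0.
have Vk : 0 < (V k)%:R :> R by rewrite ltr0n.
set T := \sum_(i < V k | _) _.
have T0 : 0 <= T.
  apply: sumr_ge0 => i _; rewrite mulr_ge0 ?invr_ge0 ?(ltW Vk)// divr_ge0// ltW//.
    exact: altdens_gt0.
  exact: cdens_gt0.
pose z := (V k)%:R^-1 * (cdens k.+1 c w v y / cdens k c w v y).
have z0 : 0 < z by rewrite mulr_gt0 ?invr_gt0// divr_gt0 ?cdens_gt0.
have -> : mixV (fun k w v => cdens k c w v y) k w v / cdens k c w v y = z + T.
  rewrite mixV_altdens (bigD1 (v k))//= altdens_self mulrDr mulrDl; congr (_ + _).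
    by rewrite -mulrA.
  by rewrite /T mulr_sumr mulr_suml; apply: eq_bigr => i _; rewrite -mulrA.
(* [1 + z + T <= (1 + z) * (1 + T)] separates the sent word from the competing ones, whose logarithm
   is at most [T]. *)
apply: (@le_trans _ _ (ln (1 + z) + ln (1 + T))).
  rewrite -lnM ?posrE ?ltr_pwDl ?(ltW z0)// ler_ln ?posrE ?mulr_gt0 ?ltr_pwDl ?addr_ge0 ?(ltW z0)//.
  by have := mulr_ge0 (ltW z0) T0; lra.
apply: lerD; last by apply: le_ln1Dx; exact: lt_le_trans T0.
apply: (le_trans (ln1D_le rho0 B0 z0)).
rewrite lerD2l -mulrA -expRD /loglik /z.
rewrite lnM ?posrE ?invr_gt0 ?divr_gt0 ?cdens_gt0// lnV ?posrE// ln_div ?posrE ?cdens_gt0//.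
rewrite ler_wpM2l ?invr_ge0 ?(ltW rho0)// ler_expR.
lra.
Qed.

Lemma leak_boundE r (rho B : R) (c : book) w v y :
  cdens s c w v y * leak_bound r rho B c w v y =
  \sum_(k < s | (r <= k)%N)
    ((1 + B) * cdens s c w v y +
     rho^-1 * expR (- (rho * (ln (V k)%:R + B))) *
       (cdens s c w v y * expR (rho * loglik k c w v y)) +
     \sum_(i < V k | i != v k) (V k)%:R^-1 *
       (cdens s c w v y * (altdens c w v ((w k, i) : lindex k) y / cdens k c w v y))).
Proof.
rewrite mulr_sumr; apply: eq_bigr => k _; rewrite mulrDr mulrDr.
congr (_ + _ + _); first exact: mulrC.
  by rewrite mulrCA.
by rewrite mulr_sumr; apply: eq_bigr => i _; rewrite mulrCA.
Qed.

Lemma nnm_leak_bound r (rho B : R) w v : 0 < rho -> 0 <= B ->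
  nnm (fun (c : book) y => cdens s c w v y * leak_bound r rho B c w v y).
Proof.
move=> rho0 B0.
rewrite (_ : (fun c y => _) = (fun (c : book) y => \sum_(k < s | (r <= k)%N)
    ((1 + B) * cdens s c w v y +
     rho^-1 * expR (- (rho * (ln (V k)%:R + B))) *
       (cdens s c w v y * expR (rho * loglik k c w v y)) +
     \sum_(i < V k | i != v k) (V k)%:R^-1 *
       (cdens s c w v y * (altdens c w v ((w k, i) : lindex k) y / cdens k c w v y))))).
  apply: nnm_sum => k; apply: nnmD.
    apply: nnmD; first by apply: nnmZ (nnm_cdens _ _); rewrite addr_ge0.
    by apply: nnmZ (nnm_tilt _ _ _ _); rewrite mulr_ge0 ?expR_ge0// invr_ge0 ltW.
  by apply: nnm_sum => i; apply: nnmZ (nnm_alt _ _ _); rewrite invr_ge0.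
by apply/funext => c; apply/funext => y; exact: leak_boundE.
Qed.

(** The [2] joins the constant of [ln1D_le] with the competing words: fewer than [V k] of them, each
    of mean one and weight [(V k)%:R^-1]. *)
Lemma EE_leak_bound r (rho B : R) w v : 0 < rho -> rho <= 4^-1 -> 0 <= B ->
  (EG (fun (c : book) y => (cdens s c w v y * leak_bound r rho B c w v y)%R) <=
   (\sum_(k < s | (r <= k)%N)
     (2 + B + rho^-1 * expR (- (rho * (ln (V k)%:R + B))) *
       expR (L%:R * (rho * info k + 4 * rho ^+ 2))))%:E)%E.
Proof.
move=> rho0 rho4 B0.
rewrite (_ : (fun c y => _) = (fun (c : book) y => \sum_(k < s | (r <= k)%N)
    ((1 + B) * cdens s c w v y +
     rho^-1 * expR (- (rho * (ln (V k)%:R + B))) *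
       (cdens s c w v y * expR (rho * loglik k c w v y)) +
     \sum_(i < V k | i != v k) (V k)%:R^-1 *
       (cdens s c w v y * (altdens c w v ((w k, i) : lindex k) y / cdens k c w v y)))))%R; last first.
  by apply/funext => c; apply/funext => y; exact: leak_boundE.
have B1 : 0 <= 1 + B by rewrite addr_ge0.
have n1 : nnm (fun (c : book) y => (1 + B) * cdens s c w v y).
  exact: nnmZ (nnm_cdens _ _).
have C0 (k : 'I_s) : 0 <= rho^-1 * expR (- (rho * (ln (V k)%:R + B))).
  by rewrite mulr_ge0 ?expR_ge0// invr_ge0 ltW.
have n2 (k : 'I_s) : nnm (fun (c : book) y => rho^-1 * expR (- (rho * (ln (V k)%:R + B))) *
       (cdens s c w v y * expR (rho * loglik k c w v y))).
  exact: nnmZ (C0 k) (nnm_tilt _ _ _ _).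
have V0 (k : 'I_s) : 0 <= (V k)%:R^-1 :> R by rewrite invr_ge0.
have n3 (k : 'I_s) (i : 'I_(V k)) : nnm (fun (c : book) y => (V k)%:R^-1 *
       (cdens s c w v y * (altdens c w v ((w k, i) : lindex k) y / cdens k c w v y))).
  exact: nnmZ (V0 k) (nnm_alt _ _ _).
have n4 (k : 'I_s) := nnm_sum (index_enum 'I_(V k)) (fun i => i != v k) (n3 k).
have n12 (k : 'I_s) := nnmD n1 (n2 k).
apply: EE_sum_le => [k|k _]; first exact: nnmD (n12 k) (n4 k).
rewrite (EED _ _ (n12 k) (n4 k)) (EED _ _ n1 (n2 k)).
rewrite (EEZ _ _ B1 (nnm_cdens _ _)) EE_cdens mule1.
rewrite (EEZ _ _ (C0 k) (nnm_tilt _ _ _ _)).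
rewrite (_ : 2 + B + rho^-1 * expR (- (rho * (ln (V k)%:R + B))) *
    expR (L%:R * (rho * info k + 4 * rho ^+ 2)) =
  (1 + B) + rho^-1 * expR (- (rho * (ln (V k)%:R + B))) *
    expR (L%:R * (rho * info k + 4 * rho ^+ 2)) + 1); last by ring.
rewrite [leRHS]EFinD; apply: leeD.
  rewrite [leRHS]EFinD; apply: leeD => //; rewrite [leRHS]EFinM; apply: lee_wpmul2l.
    by rewrite lee_fin C0.
  by apply: EE_tilt; rewrite ger0_norm// ltW.
apply: (@le_trans _ _ (\sum_(i < V k | i != v k) ((V k)%:R^-1 : R))%:E).
  apply: EE_sum_le => [i|i ine]; first exact: n3.
  rewrite (EEZ _ _ (V0 k) (nnm_alt _ _ _)) EE_alt ?mule1//.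
  by apply: contra ine => /eqP[->].
rewrite lee_fin; apply: (@le_trans _ _ (\sum_(i < V k) ((V k)%:R^-1 : R))).
  by rewrite [leRHS](bigD1 (v k))//= lerDr.
by rewrite sumr_const card_ord -[leLHS]mulr_natl divff// pnatr_eq0 -lt0n.
Qed.

End one_receiver.

(** * From the channel model to the density estimates *)

Section code.
Variables (h : 'I_s.+1 -> R) (b : 'I_s -> R).

(** All receivers share one codebook and differ only in these amplitudes, so the estimates for one
    receiver apply to each of them. *)
Definition gain (r : 'I_s.+1) (j : 'I_s) : R := Num.sqrt (h r) * b j.

Definition signal (c : book) (w : msgspace M) (v : msgspace V) : X :=
  [tuple \sum_(j < s) b j * tnth (word c ((w j, v j) : lindex j)) t | t < L].

Definition encoder (c : book) (w : msgspace M) : probability X R :=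
  [the probability _ _ of @umix _ X R (msgspace V) v0 (signal c w)].

Lemma lmean_signal r (c : book) w v t :
  lmean (gain r) s (words c (full w v)) t = Num.sqrt (h r) * tnth (signal c w v) t.
Proof.
rewrite /lmean tnth_mktuple mulr_sumr.
by apply: eq_big => [j|j _]; rewrite ?ltn_ord// tnth_mktuple /gain mulrA.
Qed.

Lemma out_dens_encoder r (c : book) w y :
  out_dens h (encoder c) r w y =
  (nV^-1 * \sum_(v : msgspace V) gdens (gain r) s (words c (full w v)) y)%:E.
Proof.
rewrite /out_dens (@integral_umix _ X R (msgspace V) v0 (signal c w)
  (fun x => \prod_(t < L) normal_pdf 0 1 (tnth y t - Num.sqrt (h r) * tnth x t))).
- congr (_ * _)%:E; apply: eq_bigr => v _; apply: eq_bigr => t _.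
  have -> : lvar (gain r) s = 1.
    by rewrite /lvar big1 ?addr0// => j; rewrite leqNgt ltn_ord.
  rewrite lmean_signal; move: (_ - _) => z.
  by have := normal_pdf_gauss 0 z (@ltr01 R); rewrite sqrtr1 subr0.
- apply: measurable_prod => t _.
  apply: (measurableT_comp (measurable_normal_pdf 0 1)); apply: measurable_funB => //.
  by apply: measurable_funM => //; exact: measurable_tnth.
- by move=> x; apply: prodr_ge0 => t _; exact: normal_pdf_ge0.
Qed.

Lemma cdensE r k (c : book) w v y : cdens (gain r) k c w v y =
  gdens (gain r) k (words c (full w v)) y * gweight y.
Proof. by []. Qed.

Lemma measurable_gdens_words r k (c : book) w v :
  measurable_fun setT (fun y => gdens (gain r) k (words c (full w v)) y).
Proof. exact: (measurable_fun_pair2 (words c (full w v)) (@measurable_gdens R s L (gain r) k)). Qed.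

Lemma integral_message_avg (F : msgspace M -> msgspace V -> X -> R) :
  (forall w v, measurable_fun setT (F w v)) -> (forall w v y, 0 <= F w v y) ->
  (\int[nu]_y (\sum_(p : msgspace M * msgspace V) (nM^-1 * nV^-1) * F p.1 p.2 y)%:E =
   (nM^-1)%:E * \sum_w \int[nu]_y (nV^-1 * \sum_v F w v y)%:E)%E.
Proof.
move=> mF F0.
have mS w : measurable_fun setT (fun y : X => (nV^-1 * \sum_v F w v y)%:E).
  by apply/measurable_EFinP; apply: measurable_funM => //; apply: measurable_sum.
have S0 w (y : X) : (0 <= (nV^-1 * \sum_v F w v y)%:E)%E.
  by rewrite lee_fin mulr_ge0 ?invr_ge0// sumr_ge0.
rewrite -ge0_integral_sum// -ge0_integralZl_EFin ?invr_ge0//; last 2 first.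
- by move=> y _; apply: sume_ge0.
- by apply: emeasurable_sum => w; exact: mS.
apply: eq_integral => y _; rewrite sumEFin -EFinM; congr _%:E.
rewrite mulr_sumr -(pair_bigA _ (fun w v => nM^-1 * nV^-1 * F w v y)) /=.
by apply: eq_bigr => w _; rewrite mulrA mulr_sumr.
Qed.

Lemma err_prob_le (r : 'I_s.+1) th (rho : R) (c : book) (k : 'I_s) : 0 <= rho -> (k < r)%N ->
  (err_prob h (encoder c) (decoder (gain r) r th c) r k <=
   \int[nu]_y (\sum_(p : msgspace M * msgspace V) (nM^-1 * nV^-1) *
     (cdens (gain r) s c p.1 p.2 y * err_bound (gain r) r rho th c p.1 p.2 y))%:E)%E.
Proof.
move=> rho0 kr.
pose F w v y := cdens (gain r) s c w v y * err_bound (gain r) r rho th c w v y.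
have nF w v := nnm_err_bound (gain r) r rho th w v.
have mF w v : measurable_fun setT (F w v) by exact: (measurable_fun_pair2 c (nF w v).1).
have F0 w v y : 0 <= F w v y by exact: (nF w v).2.
rewrite (@integral_message_avg F mF F0) /err_prob.
apply: lee_wpmul2l; first by rewrite lee_fin invr_ge0.
apply: lee_sum => w _.
pose E (y : X) := (decoder (gain r) r th c y k != w k).
have mE : measurable_fun setT E.
  apply: (measurable_fun_bool true); rewrite setTI.
  exact: (decoder_measurable (gain r) r th c [set w' | w' k != w k]).
pose q y := nV^-1 * \sum_(v : msgspace V) gdens (gain r) s (words c (full w v)) y.
have mq : measurable_fun setT q.
  by apply: measurable_funM => //; apply: measurable_sum => v; exact: measurable_gdens_words.
have q0 y : 0 <= q y.
  by rewrite mulr_ge0 ?invr_ge0// sumr_ge0// => v _; rewrite ltW// gdens_gt0.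
have mif : measurable_fun setT (fun y => if E y then (q y)%:E else 0%E).
  by apply: measurable_fun_ifT => //; exact/measurable_EFinP.
rewrite (_ : (fun y => _) = (fun y => if E y then (q y)%:E else 0%E)); last first.
  by apply/funext => y; rewrite out_dens_encoder.
rewrite intL_iid//; last by move=> y; case: ifP => // _; rewrite lee_fin.
apply: ge0_le_integral => //.
- move=> y _; rewrite mule_ge0// ?lee_fin ?(ltW (gweight_gt0 _))//.
  by case: ifP => // _; rewrite lee_fin.
- by apply: emeasurable_funM => //; apply/measurable_EFinP; exact: measurable_gweight.
- apply/measurable_EFinP; apply: measurable_funM => //; apply: measurable_sum => v; exact: mF.
move=> y _; case: ifP => [Ey|_]; last first.
  by rewrite mul0e lee_fin mulr_ge0 ?invr_ge0// sumr_ge0.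
rewrite -EFinM lee_fin /q -mulrA ler_wpM2l ?invr_ge0// mulr_suml; apply: ler_sum => v _.
rewrite -cdensE /F -[leLHS]mulr1; apply: ler_wpM2l; first by rewrite ltW// cdens_gt0.
exact: decoder_error rho0 kr Ey.
Qed.

(** By [expR_energy_le] the hypothesis bounds the average of [expR (sg * (L + h r * W - A))], with
    [W] the input energy; [t <= expR t] passes to the average of the exponent. The term [- 1]
    removes the share of the noise in the output energy. *)
Lemma avg_power_le (c : book) (r : 'I_s.+1) (sg A : R) :
  (0 < L)%N -> 0 < h r -> 0 < sg -> sg < 2^-1 ->
  (\int[nu]_y (\sum_(p : msgspace M * msgspace V) (nM^-1 * nV^-1) *
     (cdens (gain r) s c p.1 p.2 y *
      expR (sg * \sum_(t < L) (tnth y t) ^+ 2 - sg * A)))%:E <= 1)%E ->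
  (avg_power (encoder c) <= ((A / L%:R - 1 + (sg * L%:R)^-1) / h r)%:E)%E.
Proof.
move=> L_gt0 hr0 sg0 sg2; have L0 : 0 < L%:R :> R by rewrite ltr0n.
pose W (w : msgspace M) (v : msgspace V) : R := \sum_(t < L) (tnth (signal c w v) t) ^+ 2.
have -> : avg_power (encoder c) = (L%:R^-1 * (nM^-1 * \sum_w (nV^-1 * \sum_v W w v)))%:E.
  rewrite [in RHS]mulrA EFinM /avg_power -[nmsg R M]/nM invfM; congr (_ * _)%E.
  rewrite -sumEFin; apply: eq_bigr => w _.
  rewrite exchange_big /= mulr_sumr -sumEFin; apply: eq_bigr => t _.
  rewrite (@integral_umix _ X R (msgspace V) v0 (signal c w) (fun x => tnth x t ^+ 2))//.
  - by apply: measurable_funX; exact: measurable_tnth.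
  - by move=> x; exact: sqr_ge0.
pose F w v (y : X) := cdens (gain r) s c w v y *
  expR (sg * \sum_(t < L) (tnth y t) ^+ 2 - sg * A).
have mF w v : measurable_fun setT (F w v).
  apply: measurable_funM; first exact: (measurable_fun_pair2 c (measurable_cdens _ _ _ _)).
  apply: measurableT_comp => //; apply: measurable_funB => //.
  apply: measurable_funM => //; apply: measurable_sum => t; apply: measurable_funX.
  exact: measurable_tnth.
have F0 w v y : 0 <= F w v y by rewrite mulr_ge0 ?expR_ge0// ltW// cdens_gt0.
rewrite (@integral_message_avg F mF F0) => le1.
rewrite lee_fin ler_pdivlMr//.
have key : nM^-1 * \sum_w (nV^-1 * \sum_v (sg * (L%:R + h r * W w v - A))) <= 1.
  rewrite -lee_fin; apply: le_trans le1; rewrite EFinM.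
  apply: lee_wpmul2l; first by rewrite lee_fin invr_ge0.
  rewrite -sumEFin; apply: lee_sum => w _.
  rewrite (_ : (fun y => _) = (fun y => (nV^-1)%:E * \sum_v (F w v y)%:E)%E); last first.
    by apply/funext => y; rewrite sumEFin -EFinM.
  have F0' v y : setT y -> (0 <= (F w v y)%:E)%E by move=> _; rewrite lee_fin.
  have mF' v : measurable_fun setT (fun y => (F w v y)%:E) by exact/measurable_EFinP.
  rewrite ge0_integralZl_EFin ?invr_ge0//; last 2 first.
  - by move=> y _; apply: sume_ge0 => v _; rewrite lee_fin.
  - by apply: emeasurable_sum => v.
  rewrite ge0_integral_sum// EFinM; apply: lee_wpmul2l; first by rewrite lee_fin invr_ge0.
  rewrite -sumEFin; apply: lee_sum => v _.
  have sg0' := ltW sg0.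
  have := expR_energy_le (gain r) (words c (full w v)) sg0' sg2.
  rewrite (_ : \sum_(t < L) (1 + lmean (gain r) s (words c (full w v)) t ^+ 2) =
     L%:R + h r * W w v); last first.
    rewrite big_split /= sumr_const card_ord mulr_sumr; congr (_ + _).
    by apply: eq_bigr => t _; rewrite lmean_signal exprMn sqr_sqrtr// ltW.
  move=> en; apply: (@le_trans _ _ (expR (- (sg * A)) * expR (sg * (L%:R + h r * W w v)))%:E).
    rewrite lee_fin -expRD; apply: le_trans (expR_ge1Dx _); rewrite mulrBr; lra.
  rewrite (_ : (fun y => _) = (fun y => (expR (- (sg * A)))%:E *
     (cdens (gain r) s c w v y * expR (sg * \sum_(t < L) (tnth y t) ^+ 2))%:E)%E); last first.
    by apply/funext => y; rewrite /F expRD -EFinM; congr _%:E; ring.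
  rewrite ge0_integralZl_EFin ?expR_ge0//.
  - by rewrite EFinM; apply: lee_wpmul2l => //; rewrite lee_fin expR_ge0.
  - by move=> y _; rewrite lee_fin mulr_ge0 ?expR_ge0// ltW// cdens_gt0.
  - apply/measurable_EFinP; apply: measurable_funM.
      exact: (measurable_fun_pair2 c (measurable_cdens _ _ _ _)).
    apply: measurableT_comp => //.
    apply: measurable_funM => //; apply: measurable_sum => t; apply: measurable_funX.
    exact: measurable_tnth.
move: key; set Z := nM^-1 * \sum_w (nV^-1 * \sum_v W w v).
have -> : nM^-1 * \sum_w (nV^-1 * \sum_v (sg * (L%:R + h r * W w v - A))) =
    sg * (L%:R + h r * Z - A).
  have E w : nV^-1 * \sum_v (sg * (L%:R + h r * W w v - A)) =
      sg * (L%:R - A) + sg * h r * (nV^-1 * \sum_v W w v).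
    rewrite (eq_bigr (fun v => sg * (L%:R - A) + sg * h r * W w v)); last by move=> v _; ring.
    by apply: avg_affine; apply/card_gt0P; exists v0.
  rewrite (eq_bigr _ (fun w _ => E w)) avg_affine; first by rewrite /Z; ring.
  by apply/card_gt0P; exists w0.
move=> key; rewrite -(ler_pM2l L0) -(ler_pM2l sg0).
apply: le_trans (_ : sg * (A - L%:R) + 1 <= _).
  rewrite [leLHS](_ : _ = sg * (h r * Z)); last by field; rewrite gt_eqF.
  by move: key; rewrite !mulrDr !mulrN; lra.
by rewrite le_eqVlt; apply/orP; left; apply/eqP; field; rewrite !gt_eqF.
Qed.

Lemma class_cardE n (w : msgspace M) :
  class_card n w = #|[pred w' : msgspace M | agree_ge n w w']|%:R :> R.
Proof. by rewrite /class_card -sum1_card natr_sum. Qed.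

Lemma intL_ge0 n (F : n.-tuple R -> \bar R) : (forall y, 0 <= F y)%E -> (0 <= intL F)%E.
Proof.
elim: n F => [|n IH] F F0 /=; first exact: F0.
by apply: integral_ge0 => y _; apply: IH.
Qed.

(** The final [1] is the price in nats of adding the marginal density to the relative-entropy
    integrands; it becomes negligible after division by the block length. *)
Lemma secrecy_MI_le (r : 'I_s.+1) (rho B : R) (c : book) : 0 < rho -> 0 <= B ->
  (secrecy_MI h (encoder c) r <=
   ((ln 2)^-1)%:E * (\int[nu]_y (\sum_(p : msgspace M * msgspace V) (nM^-1 * nV^-1) *
     (cdens (gain r) s c p.1 p.2 y * leak_bound (gain r) r rho B c p.1 p.2 y))%:E + 1))%E.
Proof.
move=> rho0 B0; have ln20 : 0 < ln 2 :> R by rewrite ln_gt0// ltr1n.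
pose q (w : msgspace M) (y : X) : R :=
  nV^-1 * \sum_(v : msgspace V) gdens (gain r) s (words c (full w v)) y.
pose Cw (w : msgspace M) (y : X) : R :=
  (class_card r w)^-1 * \sum_(w' | agree_ge r w w') q w' y.
pose mg (y : X) : R := nM^-1 * \sum_w q w y.
have q0 w y : 0 < q w y.
  rewrite mulr_gt0 ?invr_gt0// (bigD1 v0)//= ltr_pwDl ?gdens_gt0// sumr_ge0// => v _.
  by rewrite ltW// gdens_gt0.
have Cw0 w y : 0 < Cw w y.
  rewrite mulr_gt0 ?invr_gt0 ?class_card_gt0// (bigD1 w) ?agree_ge_refl//=.
  by rewrite ltr_pwDl ?q0// sumr_ge0// => w' _; rewrite ltW.
have mg0 y : 0 < mg y.
  rewrite mulr_gt0 ?invr_gt0// (bigD1 w0)//= ltr_pwDl ?q0// sumr_ge0// => w _.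
  by rewrite ltW.
have mq w : measurable_fun setT (q w).
  by apply: measurable_funM => //; apply: measurable_sum => v; exact: measurable_gdens_words.
have mmg : measurable_fun setT mg.
  by apply: measurable_funM => //; apply: measurable_sum => w; exact: mq.
have mCw w : measurable_fun setT (Cw w).
  apply: measurable_funM => //.
  rewrite (_ : (fun y => _) = fun y => \sum_w' if agree_ge r w w' then q w' y else 0).
    by apply: measurable_sum => w'; case: (agree_ge r w w').
  by apply/funext => y; rewrite big_mkcond.
pose G w y := Cw w y * ln (Cw w y / mg y).
have mG w : measurable_fun setT (G w).
  apply: measurable_funM => //.
  rewrite (_ : (fun y => _) = fun y => ln (Cw w y) - ln (mg y)); last first.
    by apply/funext => y; rewrite ln_div ?posrE.
  by apply: measurable_funB; exact: measurableT_comp.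
have condE w y : cond_dens h (encoder c) r w y = (Cw w y)%:E.
  rewrite /cond_dens /Cw class_cardE EFinM; congr (_ * _)%E.
  by rewrite -sumEFin; apply: eq_bigr => w' _; rewrite out_dens_encoder.
have margE y : marg_dens h (encoder c) r y = (mg y)%:E.
  rewrite /marg_dens /mg EFinM; congr (_ * _)%E.
  by rewrite -sumEFin; apply: eq_bigr => w' _; rewrite out_dens_encoder.
have Gmg0 w y : 0 <= G w y + mg y.
  by have := xlnx_ge (Cw0 w y) (mg0 y); rewrite -/(G w y); have := Cw0 w y; lra.
have KLle w : (KL (cond_dens h (encoder c) r w) (marg_dens h (encoder c) r) <=
    \int[nu]_y ((G w y + mg y) * gweight y)%:E)%E.
  rewrite /KL.
  rewrite (_ : (fun y => _) = fun y => (G w y)%:E); last first.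
    by apply/funext => y; rewrite condE margE.
  (* Dropping the negative part avoids any integrability question. The positive part is at most
     [G w y + mg y], which [xlnx_ge] shows to be nonnegative. *)
  rewrite /intRL; apply: (@le_trans _ _ (intL (fun y => maxe (G w y)%:E 0%E))).
    rewrite -[leRHS]adde0 leeD// oppe_le0; apply: intL_ge0 => y.
    by rewrite le_max lexx orbT.
  rewrite intL_iid; last 2 first.
  - by apply: measurable_maxe => //; exact/measurable_EFinP.
  - by move=> y; rewrite le_max lexx orbT.
  apply: ge0_le_integral => //.
  - move=> y _; rewrite mule_ge0 ?le_max ?lexx ?orbT// lee_fin ltW// gweight_gt0//.
  - apply: emeasurable_funM; last by apply/measurable_EFinP; exact: measurable_gweight.
    by apply: measurable_maxe => //; exact/measurable_EFinP.
  - apply/measurable_EFinP; apply: measurable_funM; last exact: measurable_gweight.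
    exact: measurable_funD.
  move=> y _; rewrite [leRHS]EFinM; apply: lee_wpmul2r.
    by rewrite lee_fin ltW// gweight_gt0.
  by rewrite ge_max !lee_fin Gmg0 lerDl ltW.
pose H1 w (y : X) : R := nV^-1 * \sum_(v : msgspace V) cdens (gain r) s c w v y *
  leak_bound (gain r) r rho B c w v y.
pose H2 w (y : X) : R := nV^-1 * \sum_(v : msgspace V) cdens (gain r) r c w v y.
have pw y : \sum_w (G w y + mg y) * gweight y <= \sum_w H1 w y + \sum_w H2 w y.
  have rs : (r <= s)%N by rewrite -ltnS.
  have := @leakage_pointwise R s M V V_gt0 r rs (fun k w v => cdens (gain r) k c w v y)
    (fun k w v => cdens_gt0 (gain r) k c w v y)
    (fun k w w' v v' e => cdens_eq (gain r) c y e) w0 v0.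
  cbv zeta => le.
  have qE w : nV^-1 * \sum_v cdens (gain r) s c w v y = q w y * gweight y.
    by rewrite /q -mulrA mulr_suml.
  have CE w : (class_card r w)^-1 * (\sum_(w' | agree_ge r w w')
      (nV^-1 * \sum_v cdens (gain r) s c w' v y)) = Cw w y * gweight y.
    by rewrite /Cw -mulrA mulr_suml; congr (_ * _); apply: eq_bigr => w' _.
  have mE : nM^-1 * (\sum_w (nV^-1 * \sum_v cdens (gain r) s c w v y)) = mg y * gweight y.
    by rewrite /mg -mulrA mulr_suml; congr (_ * _); apply: eq_bigr => w' _.
  apply: le_trans (le_trans _ le) _.
    apply: ler_sum => w _; rewrite CE mE mulrDl lerD2r /G.
    rewrite -[X in X <= _]mulrAC.
    have -> : Cw w y * gweight y / (mg y * gweight y) = Cw w y / mg y.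
      by field; rewrite !gt_eqF ?gweight_gt0 ?mg0.
    by [].
  rewrite lerD2r; apply: ler_sum => w _; rewrite ler_wpM2l ?invr_ge0//.
  apply: ler_sum => v _; apply: ler_wpM2l; first by rewrite ltW// cdens_gt0.
  by apply: ler_sum => k _; exact: ln_mixV_le.
pose F w v y := cdens (gain r) s c w v y * leak_bound (gain r) r rho B c w v y.
have nF w v := nnm_leak_bound (gain r) r w v rho0 B0.
have mF w v : measurable_fun setT (F w v) by exact: (measurable_fun_pair2 c (nF w v).1).
have F0 w v y : 0 <= F w v y by exact: (nF w v).2.
rewrite (@integral_message_avg F mF F0).
have mH1 w : measurable_fun setT (fun y => (H1 w y)%:E).
  by apply/measurable_EFinP; apply: measurable_funM => //; apply: measurable_sum => v; exact: mF.
have mH2 w : measurable_fun setT (fun y => (H2 w y)%:E).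
  apply/measurable_EFinP; apply: measurable_funM => //; apply: measurable_sum => v.
  exact: (measurable_fun_pair2 c (measurable_cdens _ _ _ _)).
have H10 w y : (0 <= (H1 w y)%:E)%E.
  by rewrite lee_fin mulr_ge0 ?invr_ge0// sumr_ge0// => v _; exact: F0.
have H20 w y : (0 <= (H2 w y)%:E)%E.
  by rewrite lee_fin mulr_ge0 ?invr_ge0// sumr_ge0// => v _; rewrite ltW// cdens_gt0.
have mGw w : measurable_fun setT (fun y => ((G w y + mg y) * gweight y)%:E).
  apply/measurable_EFinP; apply: measurable_funM; last exact: measurable_gweight.
  exact: measurable_funD.
have Gw0 w y : (0 <= ((G w y + mg y) * gweight y)%:E)%E.
  by rewrite lee_fin mulr_ge0// ltW// gweight_gt0.
have iH2 w : (\int[nu]_y (H2 w y)%:E = 1)%E.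
  rewrite (_ : (fun y => _) = (fun y => (nV^-1)%:E * \sum_(v : msgspace V)
     (cdens (gain r) r c w v y)%:E)%E); last first.
    by apply/funext => y; rewrite sumEFin -EFinM.
  have mc v : measurable_fun setT (fun y => (cdens (gain r) r c w v y)%:E).
    by apply/measurable_EFinP; exact: (measurable_fun_pair2 c (measurable_cdens _ _ _ _)).
  have c0 v y : setT y -> (0 <= (cdens (gain r) r c w v y)%:E)%E.
    by move=> _; rewrite lee_fin ltW// cdens_gt0.
  rewrite ge0_integralZl_EFin ?invr_ge0//; last 2 first.
  - by move=> y _; apply: sume_ge0 => v _; exact: c0.
  - by apply: emeasurable_sum => v.
  rewrite ge0_integral_sum// (eq_bigr (fun=> 1%E)); last first.
    by move=> v _; exact: integral_wdens.
  by rewrite sumEFin sumr_const -EFinM mulVf// gt_eqF.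
have sumKL : (\sum_w KL (cond_dens h (encoder c) r w) (marg_dens h (encoder c) r) <=
    \sum_w \int[nu]_y (H1 w y)%:E + nM%:E)%E.
  apply: (le_trans (lee_sum _ (fun w _ => KLle w))).
  rewrite -ge0_integral_sum//.
  apply: (@le_trans _ _ (\int[nu]_y (\sum_w (H1 w y)%:E + \sum_w (H2 w y)%:E))%E).
    apply: ge0_le_integral => //.
    - by move=> y _; apply: sume_ge0.
    - by apply: emeasurable_sum => w.
    - by apply: emeasurable_funD; apply: emeasurable_sum => w.
    by move=> y _; rewrite !sumEFin -EFinD lee_fin.
  rewrite ge0_integralD//; last 4 first.
  - by move=> y _; apply: sume_ge0.
  - by apply: emeasurable_sum => w.
  - by move=> y _; apply: sume_ge0.
  - by apply: emeasurable_sum => w.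
  rewrite !ge0_integral_sum// leeD// (eq_bigr (fun=> 1%E)); last by move=> w _; exact: iH2.
  by rewrite sumEFin sumr_const.
rewrite /secrecy_MI -[nmsg R M]/nM invfM mulrC EFinM -muleA.
apply: lee_wpmul2l; first by rewrite lee_fin invr_ge0 ltW.
apply: (@le_trans _ _ ((nM^-1)%:E * (\sum_w \int[nu]_y (H1 w y)%:E + nM%:E))%E).
  by apply: lee_wpmul2l => //; rewrite lee_fin invr_ge0.
rewrite ge0_muleDr//; last by apply: sume_ge0 => w _; apply: integral_ge0.
apply: leeD; first exact: lexx.
by rewrite -EFinM mulVf ?lexx// gt_eqF.
Qed.

End code.
End superposition_code.

(** * Existence of a code at a fixed block length *)

Section one_shot.
Context {R : realType} (s L : nat) (M V : 'I_s -> nat).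
Hypothesis V_gt0 : forall k, (0 < V k)%N.
Variables (w0 : msgspace M) (v0 : msgspace V).
Local Notation X := (L.-tuple R).
Local Notation nu := (iid (@stdnormal R) L).
Local Notation book := (codebook X (@lindex s M V)).
Local Notation Gam := (iid nu #|{: {k : 'I_s & lindex M V k}}|).
Local Notation nM := (#|{: msgspace M}|%:R : R).
Local Notation nV := (#|{: msgspace V}|%:R : R).
Local Notation EG := (EE Gam nu).

Definition msg_avg (F : msgspace M -> msgspace V -> book -> X -> R) (c : book) (y : X) : R :=
  \sum_(p : msgspace M * msgspace V) (nM^-1 * nV^-1) * F p.1 p.2 c y.

Lemma nnm_msg_avg F : (forall w v, nnm (F w v)) -> nnm (msg_avg F).
Proof.
move=> nF; apply: nnm_sum => p; apply: nnmZ (nF p.1 p.2).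
by rewrite mulr_ge0 ?invr_ge0.
Qed.

Lemma EE_msg_avg F (b : R) : (forall w v, nnm (F w v)) ->
  (forall w v, (EG (F w v) <= b%:E)%E) -> (EG (msg_avg F) <= b%:E)%E.
Proof.
move=> nF Fb.
have n0 : 0 <= nM^-1 * nV^-1 by rewrite mulr_ge0 ?invr_ge0.
have -> : b = \sum_(p : msgspace M * msgspace V) (nM^-1 * nV^-1) * b.
  rewrite sumr_const card_prod -[RHS]mulr_natl natrM mulrA.
  rewrite mulrACA !mulfV ?mul1r ?mulr1// pnatr_eq0 -lt0n; apply/card_gt0P.
    by exists v0.
  by exists w0.
apply: EE_sum_le => [p|p _]; first exact: nnmZ n0 (nF p.1 p.2).
by rewrite (EEZ _ _ n0 (nF p.1 p.2)) [leRHS]EFinM; apply: lee_wpmul2l; rewrite ?lee_fin.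
Qed.

Definition power_bound (a : 'I_s -> R) (sg A : R) w v (c : book) (y : X) : R :=
  cdens a s c w v y * expR (sg * \sum_(t < L) (tnth y t) ^+ 2 - sg * A).

Let energy (sg : R) (y : X) : R := expR (sg * \sum_(t < L) (tnth y t) ^+ 2).

Let measurable_energy sg : measurable_fun setT (energy sg).
Proof.
apply: measurableT_comp => //; apply: measurable_funM => //.
by apply: measurable_sum => t; apply: measurable_funX; exact: measurable_tnth.
Qed.

Let nnm_energy a sg w v : nnm (fun (c : book) y => cdens a s c w v y * energy sg y).
Proof.
split; last by move=> c y; rewrite mulr_ge0 ?expR_ge0// ltW// cdens_gt0.
apply: measurable_funM; first exact: measurable_cdens.
exact: (measurableT_comp (measurable_energy sg) measurable_snd).
Qed.

Let power_boundE a sg A w v : power_bound a sg A w v =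
  fun c y => expR (- (sg * A)) * (cdens a s c w v y * energy sg y).
Proof.
by apply/funext => c; apply/funext => y; rewrite /power_bound expRD /energy; ring.
Qed.

Lemma nnm_power_bound a sg A w v : nnm (power_bound a sg A w v).
Proof. by rewrite power_boundE; exact: nnmZ (expR_ge0 _) (nnm_energy _ _ _ _). Qed.

Lemma EE_power_bound a (sg A : R) w v : 0 <= sg -> sg * lvar a 0 <= 4^-1 ->
  (EG (power_bound a sg A w v) <=
   (expR (L%:R * (sg * lvar a 0 + 4 * (sg * lvar a 0) ^+ 2) - sg * A))%:E)%E.
Proof.
move=> sg0 sg4; rewrite power_boundE.
have mf := measurable_energy sg; have nF := nnm_energy a sg w v.
have f0 y : 0 <= energy sg y by exact: expR_ge0.
rewrite (EEZ _ _ (expR_ge0 _) nF) addrC expRD EFinM.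
apply: lee_wpmul2l; first by rewrite lee_fin expR_ge0.
rewrite /EE /cdens (@integral_level0 _ _ _ _ _ nu nu s (@lindex s M V) (wdens a)
  (@measurable_wdens R s L a) (@wdens_gt0 R s L a) (@integral_wdens_tset R s L a) (full w v) _ mf f0).
set C := expR _.
rewrite -[leRHS](integral_prob_cst Gam).
apply: ge0_le_integral => //.
- move=> c _; apply: integral_ge0 => y _.
  by rewrite lee_fin mulr_ge0// ltW// wdens_gt0.
- apply: (@measurable_integral2 _ _ _ _ _ nu (fun c y => (wdens a 0 (words c (full w v)) y * energy sg y)%:E)).
    apply/measurable_EFinP; apply: measurable_funM; first exact: measurable_cdens.
    exact: (measurableT_comp mf measurable_snd).
  by move=> c y; rewrite lee_fin mulr_ge0// ltW// wdens_gt0.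
by move=> c _; exact: integral_wdens0_expR.
Qed.

Lemma avg_power0 (b : 'I_s -> R) (c : book) : (forall k, b k = 0) ->
  avg_power (encoder v0 b c) = 0%E.
Proof.
move=> b0; rewrite /avg_power big1 ?mule0// => w _; rewrite big1// => t _.
rewrite (@integral_umix _ X R (msgspace V) v0 (signal b c w) (fun x => tnth x t ^+ 2)).
- rewrite big1 ?mulr0// => v _; rewrite tnth_mktuple big1 ?expr0n// => j _.
  by rewrite b0 mul0r.
- by apply: measurable_funX; exact: measurable_tnth.
- by move=> x; exact: sqr_ge0.
Qed.

Local Notation slots := {: option ('I_s.+1 * bool)}.

(** The slots are one error and one leakage criterion per receiver, plus [None] for power. Zero
    amplitudes form a separate alternative because the exponential criterion controls power only up
    to the positive slack [(sg * L)^-1], for which [Q = 0] leaves no room. *)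
Lemma random_coding (h : 'I_s.+1 -> R) (b : 'I_s -> R) (th : 'I_s.+1 -> 'I_s -> R)
    (eps lam rho B sg A Q : R) :
  (0 < L)%N -> 0 < h ord0 -> 0 < eps -> 0 < lam -> 0 < rho -> rho <= 4^-1 -> 0 <= B ->
  0 <= Q ->
  (forall r : 'I_s.+1, \sum_(k < s | (k < r)%N)
     (expR (rho * th r k) * expR (L%:R * (- rho * info (gain h b r) k + 4 * rho ^+ 2)) +
      ((M k * V k)%:R - 1) * expR (- th r k)) <= eps / #|slots|.+1%:R) ->
  (forall r : 'I_s.+1, \sum_(k < s | (r <= k)%N)
     (2 + B + rho^-1 * expR (- (rho * (ln (V k)%:R + B))) *
       expR (L%:R * (rho * info (gain h b r) k + 4 * rho ^+ 2))) <= lam / #|slots|.+1%:R) ->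
  (forall k, b k = 0) \/
    [/\ 0 < sg, sg < 2^-1, sg * lvar (gain h b ord0) 0 <= 4^-1,
        expR (L%:R * (sg * lvar (gain h b ord0) 0 + 4 * (sg * lvar (gain h b ord0) 0) ^+ 2)
          - sg * A) <= #|slots|.+1%:R^-1 &
        (A / L%:R - 1 + (sg * L%:R)^-1) / h ord0 <= Q] ->
  exists (enc : msgspace M -> probability X R) (dec : 'I_s.+1 -> X -> msgspace M),
    [/\ (avg_power enc <= Q%:E)%E,
        forall r w, measurable (dec r @^-1` [set w]),
        forall (r : 'I_s.+1) (k : 'I_s), (k < r)%N -> (err_prob h enc (dec r) r k <= eps%:E)%E &
        forall r : 'I_s.+1, (secrecy_MI h enc r <= ((ln 2)^-1 * (lam + 1))%:E)%E].
Proof.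
move=> L0 h0 eps0 lam0 rho0 rho4 B0 Q0 errb leakb powb.
pose g := gain h b.
pose F (o : option ('I_s.+1 * bool)) : book -> X -> R := match o with
  | Some (r, true) => msg_avg (fun w v c y =>
      cdens (g r) s c w v y * err_bound (g r) r rho (th r) c w v y)
  | Some (r, false) => msg_avg (fun w v c y =>
      cdens (g r) s c w v y * leak_bound (g r) r rho B c w v y)
  | None => if `[< forall k, b k = 0 >] then fun _ _ => 0
            else msg_avg (power_bound (g ord0) sg A)
  end.
pose e (o : option ('I_s.+1 * bool)) : R := match o with
  Some (r, true) => eps | Some (r, false) => lam | None => 1 end.
have nerr r w v := @nnm_err_bound R s L M V (g r) r rho (th r) w v.
have nleak r w v := @nnm_leak_bound R s L M V (g r) r rho B w v rho0 B0.
have npow w v := nnm_power_bound (g ord0) sg A w v.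
have nF o : nnm (F o).
  case: o => [[r []]|] /=.
  - by apply: nnm_msg_avg => w v; exact: nerr.
  - by apply: nnm_msg_avg => w v; exact: nleak.
  - case: asboolP => _; first by split.
    by apply: nnm_msg_avg => w v; exact: npow.
have e0 o : 0 < e o by case: o => [[r []]|].
have EF o : (EG (F o) <= (e o / #|slots|.+1%:R)%:E)%E.
  case: o => [[r []]|] /=.
  - apply: EE_msg_avg => [w v|w v]; first exact: nerr.
    by apply: le_trans (EE_err_bound L V_gt0 (g r) r (th r) w v (ltW rho0) rho4) _; rewrite lee_fin.
  - apply: EE_msg_avg => [w v|w v]; first exact: nleak.
    by apply: le_trans (EE_leak_bound L V_gt0 (g r) r w v rho0 rho4 B0) _; rewrite lee_fin.
  - case: asboolP => bz; first by rewrite EE0 lee_fin divr_ge0.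
    case: powb => // -[sg0 _ sg4 pw _]; rewrite div1r.
    apply: EE_msg_avg => [w v|w v]; first exact: npow.
    by apply: le_trans (EE_power_bound _ w v (ltW sg0) sg4) _; rewrite lee_fin.
have [c cP] := exists_good_code nF e0 EF.
exists (encoder v0 b c), (fun r => decoder w0 (g r) r (th r) c); split.
- have := cP None; rewrite /=; case: asboolP => bz le1; first by rewrite avg_power0// lee_fin.
  case: powb => // -[sg0 sg2 _ _ pw].
  by apply: (le_trans (@avg_power_le R s L M V w0 v0 h b c ord0 sg A L0 h0 sg0 sg2 le1)); rewrite lee_fin.
- by move=> r w; exact: decoder_measurable.
- move=> r k kr; apply: (le_trans (@err_prob_le R s L M V w0 v0 h b r (th r) rho c k (ltW rho0) kr)).
  exact: cP (Some (r, true)).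
- move=> r; apply: (le_trans (secrecy_MI_le V_gt0 w0 v0 h b r c rho0 B0)).
  rewrite EFinM; apply: lee_wpmul2l; first by rewrite lee_fin invr_ge0 ltW// ln_gt0// ltr1n.
  by rewrite EFinD; apply: leeD => //; exact: cP (Some (r, false)).
Qed.

End one_shot.

(** * Rates and parameters *)

Section rates.
Context {R : realType} (s : nat).
Implicit Types (h : 'I_s.+1 -> R) (P : 'I_s -> R).

Definition tailpow P (k : nat) : R := \sum_(j < s | (k <= j)%N) P j.

(* Mutual information of layer k at channel gain [eta], in nats. *)
Definition cap P (eta : R) (k : nat) : R :=
  2^-1 * ln ((1 + eta * tailpow P k) / (1 + eta * tailpow P k.+1)).

Lemma tailpow_ge0 P k : (forall j, 0 <= P j) -> 0 <= tailpow P k.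
Proof. by move=> P0; apply: sumr_ge0. Qed.

Lemma tailpowS P (k : 'I_s) : tailpow P k = P k + tailpow P k.+1.
Proof.
rewrite /tailpow (bigD1 k)//=; congr (_ + _); apply: eq_bigl => j.
by rewrite ltn_neqAle eq_sym andbC.
Qed.

(** Cross-multiplying the two ratios reduces the claim to [0 <= (eta' - eta) * P k]. *)
Lemma cap_le P eta eta' (k : 'I_s) : (forall j, 0 <= P j) -> 0 <= eta -> eta <= eta' ->
  cap P eta k <= cap P eta' k.
Proof.
move=> P0 e0 ee'; have e'0 := le_trans e0 ee'.
have T0 := tailpow_ge0 k.+1 P0; have p0 := P0 k.
have d x : 0 <= x -> 0 < 1 + x * tailpow P k.+1 by move=> x0; have := mulr_ge0 x0 T0; lra.
have n x : 0 <= x -> 0 < 1 + x * tailpow P k.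
  by move=> x0; rewrite tailpowS; have := mulr_ge0 x0 T0; have := mulr_ge0 x0 p0; lra.
rewrite /cap ler_wpM2l ?invr_ge0// ler_ln ?posrE ?divr_gt0 ?d ?n//.
rewrite ler_pdivrMr ?d// mulrAC ler_pdivlMr ?d// tailpowS.
have : 0 <= (eta' - eta) * P k by rewrite mulr_ge0// subr_ge0.
lra.
Qed.

Lemma rate_cap h P (k : 'I_s) : (forall j, 0 < h j) -> (forall j, 0 <= P j) ->
  rate h P k * ln 2 = cap P (h (lift ord0 k)) k - cap P (h (widen_ord (leqnSn s) k)) k.
Proof.
move=> h0 P0; have ln20 : ln 2 != 0 :> R by rewrite gt_eqF// ln_gt0// ltr1n.
have T0 := tailpow_ge0 k.+1 P0.
have E eta : 0 < eta -> 1 + eta * P k / (1 + eta * interf P k) =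
    (1 + eta * tailpow P k) / (1 + eta * tailpow P k.+1).
  move=> e0; rewrite tailpowS -[interf P k]/(tailpow P k.+1).
  by field; rewrite gt_eqF// ltr_pwDl// mulr_ge0// ltW.
by rewrite /rate /log2 /cap !E//; field.
Qed.

Lemma lvar_gain h P (theta : R) r k : 0 <= h r -> 0 <= theta -> (forall j, 0 <= P j) ->
  lvar (gain h (fun j => Num.sqrt (theta * P j)) r) k = 1 + h r * (theta * tailpow P k).
Proof.
move=> h0 t0 P0; rewrite /lvar; congr (_ + _); rewrite !mulr_sumr; apply: eq_bigr => j _.
by rewrite /gain exprMn !sqr_sqrtr// mulr_ge0.
Qed.

(** From [expR (- delta) * (1 + x) <= 1 + expR (- delta) * x <= 1 + x]: shrinking the power costs at
    most [delta] nats. *)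
Lemma ln_shrink (delta x : R) : 0 <= delta -> 0 <= x ->
  ln (1 + x) - delta <= ln (1 + expR (- delta) * x) <= ln (1 + x).
Proof.
move=> d0 x0; have t0 := expR_gt0 (- delta).
have t1 : expR (- delta) <= 1 by rewrite -expR0 ler_expR; lra.
have tx : expR (- delta) * x <= x by rewrite ler_piMl.
have tx0 : 0 <= expR (- delta) * x by rewrite mulr_ge0// ltW.
apply/andP; split; last by rewrite ler_ln ?posrE; lra.
have q0 : 0 < expR (- delta) * (1 + x) by rewrite mulr_gt0//; lra.
rewrite (_ : ln (1 + x) - delta = ln (expR (- delta) * (1 + x))); last first.
  by rewrite lnM ?posrE ?expRK ?ltr_pwDl//; lra.
by rewrite (ler_ln q0) ?posrE; lra.
Qed.

Lemma info_near h P (delta : R) r (k : 'I_s) : 0 <= h r -> 0 <= delta -> (forall j, 0 <= P j) ->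
  cap P (h r) k - delta <=
    info (gain h (fun j => Num.sqrt (expR (- delta) * P j)) r) k <= cap P (h r) k + delta.
Proof.
move=> h0 d0 P0; have t0 := expR_ge0 (- delta).
rewrite /info !lvar_gain// /cap.
have y0 m : 0 <= h r * tailpow P m by rewrite mulr_ge0// tailpow_ge0.
have z0 m : 0 <= h r * (expR (- delta) * tailpow P m).
  by rewrite mulrCA mulr_ge0.
rewrite !ln_div ?posrE ?ltr_pwDl//.
have := ln_shrink d0 (y0 k); have := ln_shrink d0 (y0 k.+1).
rewrite ![expR _ * (h r * _)]mulrCA => /andP[? ?] /andP[? ?].
apply/andP; split; lra.
Qed.

End rates.

Lemma natceil_bounds {R : realType} (x : R) : 0 < x ->
  [/\ (0 < `|Num.ceil x|)%N, x <= `|Num.ceil x|%:R & `|Num.ceil x|%:R <= x + 1].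
Proof.
move=> x0; have c0 : 0 < Num.ceil x by rewrite ceil_gt0.
have E : `|Num.ceil x|%:R = (Num.ceil x)%:~R :> R by rewrite -[in RHS](gtz0_abs c0).
split; first by rewrite absz_gt0 gt_eqF.
- by rewrite E ceil_ge.
- by rewrite E; have := ceilB1_lt x; rewrite rmorphB /= => ?; lra.
Qed.

Lemma natceil_eq1 {R : realType} (x : R) : 0 < x -> x <= 1 -> `|Num.ceil x|%N = 1.
Proof.
move=> x0 x1; rewrite (@ceil_def _ _ 1)//; apply/andP; split => //.
Qed.

Lemma msg_numE {R : realType} (L : nat) (r : R) :
  msg_num L r = `|Num.ceil (expR (L%:R * (r * ln 2)))|%N.
Proof.
by rewrite /msg_num /powR pnatr_eq0/= mulrA.
Qed.

(** Polynomial decay is enough to reach a fixed tolerance and gives explicit thresholds on the block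
    length. *)
Lemma expRN_le {R : realType} (x : R) : 0 < x -> expR (- x) <= x^-1.
Proof.
move=> x0; rewrite expRN lef_pV2 ?posrE ?expR_gt0//.
by have := expR_ge1Dx x; lra.
Qed.

(** * Code sizes and exponents *)

Section parameters.
Context {R : realType} (s : nat) (h : 'I_s.+1 -> R) (P : 'I_s -> R) (delta : R).
Hypotheses (h_gt0 : forall r, 0 < h r)
  (h_lt : forall i j : 'I_s.+1, (i < j)%N -> h i < h j)
  (P_ge0 : forall k, 0 <= P k) (delta_gt0 : 0 < delta) (delta_le : delta <= 2^-1).

Local Notation capw k := (cap P (h (widen_ord (leqnSn s) k)) k).

Hypothesis delta_cap : forall k, 0 < P k -> 4 * delta <= capw k.

Definition amp (j : 'I_s) : R := Num.sqrt (expR (- delta) * P j).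

(** The randomization nearly fills layer [k] at receiver [k], the strongest one that must not learn
    its message. Of the slack [4 * delta], one part pays for the shrunk powers, one for the decoding
    threshold, and two remain as the decay exponent of wrong words. *)
Definition rand_num (L : nat) (k : 'I_s) : nat :=
  `|Num.ceil (expR (L%:R * (capw k - 4 * delta)))|%N.

Local Notation infor r := (info (gain h amp r)).

Lemma h_le (i j : 'I_s.+1) : (i <= j)%N -> h i <= h j.
Proof. by rewrite leq_eqVlt => /predU1P[/val_inj ->//|/h_lt/ltW]. Qed.

Lemma rate_ge0 k : 0 <= rate h P k * ln 2.
Proof.
rewrite rate_cap// subr_ge0; apply: cap_le => //; first exact: ltW.
by apply: h_le; rewrite /= /bump.
Qed.

Lemma msg_num_gt0 L k : (0 < msg_num L (rate h P k))%N.
Proof. by rewrite msg_numE; have [] := natceil_bounds (expR_gt0 (L%:R * (rate h P k * ln 2))). Qed.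

Lemma rand_num_gt0 L k : (0 < rand_num L k)%N.
Proof. by have [] := natceil_bounds (expR_gt0 (L%:R * (capw k - 4 * delta))). Qed.

Lemma ln_rand_num L k : L%:R * (capw k - 4 * delta) <= ln (rand_num L k)%:R.
Proof.
have [g0 g _] := natceil_bounds (expR_gt0 (L%:R * (capw k - 4 * delta))).
by rewrite -[leLHS]expRK (ler_ln (expR_gt0 _)) ?posrE ?ltr0n.
Qed.

Lemma cap0 eta (k : 'I_s) : 0 < eta -> P k = 0 -> cap P eta k = 0.
Proof.
move=> e0 Pk; rewrite /cap tailpowS Pk add0r divff ?ln1 ?mulr0//.
by rewrite gt_eqF// ltr_pwDl// mulr_ge0 ?tailpow_ge0// ltW.
Qed.

Lemma layer_size (L : nat) (r : 'I_s.+1) (k : 'I_s) : (k < r)%N ->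
  ((msg_num L (rate h P k) * rand_num L k)%:R - 1) *
    expR (- (L%:R * (infor r k - delta))) <= 4 * expR (- (L%:R * (2 * delta))).
Proof.
(* A layer of zero power has exactly one word: both exponents are at most zero, so both ceilings are
   [1] and the [- 1] kills the term. This is essential, as its threshold is negative and the
   exponential factor grows with [L]. *)
move=> kr; have [Pk|Pk] := eqVneq (P k) 0.
  rewrite msg_numE rate_cap// !cap0//.
  rewrite /rand_num !cap0// subr0 sub0r mulr0 expR0 natceil_eq1//.
  rewrite natceil_eq1 ?expR_gt0//; last first.
    by rewrite -expR0 ler_expR mulrN oppr_le0 mulr_ge0// mulr_ge0// ltW.
  by rewrite subrr mul0r mulr_ge0// expR_ge0.
have {}Pk : 0 < P k by rewrite lt_neqAle eq_sym Pk P_ge0.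
(* For a nonnegative exponent the ceiling at most doubles the value, which is what [delta_cap]
   secures; two ceilings give the factor [4]. *)
have half n (x : R) : 0 <= x -> n <= expR x + 1 -> n <= 2 * expR x.
  by move=> x0; have := expR_ge1Dx x; lra.
have Mle : (msg_num L (rate h P k))%:R <= 2 * expR (L%:R * (rate h P k * ln 2)) :> R.
  apply: half; first by rewrite mulr_ge0// rate_ge0.
  by rewrite msg_numE; have [] := natceil_bounds (expR_gt0 (L%:R * (rate h P k * ln 2))).
have Vle : (rand_num L k)%:R <= 2 * expR (L%:R * (capw k - 4 * delta)) :> R.
  apply: half; first by rewrite mulr_ge0// subr_ge0 delta_cap.
  by have [] := natceil_bounds (expR_gt0 (L%:R * (capw k - 4 * delta))).
apply: (@le_trans _ _ ((2 * expR (L%:R * (rate h P k * ln 2))) *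
    (2 * expR (L%:R * (capw k - 4 * delta))) * expR (- (L%:R * (infor r k - delta))))).
  rewrite ler_wpM2r ?expR_ge0//; apply: (@le_trans _ _ (msg_num L (rate h P k) * rand_num L k)%:R).
    by rewrite gerBl.
  by rewrite natrM ler_pM.
rewrite rate_cap//; set u := cap _ _ k; set v := cap _ _ k.
rewrite [leLHS](_ : _ = 4 * expR (L%:R * (u - v) + L%:R * (v - 4 * delta) -
    L%:R * (infor r k - delta))); last by rewrite !expRD; ring.
rewrite ler_pM2l// ler_expR -mulrDr -mulrBr -[leRHS]mulrN ler_wpM2l//.
have kr' : u <= cap P (h r) k.
  by apply: cap_le => //; [exact: ltW | apply: h_le].
have /andP[lo _] := @info_near R s h P delta r k (ltW (h_gt0 r)) (ltW delta_gt0) P_ge0.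
rewrite -/amp in lo; lra.
Qed.

(** The sent word fails with exponent [- delta ^+ 2 / 8 + 4 * (delta / 8) ^+ 2], that is
    [- delta ^+ 2 / 16]; wrong words decay faster, and [5] is [1 + 4]. *)
Lemma err_sum (L : nat) (r : 'I_s.+1) :
  \sum_(k < s | (k < r)%N)
     (expR (delta / 8 * (L%:R * (infor r k - delta))) *
        expR (L%:R * (- (delta / 8) * infor r k + 4 * (delta / 8) ^+ 2)) +
      ((msg_num L (rate h P k) * rand_num L k)%:R - 1) *
        expR (- (L%:R * (infor r k - delta))))
  <= s.+1%:R * (5 * expR (- (L%:R * (delta ^+ 2 / 16)))).
Proof.
set E := expR _.
apply: (@le_trans _ _ (\sum_(k < s | (k < r)%N) 5 * E)).
  apply: ler_sum => k kr; apply: le_trans (_ : E + 4 * E <= _); last by lra.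
  apply: lerD.
    rewrite -expRD ler_expR le_eqVlt; apply/orP; left; apply/eqP; by field.
  apply: (le_trans (layer_size L kr)); rewrite ler_pM2l// ler_expR lerN2 ler_wpM2l//.
  have : delta * delta <= delta * 2^-1 by rewrite ler_pM2l.
  by rewrite expr2; have := delta_gt0; lra.
rewrite sumr_const -[leLHS]mulr_natl ler_wpM2r ?mulr_ge0 ?expR_ge0// ler_nat.
by rewrite (leq_trans (max_card _))// card_ord.
Qed.

(** The allowance [6 * delta * L] covers [4 * delta] from [rand_num] and [delta] from the shrunk
    powers. The last [delta] exceeds the [delta / 2] of the quadratic term, so each exponential
    factor is at most one. *)
Lemma leak_sum (L : nat) (r : 'I_s.+1) :
  \sum_(k < s | (r <= k)%N)
     (2 + 6 * delta * L%:R + (delta / 8)^-1 *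
       expR (- (delta / 8 * (ln (rand_num L k)%:R + 6 * delta * L%:R))) *
       expR (L%:R * (delta / 8 * infor r k + 4 * (delta / 8) ^+ 2)))
  <= s.+1%:R * (2 + 6 * delta * L%:R + 8 / delta).
Proof.
set T := 2 + _; have T0 : 0 <= T by rewrite addr_ge0// mulr_ge0// mulr_ge0// ltW.
have d8 : 0 <= 8 / delta by rewrite divr_ge0// ltW.
apply: (@le_trans _ _ (\sum_(k < s | (r <= k)%N) (T + 8 / delta))).
  apply: ler_sum => k rk; rewrite lerD2l -mulrA -expRD invf_div -[leRHS]mulr1.
  rewrite ler_wpM2l// -[leRHS]expR0 ler_expR.
  have kr' : cap P (h r) k <= capw k.
    by apply: cap_le => //; [exact: ltW | apply: h_le].
  have /andP[_ hi] := @info_near R s h P delta r k (ltW (h_gt0 r)) (ltW delta_gt0) P_ge0.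
  rewrite -/amp in hi.
  have d0 : 0 <= delta / 8 by rewrite divr_ge0// ltW.
  have := ln_rand_num L k => lnV.
  have : delta / 8 * (L%:R * (capw k - 4 * delta)) <= delta / 8 * ln (rand_num L k)%:R.
    by rewrite ler_wpM2l.
  have : L%:R * (delta / 8) * infor r k <= L%:R * (delta / 8) * (capw k + delta).
    by rewrite ler_wpM2l ?mulr_ge0//; lra.
  have : 0 <= L%:R * delta ^+ 2 by rewrite mulr_ge0// sqr_ge0.
  lra.
rewrite sumr_const -[leLHS]mulr_natl; apply: ler_wpM2r; first exact: addr_ge0.
rewrite ler_nat.
by rewrite (leq_trans (max_card _))// card_ord.
Qed.

End parameters.

Lemma cap_gt0 {R : realType} (s : nat) (P : 'I_s -> R) (eta : R) (k : 'I_s) :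
  (forall j, 0 <= P j) -> 0 < eta -> 0 < P k -> 0 < cap P eta k.
Proof.
move=> P0 e0 Pk; have T0 := tailpow_ge0 k.+1 P0.
have d0 : 0 < 1 + eta * tailpow P k.+1 by rewrite ltr_pwDl// mulr_ge0// ltW.
rewrite /cap mulr_gt0 ?invr_gt0// ln_gt0// ltr_pdivlMr// mul1r tailpowS.
by rewrite ltrD2l ltr_pM2l// ltrDr.
Qed.

(** [D] is the gap between the received power allowed and the shrunk one. The energy level per
    symbol, [1 + x * (1 + theta) / 2], sits midway: one half of the gap yields exponential decay,
    the other absorbs [(sg * L)^-1]. The choice of [sg] makes the quadratic term [sg * D / 4], half
    of the linear gain [sg * D / 2]. *)
Lemma power_choice {R : realType} (x theta K L : R) :
  let v := 1 + theta * x in let D := x * (1 - theta) in let sg := D / (16 * v ^+ 2) in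
  0 < x -> 2^-1 <= theta -> theta < 1 -> 1 <= K -> 4 * K / (sg * D) <= L ->
  [/\ 0 < sg, sg < 2^-1, sg * v <= 4^-1,
    expR (L * (sg * v + 4 * (sg * v) ^+ 2) - sg * (L * (1 + x * (1 + theta) / 2))) <= K^-1 &
    L * (1 + x * (1 + theta) / 2) / L - 1 + (sg * L)^-1 <= x].
Proof.
move=> v D sg x0 t2 t1 K1.
have v1 : 1 <= v by rewrite lerDl mulr_ge0// ?(ltW x0)//; lra.
have v0 : 0 < v by lra.
have D0 : 0 < D by rewrite mulr_gt0// subr_gt0.
have sg0 : 0 < sg by rewrite divr_gt0// mulr_gt0// exprn_gt0.
have K0 : 0 < K by lra.
have sD0 : 0 < sg * D by rewrite mulr_gt0.
rewrite ler_pdivrMr// => LK.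
have L0 : 0 < L by rewrite -(pmulr_lgt0 _ sD0); apply: lt_le_trans LK; rewrite mulr_gt0.
have sgv : sg * v <= 4^-1.
  have -> : sg * v = D / (16 * v) by rewrite /sg; field; rewrite gt_eqF.
  rewrite ler_pdivrMr ?mulr_gt0// (_ : 4^-1 * (16 * v) = 4 * v); last by field.
  have : x * (1 - theta) <= x * theta by rewrite ler_pM2l//; lra.
  rewrite /D /v mulrC; lra.
have sgv1 : sg <= sg * v by rewrite ler_peMr// ltW.
split => //; first by lra.
- have -> : L * (sg * v + 4 * (sg * v) ^+ 2) - sg * (L * (1 + x * (1 + theta) / 2)) =
      - (L * (sg * D) / 4).
    have -> : (sg * v) ^+ 2 = sg * (D / 16) by rewrite /sg; field; rewrite gt_eqF.
    by rewrite /v /D; field.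
  apply: (le_trans (expRN_le _)); first by rewrite divr_gt0// mulr_gt0.
  have t0 : 0 < L * (sg * D) / 4 by rewrite divr_gt0// mulr_gt0.
  by rewrite (lef_pV2 t0 K0) ler_pdivlMr// mulrC.
have -> : L * (1 + x * (1 + theta) / 2) / L - 1 = x - D / 2.
  by rewrite /D; field; rewrite gt_eqF.
have : (sg * L)^-1 <= D / 2.
  have sL0 : 0 < sg * L by rewrite mulr_gt0.
  rewrite -[leLHS]mul1r ler_pdivrMr// (_ : D / 2 * (sg * L) = L * (sg * D) / 2); last by field.
  rewrite ler_pdivlMr//; apply: le_trans LK; lra.
clearbody sg; lra.
Qed.

Theorem theorem9 (R : realType) (s : nat) (h : 'I_s.+1 -> R) (Pmax : R)
    (P : 'I_s -> R) :
  0 < h ord0 ->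
  (forall i j : 'I_s.+1, (i < j)%N -> h i < h j) ->
  (forall k, 0 <= P k) ->
  \sum_(k < s) P k <= Pmax ->
  achievable h Pmax (rate h P).
Proof.
move=> h00 h_lt P0 Pmaxle eps eps0.
have h0 r : 0 < h r.
  have [->//|r0] := eqVneq r ord0.
  by apply: lt_trans h00 (h_lt _ _ _); rewrite lt0n.
have ln20 : 0 < ln 2 :> R by rewrite ln_gt0// ltr1n.
pose K : R := #|{: option ('I_s.+1 * bool)}|.+1%:R.
have K1 : 1 <= K by rewrite ler1n.
have K0 : 0 < K by lra.
pose Lam := K * s.+1%:R; have Lam0 : 0 < Lam by rewrite mulr_gt0// ltr0n.
pose capw (k : 'I_s) := cap P (h (widen_ord (leqnSn s) k)) k.
have [delta [d0 d2 dL dcap]] : exists delta : R, [/\ 0 < delta, delta <= 2^-1,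
    12 * Lam * delta <= eps * ln 2 & forall k, 0 < P k -> 4 * delta <= capw k].
  (* The [12] leaves half of the leakage budget to the allowance [6 * delta * L]; the minimum over
     layers of positive power keeps the exponents of [rand_num] nonnegative. *)
  pose d1 := Order.min 2^-1 (eps * ln 2 / (12 * Lam)).
  exists (\big[Order.min/d1]_(k < s | 0 < P k) (capw k / 4)); split.
  - apply: lt_bigmin => [|k Pk]; first by rewrite lt_min invr_gt0 ltr0n divr_gt0 ?mulr_gt0.
    by rewrite divr_gt0// cap_gt0.
  - by apply: (le_trans (bigmin_le_id _ _ _ _)); rewrite ge_min lexx.
  - rewrite mulrC -ler_pdivlMr ?mulr_gt0//.
    by apply: (le_trans (bigmin_le_id _ _ _ _)); rewrite ge_min lexx orbT.
  - by move=> k Pk; rewrite mulrC -ler_pdivlMr//; exact: bigmin_le_cond.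
pose c := delta ^+ 2 / 16; have c0 : 0 < c by rewrite divr_gt0// exprn_gt0.
pose x := h ord0 * tailpow P 0.
have x_ge0 : 0 <= x by rewrite mulr_ge0 ?(ltW h00)// tailpow_ge0.
pose theta : R := expR (- delta).
have t1 : theta < 1 by rewrite -[ltRHS]expR0 ltr_expR; lra.
have t2 : 2^-1 <= theta by have := expR_ge1Dx (- delta); rewrite -/theta; lra.
pose v := 1 + theta * x; pose D := x * (1 - theta); pose sg := D / (16 * v ^+ 2).
(* Thresholds on the block length: [C2] for decoding, [C3] for the leakage terms that do not grow
   with [L], [C4] for power. If the total power is zero, [sg * D] is [0] and so is [C4], by the
   convention on division. *)
pose C2 := s.+1%:R * 5 * K / (c * eps).
pose C3 := (Lam * (2 + 8 / delta) + 1) * 2 / (eps * ln 2).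
pose C4 := 4 * K / (sg * D).
have C20 : 0 <= C2 by apply: ltW; rewrite divr_gt0 ?mulr_gt0 ?ltr0n.
have C30 : 0 <= C3.
  have ? : 0 < 8 / delta by rewrite divr_gt0.
  by apply: ltW; rewrite divr_gt0 ?mulr_gt0// addr_gt0 ?mulr_gt0// addr_gt0.
have D_ge0 : 0 <= D by rewrite mulr_ge0// subr_ge0 ltW.
have sg_ge0 : 0 <= sg by rewrite divr_ge0// mulr_ge0// sqr_ge0.
have C40 : 0 <= C4.
  by apply: divr_ge0; [rewrite mulr_ge0// ltW | rewrite mulr_ge0].
exists (Num.truncn (C2 + C3 + C4)).+1 => L NL M.
have L0 : (0 < L)%N by exact: leq_trans NL.
have Lr0 : 0 < L%:R :> R by rewrite ltr0n.
have CL : C2 + C3 + C4 <= L%:R.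
  by apply: le_trans (ltW (truncnS_gt _)) _; rewrite ler_nat.
have M0 k : (0 < M k)%N by exact: msg_num_gt0.
have V0 k : (0 < rand_num h P delta L k)%N by exact: rand_num_gt0.
pose w0 : msgspace M := [ffun k => Ordinal (M0 k)].
pose v0 : msgspace (rand_num h P delta L) := [ffun k => Ordinal (V0 k)].
pose th (r : 'I_s.+1) k := L%:R * (info (gain h (amp P delta) r) k - delta).
pose lam := Lam * (2 + 6 * delta * L%:R + 8 / delta).
have Q0 : 0 <= Pmax by apply: le_trans Pmaxle; exact: sumr_ge0.
have C2L : C2 <= L%:R by lra.
have C3L : C3 <= L%:R by lra.
have C4L : C4 <= L%:R by lra.
have lam0 : 0 < lam.
  rewrite mulr_gt0// addr_gt0 ?divr_gt0// addr_gt0// mulr_gt0// mulr_gt0//.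
have rho0 : 0 < delta / 8 by rewrite divr_gt0.
have rho4 : delta / 8 <= 4^-1 by lra.
have B0 : 0 <= 6 * delta * L%:R by apply: ltW; rewrite mulr_gt0// mulr_gt0.
have errb (r : 'I_s.+1) := err_sum h0 h_lt P0 d0 d2 dcap L r.
have leakb (r : 'I_s.+1) := leak_sum h0 h_lt P0 d0 L r.
have [|||enc [dec [pw mdec er sec]]] := @random_coding R s L M _ V0 w0 v0 h (amp P delta) th
  eps lam (delta / 8) (6 * delta * L%:R) sg (L%:R * (1 + x * (1 + theta) / 2)) Pmax L0 h00 eps0
  lam0 rho0 rho4 B0 Q0.
- move=> r; apply: (le_trans (errb r)); rewrite -/K -/c.
  have cL0 : 0 < L%:R * c by rewrite mulr_gt0.
  apply: (@le_trans _ _ (s.+1%:R * 5 * (L%:R * c)^-1)).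
    by rewrite mulrA ler_wpM2l// expRN_le.
  rewrite ler_pdivrMr// mulrAC ler_pdivlMr//.
  by move: C2L; rewrite ler_pdivrMr ?mulr_gt0//; lra.
- move=> r; apply: (le_trans (leakb r)); rewrite -/K /lam /Lam.
  by rewrite le_eqVlt; apply/orP; left; apply/eqP; field; rewrite !gt_eqF.
- have [Ps|Ps] := eqVneq (tailpow P 0) 0.
    left=> k; rewrite /amp; suff -> : P k = 0 by rewrite mulr0 sqrtr0.
    by move/eqP: Ps; rewrite psumr_eq0// => /allP/(_ k (mem_index_enum _))/eqP.
  right; have x0 : 0 < x by rewrite mulr_gt0// lt_neqAle eq_sym Ps tailpow_ge0.
  have := power_choice x0 t2 t1 K1 C4L; rewrite -/D -/v -/sg => -[? ? sgv ex av].
  have lv : lvar (gain h (amp P delta) ord0) 0 = v.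
    by rewrite lvar_gain ?expR_ge0 ?(ltW h00)// /v /x mulrCA.
  rewrite lv; split => //.
  rewrite ler_pdivrMr//; apply: (le_trans av).
  by rewrite /x mulrC ler_wpM2r ?(ltW h00).
exists enc, dec; split; [exact: pw|split; [exact: mdec|split; [exact: er|move=> r]]].
apply: (@le_trans _ _ ((L%:R^-1)%:E * ((ln 2)^-1 * (lam + 1))%:E)%E).
  by apply: lee_wpmul2l; rewrite ?lee_fin ?invr_ge0.
rewrite -EFinM lee_fin mulrA -invfM mulrC ler_pdivrMr ?mulr_gt0//.
move: C3L; rewrite ler_pdivrMr ?mulr_gt0// => C3L.
have : 12 * Lam * delta * L%:R <= eps * ln 2 * L%:R by rewrite ler_wpM2r.
by rewrite /lam; lra.
Qed.
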